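(* Let $1\le t\le d$ and let $\{(\mathbf u^k_{j,i},\omega^k_i)\}_{k\ge0}$ be generated by the ALS algorithm (described in the context, with $\epsilon_1=\epsilon_2=0$) started from any initializer $(\mathbf u^0_{j,i},\omega^0_i)$, where it is assumed that there is a constant $\delta>0$ with $|\sigma_i^k|\ge \delta$ for all $k$ and all $1\le i\le R$. If the sequence has a limit point (i.e. cluster point) $(\mathbf u^*_{j,i},\omega^*_i)$ such that the matrices $V^*_j=[\mathbf v^*_{j,1},\dots,\mathbf v^*_{j,R}]$, $\mathbf v^*_{j,i}=\mathcal A\bigotimes_{l\neq j}\mathbf u^*_{l,i}$, have full column rank for $j=d-t+1,\dots,d$, then the whole sequence converges to $(\mathbf u^*_{j,i},\omega^*_i)$, which is a KKT point (in the sense of the context).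
   Context: Setting. $d\ge 1$, $1\le t\le d$, $R\ge 1$ are integers, $\mathcal A\in\mathbb R^{n_1\times\cdots\times n_d}$, and $n_j\ge R$ for $d-t+1\le j\le d$. Variables are vectors $\mathbf u_{j,i}\in\mathbb R^{n_j}$ ($1\le j\le d$, $1\le i\le R$) and $\boldsymbol\omega=(\omega_1,\dots,\omega_R)^\top\in\mathbb R^R$; $U_j=[\mathbf u_{j,1},\dots,\mathbf u_{j,R}]\in\mathbb R^{n_j\times R}$. $\bigotimes_{j=1}^d\mathbf u_{j,i}$ is the outer product and $\langle\cdot,\cdot\rangle$ the standard inner product of tensors. For vectors $\mathbf x_l\in\mathbb R^{n_l}$, $\mathcal A\bigotimes_{l\ne j}\mathbf x_l\in\mathbb R^{n_j}$ denotes the gradient of $\mathbf x_j\mapsto\langle\mathcal A,\bigotimes_{l=1}^d\mathbf x_l\rangle$. Set $\sigma_i=\langle\mathcal A,\bigotimes_{j=1}^d\mathbf u_{j,i}\rangle$, $\boldsymbol\sigma=(\sigma_1,\dots,\sigma_R)^\top$. The problem considered is to maximize $\sum_{i=1}^R\sigma_i^2$ subject to $\|\mathbf u_{j,i}\|=1$ for $1\le j\le d-t$, $1\le i\le R$, and $U_j^\top U_j=I$ for $d-t+1\le j\le d$. ALS algorithm. Input: $(\mathbf u^0_{j,i})$ satisfying the constraints with $\boldsymbol\sigma^0\ne0$; $\boldsymbol\omega^0=\boldsymbol\sigma^0/\|\boldsymbol\sigma^0\|$. For $k=0,1,2,\dots$: (a) for $j=1,\dots,d-t$ in order and $i=1,\dots,R$: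 $\mathbf v^{k+1}_{j,i}=\mathcal A\,\mathbf u^{k+1}_{1,i}\otimes\cdots\otimes\mathbf u^{k+1}_{j-1,i}\otimes\mathbf u^k_{j+1,i}\otimes\cdots\otimes\mathbf u^k_{d,i}\in\mathbb R^{n_j}$ (the contraction of $\mathcal A$ in all modes but $j$), $\tilde{\mathbf v}^{k+1}_{j,i}=\omega^k_i\mathbf v^{k+1}_{j,i}$, $\mathbf u^{k+1}_{j,i}=\tilde{\mathbf v}^{k+1}_{j,i}/\|\tilde{\mathbf v}^{k+1}_{j,i}\|$. (b) For $j=d-t+1,\dots,d$ in order: $\mathbf v^{k+1}_{j,i}$ is defined by the same formula, $\tilde{\mathbf v}^{k+1}_{j,i}=\omega^k_i\mathbf v^{k+1}_{j,i}$ ($1\le i\le R$), $\tilde V^{k+1}_j=[\tilde{\mathbf v}^{k+1}_{j,1},\dots,\tilde{\mathbf v}^{k+1}_{j,R}]$, and $U^{k+1}_j$ is the orthonormal factor of a polar decomposition $\tilde V^{k+1}_j=U^{k+1}_jH^{k+1}_j$, i.e. $(U_j^{k+1})^\top U_j^{k+1}=I$ and $H^{k+1}_j$ is symmetric positive semidefinite. (c) $\sigma^{k+1}_i=\langle\mathcal A,\bigotimes_{j=1}^d\mathbf u^{k+1}_{j,i}\rangle$, $\boldsymbol\omega^{k+1}=\boldsymbol\sigma^{k+1}/\|\boldsymbol\sigma^{k+1}\|$. KKT point. $(\mathbf u_{j,i},\omega_i)$, with $\sigma_i=\langle\mathcal A,\bigotimes_{j}\mathbf u_{j,i}\rangle$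 and $\boldsymbol\sigma\ne0$, is a KKT point if: $\|\mathbf u_{j,i}\|=1$ and $\mathcal A\bigotimes_{l\ne j}\mathbf u_{l,i}=\sigma_i\mathbf u_{j,i}$ for $1\le j\le d-t$, $1\le i\le R$; $U_j^\top U_j=I$ and there is a symmetric $\Lambda_j\in\mathbb R^{R\times R}$ with $\omega_i\,\mathcal A\bigotimes_{l\ne j}\mathbf u_{l,i}=\sum_{r=1}^R(\Lambda_j)_{i,r}\mathbf u_{j,r}$ for $d-t+1\le j\le d$, $1\le i\le R$; and $\boldsymbol\omega=\boldsymbol\sigma/\|\boldsymbol\sigma\|$. *)

(* Defs.v *)
From HB Require Import structures.
From mathcomp Require Import all_boot all_order all_algebra.
From mathcomp Require Import all_classical all_reals all_analysis.

Set Implicit Arguments.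
Unset Strict Implicit.
Unset Printing Implicit Defensive.

Import Order.TTheory GRing.Theory Num.Theory.
Import numFieldNormedType.Exports.

Local Open Scope classical_set_scope.
Local Open Scope ring_scope.

(* Modes are numbered from 0: the modes j = 1..d-t of the mathematics are the
   j : 'I_d with j < d - t (unit-norm modes), and the modes j = d-t+1..d are
   those with d - t <= j (orthonormal modes). *)

Definition multi_index (d : nat) (n : 'I_d -> nat) : finType :=
  {dffun forall j : 'I_d, 'I_(n j)}.

Definition tensor (R : realType) (d : nat) (n : 'I_d -> nat) :=
  {ffun multi_index n -> R}.

Definition tinner (R : realType) (d : nat) (n : 'I_d -> nat)
    (A B : tensor R n) : R :=
  \sum_(a : multi_index n) A a * B a.

Definition outer (R : realType) (d : nat) (n : 'I_d -> nat)
    (x : forall j : 'I_d, 'cV[R]_(n j)) : tensor R n :=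
  [ffun a : multi_index n => \prod_(j < d) x j (a j) 0].

(* Contraction of A with the x l, l != j; the value x j is not used. It is the
   gradient of x j |-> <A, outer x>: see tinner_outer_dfwith below. *)
Definition contract (R : realType) (d : nat) (n : 'I_d -> nat)
    (A : tensor R n) (j : 'I_d) (x : forall l : 'I_d, 'cV[R]_(n l)) :
    'cV[R]_(n j) :=
  \col_(b < n j) \sum_(a : multi_index n | a j == b)
     A a * \prod_(l < d | l != j) x l (a l) 0.

(* y |-> <A, outer (x with x j := y)> is linear, represented by contract A x. *)
Lemma tinner_outer_dfwith (R : realType) (d : nat) (n : 'I_d -> nat)
    (A : tensor R n) (j : 'I_d) (x : forall l : 'I_d, 'cV[R]_(n l))
    (y : 'cV[R]_(n j)) :
  tinner A (outer (eqtype.dfwith x y)) = \sum_(b < n j) contract A j x b 0 * y b 0.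
Proof.
rewrite /tinner (partition_big (fun a : multi_index n => a j) predT) //=.
apply: eq_bigr => b _; rewrite mxE mulr_suml.
apply: eq_bigr => a /eqP ab; rewrite ffunE (bigD1 j) //= dfwith_in ab.
rewrite [y b 0 * _]mulrC mulrA; congr (_ * _ * _).
by apply: eq_bigr => l lj; rewrite dfwith_out // eq_sym.
Qed.

(* The library norm `|_| on matrices is the max norm. *)
Definition enorm (R : realType) (m : nat) (x : 'cV[R]_m) : R :=
  Num.sqrt (\sum_(a < m) x a 0 ^+ 2).

(* The factor matrices U_j; the vector u_{j,i} is col i (U j). prod_topology
   is the dependent product with the product topology. *)
Definition factors (R : realType) (d : nat) (n : 'I_d -> nat) (r : nat) :=
  prod_topology (fun j : 'I_d => 'M[R]_(n j, r)).

Definition als_state (R : realType) (d : nat) (n : 'I_d -> nat) (r : nat) :=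
  (factors R n r * 'cV[R]_r)%type.

Definition sigma (R : realType) (d : nat) (n : 'I_d -> nat) (r : nat)
    (A : tensor R n) (U : factors R n r) : 'cV[R]_r :=
  \col_(i < r) tinner A (outer (fun j => col i (U j))).

(* The matrix V_j with columns v_{j,i}. *)
Definition contractions (R : realType) (d : nat) (n : 'I_d -> nat) (r : nat)
    (A : tensor R n) (U : factors R n r) (j : 'I_d) : 'M[R]_(n j, r) :=
  \matrix_(b < n j, i < r) contract A j (fun l => col i (U l)) b 0.

Definition feasible (R : realType) (d : nat) (n : 'I_d -> nat) (r t : nat)
    (U : factors R n r) : Prop :=
  (forall (j : 'I_d) (i : 'I_r), (j < d - t)%N -> enorm (col i (U j)) = 1) /\
  (forall j : 'I_d, (d - t <= j)%N -> (U j)^T *m U j = 1%:M).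

Definition psd (R : realType) (m : nat) (H : 'M[R]_m) : Prop :=
  H^T = H /\ forall y : 'cV[R]_m, 0 <= (y^T *m H *m y) 0 0.

Definition polar_factor (R : realType) (m r : nat) (V U : 'M[R]_(m, r)) : Prop :=
  U^T *m U = 1%:M /\ exists H : 'M[R]_r, psd H /\ V = U *m H.

(* The factors in force when mode j is updated: new before j, old after j. *)
Definition gauss_seidel (R : realType) (d : nat) (n : 'I_d -> nat) (r : nat)
    (U U' : factors R n r) (j : 'I_d) : factors R n r :=
  fun l => if (l < j)%N then U' l else U l.

Definition als_vtilde (R : realType) (d : nat) (n : 'I_d -> nat) (r : nat)
    (A : tensor R n) (x : als_state R n r) (U' : factors R n r) (j : 'I_d) :
    'M[R]_(n j, r) :=
  \matrix_(b < n j, i < r)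
     (x.2 i 0 * contractions A (gauss_seidel x.1 U' j) j b i).

Definition als_step (R : realType) (d : nat) (n : 'I_d -> nat) (r t : nat)
    (A : tensor R n) (x x' : als_state R n r) : Prop :=
  [/\ forall (j : 'I_d) (i : 'I_r), (j < d - t)%N ->
        col i (x'.1 j) =
        (enorm (col i (als_vtilde A x x'.1 j)))^-1
          *: col i (als_vtilde A x x'.1 j),
      forall j : 'I_d, (d - t <= j)%N ->
        polar_factor (als_vtilde A x x'.1 j) (x'.1 j)
    & x'.2 = (enorm (sigma A x'.1))^-1 *: sigma A x'.1].

(* A relation rather than a function: polar decompositions of rank-deficient
   matrices are not unique, and any choice is allowed. *)
Definition als_sequence (R : realType) (d : nat) (n : 'I_d -> nat) (r t : nat)
    (A : tensor R n) (x : nat -> als_state R n r) : Prop :=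
  [/\ feasible t (x 0%N).1,
      sigma A (x 0%N).1 != 0,
      (x 0%N).2 = (enorm (sigma A (x 0%N).1))^-1 *: sigma A (x 0%N).1
    & forall k : nat, als_step t A (x k) (x k.+1)].

Definition kkt_point (R : realType) (d : nat) (n : 'I_d -> nat) (r t : nat)
    (A : tensor R n) (x : als_state R n r) : Prop :=
  let: (U, omega) := x in
  [/\ sigma A U != 0,
      forall (j : 'I_d) (i : 'I_r), (j < d - t)%N ->
        enorm (col i (U j)) = 1 /\
        contract A j (fun l => col i (U l)) = sigma A U i 0 *: col i (U j),
      forall j : 'I_d, (d - t <= j)%N ->
        (U j)^T *m U j = 1%:M /\
        exists L : 'M[R]_r, L^T = L /\
          forall i : 'I_r,
            omega i 0 *: contract A j (fun l => col i (U l)) =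
            \sum_(s < r) L i s *: col s (U j)
    & omega = (enorm (sigma A U))^-1 *: sigma A U].

(* Main.v *)
(* The objective f = sum_i sigma_i^2 increases along the iteration by at least
   a constant times the squared step as long as the iterates stay near the limit
   point: when mode j is updated, the gain is half the quadratic form of H_j
   (the diagonal of norms, or the polar factor H) on the rows of U_j' - U_j, and
   H_j is coercive near the limit point because of the rank hypothesis. The
   first-order conditions satisfied by the updated blocks bound the slope of f
   along the constraint set at the new iterate by a constant times the step.
   Full convergence then follows from a Kurdyka-Lojasiewicz inequality for f on
   the compact semialgebraic constraint set.

   That inequality is obtained from quantifier elimination over R: a definable
   subset of R contains or avoids an interval just to the right of each point, so
   definable functions of one variable are monotone near 0+ and definable choice
   is available. Following Kurdyka, choose a definable curve x(s) at level f* - s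
   with nearly minimal slope m(s); its coordinates are monotone near 0+, so its length is
   controlled by their oscillation, and s - s' <= m(s) |x(s) - x(s')|_1 makes the
   oscillation of x a desingularizing function. *)

Require Import Defs.
From HB Require Import structures.
From mathcomp Require Import all_boot all_order all_algebra.
From mathcomp Require Import all_classical all_reals all_analysis.
From mathcomp Require Import polyrcf.
From mathcomp Require qe_rcf ordered_qelim.
From mathcomp Require Import ring lra.
Import Order.TTheory GRing.Theory Num.Theory.
Import numFieldNormedType.Exports.
Local Open Scope classical_set_scope.
Local Open Scope ring_scope.
Set Implicit Arguments.
Unset Strict Implicit.
Unset Printing Implicit Defensive.

(** * Definable predicates *)

(** The desingularizing function enters in finite-difference form: [s - s' <= m * (psi s - psi s')]
    for levels [s' <= s] and any slope bound [m] at level [s]. A concave [psi] with [psi' >= 1 / m]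
    would satisfy it, but no derivative is ever taken; likewise the slope bounds difference
    quotients within the constraint set, so no tangent space occurs.

    A nearly minimal slope can be chosen only where the infimum over a level is positive. The test
    value [m = s] settles this: a curve with slope at most [s] at level [s] would have length at
    least 1/2 between the levels [s / 2] and [s], hence unbounded oscillation in a bounded set.

    Two circularities shape the rest. Coercivity of [H_j] is known only near the cluster point,
    whereas neither the intermediate points of a sweep nor the later iterates are known to stay
    there: a small total gain controls the former mode by mode, a decreasing potential the latter.
    And the slope at an iterate is bounded by the step that led to it, not by the next one, hence a
    recursion over two consecutive steps. *)

(* A context is a space of real parameters with its coordinate functions; the
   inductive [definable] below consists of the first-order formulas over the
   ordered field [R] in these coordinates, with constants from [R]. *)
Record ctx (R : realType) := Ctx { ctx_sort :> Type; coordinate : (ctx_sort -> R) -> Prop }.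
Arguments coordinate {R} c _.

Definition real_ctx (R : realType) := @Ctx R R (fun b => b = id).
Canonical real_ctx.

Definition prod_ctx (R : realType) (C D : ctx R) := @Ctx R (C * D)%type
  (fun b => (exists2 b', coordinate C b' & b = b' \o fst) \/
            (exists2 b', coordinate D b' & b = b' \o snd)).
Canonical prod_ctx.

Definition ffun_ctx (R : realType) (I : finType) := @Ctx R {ffun I -> R}
  (fun b => exists i, b = (fun x : {ffun I -> R} => x i)).
Canonical ffun_ctx.

Inductive polyfun (R : realType) (C : ctx R) : (C -> R) -> Prop :=
| polyfun_coordinate b : coordinate C b -> polyfun b
| polyfun_cst k : polyfun (fun=> k)
| polyfun_add p q : polyfun p -> polyfun q -> polyfun (fun c => p c + q c)
| polyfun_mul p q : polyfun p -> polyfun q -> polyfun (fun c => p c * q c).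

Inductive definable (R : realType) : forall C : ctx R, (C -> Prop) -> Prop :=
| definable_gt0 (C : ctx R) p : polyfun p -> definable (fun c : C => 0 < p c)
| definable_not (C : ctx R) P : definable P -> definable (fun c : C => ~ P c)
| definable_and (C : ctx R) P Q :
    definable P -> definable Q -> definable (fun c : C => P c /\ Q c)
| definable_exR (C : ctx R) (P : C * R -> Prop) :
    definable (P : prod_ctx C (real_ctx R) -> Prop) ->
    definable (fun c : C => exists v, P (c, v))
| definable_ext (C : ctx R) (P Q : C -> Prop) :
    definable P -> (forall c, P c <-> Q c) -> definable Q.

Section Reindex.
Variable R : realType.
Implicit Types C D : ctx R.

Lemma polyfun_comp C D (g : D -> C) (p : C -> R) :
  (forall b, coordinate C b -> polyfun (fun d => b (g d))) ->
  polyfun p -> polyfun (fun d : D => p (g d)).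
Proof.
move=> hg; elim=> [b /hg //|k|p1 q1 _ h1 _ h2|p1 q1 _ h1 _ h2].
- exact: polyfun_cst.
- exact: polyfun_add.
- exact: polyfun_mul.
Qed.

Lemma polyfun_comp_fst C D (p : C -> R) :
  polyfun p -> polyfun (fun d : prod_ctx C D => p d.1).
Proof.
by apply: polyfun_comp => b hb; apply: polyfun_coordinate; left; exists b.
Qed.

Lemma polyfun_comp_snd C D (p : D -> R) :
  polyfun p -> polyfun (fun d : prod_ctx C D => p d.2).
Proof.
by apply: polyfun_comp => b hb; apply: polyfun_coordinate; right; exists b.
Qed.

Lemma polyfun_real : polyfun (fun x : real_ctx R => x).
Proof. exact: polyfun_coordinate. Qed.

Lemma polyfun_ffun (I : finType) (i : I) : polyfun (fun x : ffun_ctx R I => x i).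
Proof. by apply: polyfun_coordinate; exists i. Qed.

Definition polymap C D (g : D -> C) :=
  forall b, coordinate C b -> polyfun (fun d => b (g d)).

(** Substitution takes the place of renaming and weakening of variables: under the quantifier the
    map is extended by the identity on the new coordinate. *)
Lemma definable_comp C D (g : D -> C) (P : C -> Prop) :
  polymap g -> definable P -> definable (fun d : D => P (g d)).
Proof.
move=> hg dP; elim: dP D g hg => {P C}.
- by move=> C p hp D g hg; apply: definable_gt0; apply: polyfun_comp.
- by move=> C P _ IH D g hg; apply: definable_not; apply: IH.
- move=> C P Q _ IH1 _ IH2 D g hg; apply: definable_and; [exact: IH1|exact: IH2].
- move=> C P _ IH D g hg.
  apply: (@definable_exR _ D (fun dv => P (g dv.1, dv.2))).
  apply: (IH (prod_ctx D (real_ctx R)) (fun dv => (g dv.1, dv.2))) => b [] [b' hb' ->] /=.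
    by apply: (@polyfun_comp_fst D (real_ctx R) (fun d => b' (g d))); exact: hg.
  by apply: (@polyfun_comp_snd D (real_ctx R)); exact: polyfun_coordinate.
- by move=> C P Q _ IH h D g hg; apply: definable_ext (IH _ _ hg) _ => d; exact: h.
Qed.

Lemma polymap_id C : polymap (fun c : C => c).
Proof. by move=> b hb; exact: polyfun_coordinate. Qed.

Lemma polymap_pair C C1 C2 (g1 : C -> C1) (g2 : C -> C2) :
  polymap g1 -> polymap g2 -> polymap (fun c => (g1 c, g2 c) : prod_ctx C1 C2).
Proof. by move=> h1 h2 b [] [b' hb' ->] /=; [exact: h1|exact: h2]. Qed.

Lemma polymap_fst C D C' (g : D -> prod_ctx C C') :
  polymap g -> polymap (fun d => (g d).1).
Proof. by move=> h b hb; apply: (h (b \o fst)); left; exists b. Qed.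

Lemma polymap_snd C D C' (g : D -> prod_ctx C C') :
  polymap g -> polymap (fun d => (g d).2).
Proof. by move=> h b hb; apply: (h (b \o snd)); right; exists b. Qed.

Lemma polymap_real D (g : D -> real_ctx R) : polyfun g -> polymap g.
Proof. by move=> h b ->. Qed.

Lemma polyfun_polymap D (g : D -> real_ctx R) : polymap g -> polyfun g.
Proof. by move=> /(_ id); exact. Qed.

Lemma polymap_ffun D (I : finType) (g : D -> ffun_ctx R I) :
  (forall i, polyfun (fun d => g d i)) -> polymap g.
Proof. by move=> h b [i ->]; exact: h. Qed.

Lemma polymap_cst C D (c : C) : polymap (fun _ : D => c).
Proof. by move=> b hb; exact: polyfun_cst. Qed.

End Reindex.

Section Connectives.
Variable R : realType.
Implicit Types C D : ctx R.
Local Notation RC := (real_ctx R).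

Lemma definable_or C (P Q : C -> Prop) :
  definable P -> definable Q -> definable (fun c => P c \/ Q c).
Proof.
move=> hP hQ; apply: definable_ext
  (definable_not (definable_and (definable_not hP) (definable_not hQ))) _.
by move=> c; split=> [/not_andP[/contrapT|/contrapT]|]; tauto.
Qed.

Lemma definable_imp C (P Q : C -> Prop) :
  definable P -> definable Q -> definable (fun c => P c -> Q c).
Proof.
move=> hP hQ; apply: definable_ext (definable_or (definable_not hP) hQ) _.
by move=> c; split=> [[]//|h]; case: (pselect (P c)) => hp; [right; exact: h|left].
Qed.

Lemma definable_ex C (P : C -> R -> Prop) :
  definable (fun cv : prod_ctx C RC => P cv.1 cv.2) ->
  definable (fun c => exists v, P c v).
Proof. by move=> h; exact: (definable_exR (P := fun cv => P cv.1 cv.2)). Qed.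

Lemma definable_all C (P : C -> R -> Prop) :
  definable (fun cv : prod_ctx C RC => P cv.1 cv.2) ->
  definable (fun c => forall v, P c v).
Proof.
move=> h; apply: definable_ext
  (definable_not (definable_ex (P := fun c v => ~ P c v) (definable_not h))) _.
move=> c; split=> [hn v|hn [v]]; last by apply; exact: hn.
by apply: contrapT => nP; apply: hn; exists v.
Qed.

Lemma polyfun_opp C (p : C -> R) : polyfun p -> polyfun (fun c => - p c).
Proof.
move=> hp; suff -> : (fun c => - p c) = (fun c => -1 * p c).
  by apply: (@polyfun_mul _ _ (fun=> -1)) => //; exact: polyfun_cst.
by apply/funext => c; rewrite mulN1r.
Qed.

Lemma polyfun_sub C (p q : C -> R) :
  polyfun p -> polyfun q -> polyfun (fun c => p c - q c).
Proof. by move=> hp hq; apply: polyfun_add => //; apply: polyfun_opp. Qed.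

Lemma polyfun_sum C (J : finType) (S : pred J) (p : J -> C -> R) :
  (forall j, polyfun (p j)) -> polyfun (fun c => \sum_(j | S j) p j c).
Proof.
move=> hp; elim: (index_enum J) => [|j s IH].
  by under eq_fun do rewrite big_nil; exact: polyfun_cst.
under eq_fun do rewrite big_cons.
by case: (S j) => //; exact: polyfun_add.
Qed.

Lemma polyfun_prod C (J : finType) (S : pred J) (p : J -> C -> R) :
  (forall j, polyfun (p j)) -> polyfun (fun c => \prod_(j | S j) p j c).
Proof.
move=> hp; elim: (index_enum J) => [|j s IH].
  by under eq_fun do rewrite big_nil; exact: polyfun_cst.
under eq_fun do rewrite big_cons.
by case: (S j) => //; exact: polyfun_mul.
Qed.

Lemma definable_lt_poly C (p q : C -> R) :
  polyfun p -> polyfun q -> definable (fun c => p c < q c).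
Proof.
move=> hp hq; apply: definable_ext (definable_gt0 (polyfun_sub hq hp)) _.
by move=> c; rewrite subr_gt0.
Qed.

Lemma definable_eq_poly C (p q : C -> R) :
  polyfun p -> polyfun q -> definable (fun c => p c = q c).
Proof.
move=> hp hq; apply: definable_ext (definable_and (definable_not (definable_lt_poly hp hq))
  (definable_not (definable_lt_poly hq hp))) _.
move=> c; split=> [[/negP h1 /negP h2]|->]; last by rewrite ltxx.
by apply/le_anti; rewrite !leNgt h1 h2.
Qed.

Lemma definable_cst C (P : Prop) : definable (fun _ : C => P).
Proof.
apply: definable_ext (definable_eq_poly (polyfun_cst C (if `[<P>] then 0 else 1 : R))
  (polyfun_cst C (0:R))) _ => _.
by case: asboolP => // nP; split=> // /eqP; rewrite oner_eq0.
Qed.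

Definition defun C (f : C -> R) :=
  definable (fun cv : prod_ctx C RC => cv.2 = f cv.1).

(** Only the graph of [f] is definable, so the value [f c] is introduced by an existential
    quantifier over that graph. *)
Lemma definable_subst C (P : C -> R -> Prop) (f : C -> R) : defun f ->
  definable (fun cv : prod_ctx C RC => P cv.1 cv.2) ->
  definable (fun c => P c (f c)).
Proof.
move=> hf hP; apply: definable_ext (definable_ex (P := fun c v => v = f c /\ P c v) _) _.
  exact: definable_and.
by move=> c; split=> [[v [-> ]]//|h]; exists (f c).
Qed.

Lemma defun_poly C (p : C -> R) : polyfun p -> defun p.
Proof.
move=> hp; apply: definable_eq_poly (polyfun_comp_fst _ hp).
exact: (polyfun_comp_snd C (polyfun_real R)).
Qed.

Lemma defun_polymap C D (g : D -> C) (f : C -> R) :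
  polymap g -> defun f -> defun (fun d => f (g d)).
Proof.
move=> hg hf.
apply: (definable_comp (P := fun cv : prod_ctx C RC => cv.2 = f cv.1)
   (g := fun dv : prod_ctx D RC => (g dv.1, dv.2))) => //.
apply: polymap_pair.
  by move=> b hb; apply: (@polyfun_comp_fst R D RC (fun d => b (g d))); exact: hg.
by apply: polymap_snd; exact: polymap_id.
Qed.

Lemma defun_comp C (h : R -> R) (f : C -> R) :
  @defun RC h -> defun f -> defun (fun c => h (f c)).
Proof.
move=> hh hf; rewrite /defun.
apply: (@definable_subst (prod_ctx C RC) (fun cv a => cv.2 = h a) (fun cv => f cv.1)).
  by apply: (defun_polymap (g := fst)) => //; apply: polymap_fst; exact: polymap_id.
apply: (definable_comp (P := fun cv : prod_ctx RC RC => cv.2 = h cv.1)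
   (g := fun dv : prod_ctx (prod_ctx C RC) RC => (dv.2, dv.1.2))) => //.
apply: polymap_pair; first by apply: polymap_snd; exact: polymap_id.
by apply: polymap_snd; apply: polymap_fst; exact: polymap_id.
Qed.

Lemma defun_op2 C (op : R -> R -> R) (f g : C -> R) :
  defun (fun ab : prod_ctx RC RC => op ab.1 ab.2) ->
  defun f -> defun g -> defun (fun c => op (f c) (g c)).
Proof.
move=> hop hf hg; rewrite /defun.
apply: (@definable_subst (prod_ctx C RC) (fun cv a => cv.2 = op a (g cv.1)) (fun cv => f cv.1)).
  by apply: (defun_polymap (g := fst)) => //; apply: polymap_fst; exact: polymap_id.
apply: (@definable_subst (prod_ctx (prod_ctx C RC) RC)
  (fun cva b => cva.1.2 = op cva.2 b) (fun cva => g cva.1.1)).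
  apply: (defun_polymap (g := fun cva : prod_ctx (prod_ctx C RC) RC => cva.1.1)) => //.
  by do 2 apply: polymap_fst; exact: polymap_id.
apply: (definable_comp (P := fun abv : prod_ctx (prod_ctx RC RC) RC => abv.2 = op abv.1.1 abv.1.2)
   (g := fun d : prod_ctx (prod_ctx (prod_ctx C RC) RC) RC => ((d.1.2, d.2), d.1.1.2))) => //.
apply: polymap_pair; last first.
  by apply: polymap_snd; do 2 apply: polymap_fst; exact: polymap_id.
apply: polymap_pair; last by apply: polymap_snd; exact: polymap_id.
by apply: polymap_snd; apply: polymap_fst; exact: polymap_id.
Qed.

Lemma defun_add C (f g : C -> R) : defun f -> defun g -> defun (fun c => f c + g c).
Proof.
apply: (@defun_op2 _ (fun a b => a + b)); apply: defun_poly.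
by apply: polyfun_add; apply: polyfun_polymap;
  [apply: polymap_fst|apply: polymap_snd]; exact: polymap_id.
Qed.

Lemma defun_mul C (f g : C -> R) : defun f -> defun g -> defun (fun c => f c * g c).
Proof.
apply: (@defun_op2 _ (fun a b => a * b)); apply: defun_poly.
by apply: polyfun_mul; apply: polyfun_polymap;
  [apply: polymap_fst|apply: polymap_snd]; exact: polymap_id.
Qed.

Lemma defun_cst C (k : R) : defun (fun _ : C => k).
Proof. by apply: defun_poly; exact: polyfun_cst. Qed.

Lemma defun_opp C (f : C -> R) : defun f -> defun (fun c => - f c).
Proof.
move=> hf; suff -> : (fun c => - f c) = (fun c => -1 * f c).
  by apply: (@defun_mul _ (fun=> -1)) => //; exact: defun_cst.
by apply/funext => c; rewrite mulN1r.
Qed.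

Lemma defun_sub C (f g : C -> R) : defun f -> defun g -> defun (fun c => f c - g c).
Proof. by move=> hf hg; apply: defun_add => //; apply: defun_opp. Qed.

Lemma definable_rel2 C (rel : R -> R -> Prop) (f g : C -> R) :
  definable (fun ab : prod_ctx RC RC => rel ab.1 ab.2) ->
  defun f -> defun g -> definable (fun c => rel (f c) (g c)).
Proof.
move=> hrel hf hg.
apply: (@definable_subst C (fun c a => rel a (g c))) => //.
apply: (@definable_subst (prod_ctx C RC) (fun ca b => rel ca.2 b) (fun ca => g ca.1)).
  by apply: (defun_polymap (g := fst)) => //; apply: polymap_fst; exact: polymap_id.
apply: (definable_comp (P := fun ab : prod_ctx RC RC => rel ab.1 ab.2)
   (g := fun d : prod_ctx (prod_ctx C RC) RC => (d.1.2, d.2))) => //.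
apply: polymap_pair; last by apply: polymap_snd; exact: polymap_id.
by apply: polymap_snd; apply: polymap_fst; exact: polymap_id.
Qed.

Lemma definable_lt C (f g : C -> R) : defun f -> defun g -> definable (fun c => f c < g c).
Proof.
apply: (@definable_rel2 _ (fun a b => a < b)); apply: definable_lt_poly;
  apply: polyfun_polymap;
  [apply: polymap_fst|apply: polymap_snd]; exact: polymap_id.
Qed.

Lemma definable_le C (f g : C -> R) : defun f -> defun g -> definable (fun c => f c <= g c).
Proof.
move=> hf hg; apply: definable_ext (definable_not (definable_lt hg hf)) _ => c.
by rewrite leNgt; split=> /negP.
Qed.

Lemma definable_eq C (f g : C -> R) : defun f -> defun g -> definable (fun c => f c = g c).
Proof.
apply: (@definable_rel2 _ (fun a b => a = b)); apply: definable_eq_poly;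
  apply: polyfun_polymap;
  [apply: polymap_fst|apply: polymap_snd]; exact: polymap_id.
Qed.

Lemma defun_abs C (f : C -> R) : defun f -> defun (fun c => `|f c|).
Proof.
apply: (@defun_comp _ (fun a => `|a|)); rewrite /defun.
have h1 : @defun (prod_ctx RC RC) fst.
  by apply: defun_poly; apply: polyfun_polymap; apply: polymap_fst; exact: polymap_id.
have h2 : @defun (prod_ctx RC RC) snd.
  by apply: defun_poly; apply: polyfun_polymap; apply: polymap_snd; exact: polymap_id.
apply: definable_ext (definable_or
  (definable_and (definable_le (defun_cst _ 0) h1) (definable_eq h2 h1))
  (definable_and (definable_lt h1 (defun_cst _ 0)) (definable_eq h2 (defun_opp h1)))) _.
move=> [a b] /=; split.
  by case=> -[h ->]; [rewrite ger0_norm|rewrite ltr0_norm].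
by move=> ->; case: (leP 0 a) => h; [left; rewrite ger0_norm|right; rewrite ltr0_norm].
Qed.

Lemma defun_sum C (J : finType) (f : J -> C -> R) :
  (forall j, defun (f j)) -> defun (fun c => \sum_j f j c).
Proof.
move=> hp; elim: (index_enum J) => [|j s IH].
  by under eq_fun do rewrite big_nil; exact: defun_cst.
by under eq_fun do rewrite big_cons; exact: defun_add.
Qed.

Lemma definable_allfin C (J : finType) (P : J -> C -> Prop) :
  (forall j, definable (P j)) -> definable (fun c => forall j, P j c).
Proof.
move=> hP.
suff h (s : seq J) : definable (fun c => forall j, j \in s -> P j c).
  by apply: definable_ext (h (enum J)) _ => c; split=> hj j;
    [apply: hj; rewrite mem_enum|move=> _; exact: hj].
elim: s => [|i s IH]; first by apply: definable_ext (definable_cst C True) _ => c; split.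
apply: definable_ext (definable_and (hP i) IH) _ => c; split.
  by move=> [hi hs] j; rewrite inE => /orP[/eqP->//|]; exact: hs.
by move=> h; split=> [|j js]; apply: h; rewrite inE ?eqxx ?js ?orbT.
Qed.

Definition ffun_upd (I : finType) (x : {ffun I -> R}) (i : I) (v : R) : {ffun I -> R} :=
  [ffun k => if k == i then v else x k].

Lemma definable_ex_ffun C (I : finType) (P : C -> {ffun I -> R} -> Prop) :
  definable (fun cx : prod_ctx C (ffun_ctx R I) => P cx.1 cx.2) ->
  definable (fun c => exists x, P c x).
Proof.
move=> hP; pose CX := prod_ctx C (ffun_ctx R I).
(* Induction on the coordinates already quantified: those outside [s] are still read from [cx.2]. *)
suff h (s : seq I) : definable (fun cx : CX =>
    exists y : {ffun I -> R}, (forall i, i \notin s -> y i = cx.2 i) /\ P cx.1 y).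
  pose g (c : C) : CX := (c, [ffun=> 0]).
  have hg : polymap g by apply: polymap_pair; [exact: polymap_id|exact: polymap_cst].
  apply: definable_ext (definable_comp hg (h (enum I))) _ => c; split.
    by case=> y [_ hy]; exists y.
  by case=> y hy; exists y; split=> // i; rewrite mem_enum.
elim: s => [|i s IH].
  apply: (definable_ext hP) => -[c x] /=; split.
    by move=> h; exists x.
  by case=> y [hy]; suff -> : x = y by []; apply/ffunP => i; rewrite hy.
pose g (cxv : prod_ctx CX RC) : CX := (cxv.1.1, ffun_upd cxv.1.2 i cxv.2).
have hg : polymap g.
  apply: polymap_pair; first by do 2 apply: polymap_fst; exact: polymap_id.
  apply: polymap_ffun => k; under eq_fun do rewrite ffunE.
  case: (k == i); apply: polyfun_polymap.
    by apply: polymap_snd; exact: polymap_id.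
  have h2 : polymap (fun d : prod_ctx CX RC => d.1.2).
    by apply: polymap_snd; apply: polymap_fst; exact: polymap_id.
  by apply: polymap_real; apply: (h2 (fun x : {ffun I -> R} => x k)); exists k.
have h : definable (fun cx : CX => exists v : R, exists y : {ffun I -> R},
    (forall k, k \notin s -> y k = ffun_upd cx.2 i v k) /\ P cx.1 y).
  by apply: definable_ex; exact: (definable_comp hg IH).
apply: (definable_ext h) => -[c x] /=; split.
  case=> v [y [hy hPy]]; exists y; split=> // k; rewrite inE negb_or => /andP[ki ks].
  by rewrite hy // ffunE (negbTE ki).
case=> y [hy hPy]; exists (y i), y; split=> // k ks; rewrite ffunE.
by case: eqP => [->//|/eqP ki]; apply: hy; rewrite inE negb_or ki.
Qed.

Lemma definable_all_ffun C (I : finType) (P : C -> {ffun I -> R} -> Prop) :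
  definable (fun cx : prod_ctx C (ffun_ctx R I) => P cx.1 cx.2) ->
  definable (fun c => forall x, P c x).
Proof.
move=> h; apply: definable_ext
  (definable_not (definable_ex_ffun (P := fun c v => ~ P c v) (definable_not h))) _.
move=> c; split=> [hn v|hn [v]]; last by apply; exact: hn.
by apply: contrapT => nP; apply: hn; exists v.
Qed.

End Connectives.

(** * O-minimality *)

Section OMinimality.
Variable R : realType.
Local Notation RC := (real_ctx R).

Lemma polyfun_term (C : ctx R) (p : C -> R) (hs : seq (C -> R)) :
  (forall b, coordinate C b ->
     exists2 i, (i < size hs)%N & forall c, nth (fun=> 0) hs i c = b c) ->
  polyfun p -> exists t, forall c, GRing.eval [seq h c | h <- hs] t = p c.
Proof.
move=> hc; elim=> [b /hc [i ilt hi]|k|p1 q1 _ [t1 h1] _ [t2 h2]|p1 q1 _ [t1 h1] _ [t2 h2]].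
- by exists (GRing.Var R i) => c /=; rewrite (nth_map (fun=> 0)).
- by exists (GRing.Const k).
- by exists (GRing.Add t1 t2) => c /=; rewrite h1 h2.
- by exists (GRing.Mul t1 t2) => c /=; rewrite h1 h2.
Qed.

(** Passage to the syntax on which quantifier elimination operates. The list [hs] interprets the
    variables, variable [i] being the coordinate [nth hs i], and a quantifier binds the fresh index
    [size hs]. *)
Lemma definable_formula (C : ctx R) (P : C -> Prop) : definable P ->
  forall hs : seq (C -> R),
  (forall b, coordinate C b ->
     exists2 i, (i < size hs)%N & forall c, nth (fun=> 0) hs i c = b c) ->
  exists f, forall c, P c <-> ordered_qelim.ord.holds [seq h c | h <- hs] f.
Proof.
elim=> {P C}.
- move=> C p hp hs hc; have [t ht] := polyfun_term hc hp.
  by exists (ordered_qelim.ord.Lt (GRing.Const 0) t) => c /=; rewrite ht.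
- move=> C P _ IH hs hc; have [f hf] := IH hs hc.
  by exists (ordered_qelim.ord.Not f) => c /=; rewrite hf.
- move=> C P Q _ IH1 _ IH2 hs hc; have [f hf] := IH1 hs hc; have [g hg] := IH2 hs hc.
  by exists (ordered_qelim.ord.And f g) => c /=; rewrite hf hg.
- move=> C P _ IH hs hc.
  pose hs' := rcons [seq (fun cv : C * R => h cv.1) | h <- hs] snd.
  have szm : size [seq (fun cv : C * R => h cv.1) | h <- hs] = size hs by rewrite size_map.
  have [|f hf] := IH hs'.
    move=> b [] [b' hb' ->].
      have [i ilt hi] := hc _ hb'.
      exists i; first by rewrite size_rcons szm ltnS ltnW.
      by move=> c; rewrite nth_rcons szm ilt (nth_map (fun=> 0)) //= hi.
    exists (size hs); first by rewrite size_rcons szm.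
    by move=> c; rewrite nth_rcons szm ltnn eqxx /= hb'.
  exists (ordered_qelim.ord.Exists (size hs) f) => c /=.
  suff e v : set_nth 0 [seq h c | h <- hs] (size hs) v = [seq h (c, v) | h <- hs'].
    by split=> -[v hv]; exists v; [rewrite e; apply/hf|apply/hf; rewrite -e].
  rewrite map_rcons -map_comp /= set_nthE size_map ltnn subnn /= -cats1.
  by congr (_ ++ _); apply: eq_map.
- move=> C P Q _ IH h hs hc; have [f hf] := IH hs hc.
  by exists f => c; rewrite -h.
Qed.

Lemma poly_sgr_right (p : {poly R}) (a : R) :
  exists2 e, 0 < e & forall x y, a < x < a + e -> a < y < a + e -> Num.sg p.[x] = Num.sg p.[y].
Proof.
have [->|p0] := eqVneq p 0; first by exists 1 => // x y _ _; rewrite !horner0.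
have a1 : a < a + 1 by rewrite ltrDl.
exists (next_root p a (a + 1) - a); first by rewrite subr_gt0; exact: next_root_gt.
by move=> x y; rewrite addrC subrK => hx hy; apply: (@sgr_neighpr_same _ p a (a + 1)).
Qed.

(** Division-free terms in one variable are polynomials, and an atom depends only on the sign of a
    difference of two of them, which is constant up to the next root. Finitely many atoms share a
    neighbourhood. *)
Lemma qf_right_constant (g : ordered_qelim.ord.formula R) (a : R) :
  ordered_qelim.ord.qf_form g && ordered_qelim.ord.rformula g ->
  exists2 e, 0 < e & forall x y, a < x < a + e -> a < y < a + e ->
    ordered_qelim.ord.qf_eval [:: x] g = ordered_qelim.ord.qf_eval [:: y] g.
Proof.
have tp (t : GRing.term R) : GRing.rterm t ->
    exists p : {poly R}, forall x, GRing.eval [:: x] t = p.[x].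
  move=> ht; exists (qe_rcf.eval_poly [::] (qe_rcf.abstrX 0 (qe_rcf.to_rterm t))) => x.
  by rewrite qe_rcf.abstrXP qe_rcf.evalE qe_rcf.to_rtermE.
have at2 t1 t2 : GRing.rterm t1 && GRing.rterm t2 ->
    exists2 e, 0 < e & forall x y, a < x < a + e -> a < y < a + e ->
      Num.sg (GRing.eval [:: x] t1 - GRing.eval [:: x] t2) =
      Num.sg (GRing.eval [:: y] t1 - GRing.eval [:: y] t2).
  move=> /andP[/tp [p hp] /tp [q hq]]; have [e e0 he] := poly_sgr_right (p - q) a.
  by exists e => // x y hx hy; rewrite !hp !hq -!hornerN -!hornerD; exact: he.
have bin g1 g2 : (exists2 e, 0 < e & forall x y, a < x < a + e -> a < y < a + e ->
    ordered_qelim.ord.qf_eval [:: x] g1 = ordered_qelim.ord.qf_eval [:: y] g1) ->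
  (exists2 e, 0 < e & forall x y, a < x < a + e -> a < y < a + e ->
    ordered_qelim.ord.qf_eval [:: x] g2 = ordered_qelim.ord.qf_eval [:: y] g2) ->
  exists2 e, 0 < e & forall x y, a < x < a + e -> a < y < a + e ->
    ordered_qelim.ord.qf_eval [:: x] g1 = ordered_qelim.ord.qf_eval [:: y] g1 /\
    ordered_qelim.ord.qf_eval [:: x] g2 = ordered_qelim.ord.qf_eval [:: y] g2.
  move=> [e1 e10 h1] [e2 e20 h2]; exists (Num.min e1 e2); first by rewrite lt_min e10.
  have hm x : a < x < a + Num.min e1 e2 -> a < x < a + e1 /\ a < x < a + e2.
    move=> /andP[ax xe]; split; rewrite ax; apply: lt_le_trans xe _;
    by rewrite lerD2l ge_min lexx ?orbT.
  by move=> x y /hm[x1 x2] /hm[y1 y2]; split; [exact: h1|exact: h2].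
elim: g => //=.
- by move=> b _; exists 1.
- move=> t1 t2 /at2[e e0 he]; exists e => // x y hx hy.
  by rewrite -subr_eq0 -sgr_eq0 (he _ _ hx hy) sgr_eq0 subr_eq0.
- move=> t1 t2 /at2[e e0 he]; exists e => // x y hx hy.
  by rewrite -subr_lt0 -sgr_lt0 (he _ _ hx hy) sgr_lt0 subr_lt0.
- move=> t1 t2 /at2[e e0 he]; exists e => // x y hx hy.
  by rewrite -subr_le0 -sgr_le0 (he _ _ hx hy) sgr_le0 subr_le0.
- move=> g1 IH1 g2 IH2 /andP[/andP[? ?] /andP[? ?]].
  have [||e e0 he] := bin g1 g2; [by apply: IH1; apply/andP|by apply: IH2; apply/andP|].
  by exists e => // x y hx hy; have [-> ->] := he _ _ hx hy.
- move=> g1 IH1 g2 IH2 /andP[/andP[? ?] /andP[? ?]].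
  have [||e e0 he] := bin g1 g2; [by apply: IH1; apply/andP|by apply: IH2; apply/andP|].
  by exists e => // x y hx hy; have [-> ->] := he _ _ hx hy.
- move=> g1 IH1 g2 IH2 /andP[/andP[? ?] /andP[? ?]].
  have [||e e0 he] := bin g1 g2; [by apply: IH1; apply/andP|by apply: IH2; apply/andP|].
  by exists e => // x y hx hy; have [-> ->] := he _ _ hx hy.
- by move=> g1 IH1 /IH1[e e0 he]; exists e => // x y hx hy; rewrite (he _ _ hx hy).
Qed.

(** Quantifier elimination reduces [P] to sign conditions on polynomials. This local one-sided
    statement is the form in which o-minimality is used throughout. *)
Lemma definable_right (P : R -> Prop) (a : R) : @definable R RC P ->
  (exists2 e, 0 < e & forall x, a < x < a + e -> P x) \/
  (exists2 e, 0 < e & forall x, a < x < a + e -> ~ P x).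
Proof.
move=> /definable_formula /(_ [:: id]) [].
  by move=> b ->; exists 0%N.
move=> f hf.
pose g := ordered_qelim.ord.quantifier_elim
  (fun i (bc : seq (GRing.term R) * seq (GRing.term R)) =>
     qe_rcf.qfr_to_formula (qe_rcf.wproj i bc)) (ordered_qelim.ord.to_rform f).
have hg x : P x <-> ordered_qelim.ord.qf_eval [:: x] g.
  rewrite hf /=; exact: (rwP (qe_rcf.rcf_satP [:: x] f)).
have wf : ordered_qelim.ord.qf_form g && ordered_qelim.ord.rformula g.
  apply: ordered_qelim.ord.quantifier_elim_wf.
    exact: qe_rcf.wf_QE_wproj.
  exact: ordered_qelim.ord.to_rform_rformula.
have [e e0 he] := qf_right_constant a wf.
have hm : a < a + e / 2 < a + e by apply/andP; split; lra.
case: (pselect (P (a + e / 2))) => hP; [left|right]; exists e => // x hx.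
  by apply/hg; rewrite (he _ _ hx hm); apply/hg.
by move=> /hg; rewrite (he _ _ hx hm) => /hg.
Qed.

Lemma definable_left (P : R -> Prop) (a : R) : @definable R RC P ->
  (exists2 e, 0 < e & forall x, a - e < x < a -> P x) \/
  (exists2 e, 0 < e & forall x, a - e < x < a -> ~ P x).
Proof.
move=> hP; have hN : @definable R RC (fun x => P (- x)).
  apply: (definable_comp (C := RC) (D := RC) (g := fun x => - x)) => //.
  by apply: polymap_real; apply: polyfun_opp; exact: polyfun_real.
have [[e e0 he]|[e e0 he]] := definable_right (- a) hN; [left|right]; exists e => // x hx.
  by rewrite -(opprK x); apply: he; lra.
by rewrite -(opprK x); apply: he; lra.
Qed.

End OMinimality.

Ltac polymap_proj :=
  repeat first [exact: polymap_id | apply: polymap_fst | apply: polymap_snd].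

Ltac defun_auto := cbv beta; lazymatch goal with
  | H : defun ?h |- defun ?h => exact: H
  | |- defun (fun c => @?f c + - @?g c) => apply: (defun_sub (f := f) (g := g)); defun_auto
  | |- defun (fun c => @?f c + @?g c) => apply: (defun_add (f := f) (g := g)); defun_auto
  | |- defun (fun c => @?f c * @?g c) => apply: (defun_mul (f := f) (g := g)); defun_auto
  | |- defun (fun c => - @?f c) => apply: (defun_opp (f := f)); defun_auto
  | |- defun (fun c => `|@?f c|) => apply: (defun_abs (f := f)); defun_auto
  | |- defun (fun c => \sum_i @?f c i) =>
      refine (defun_sum (f := fun i c => f c i) _); intros ?; defun_auto
  | H : defun ?h |- defun (fun c => ?h (@?f c)) =>
      first [ refine (defun_polymap (g := f) _ H); solve [polymap_proj]
            | apply: (defun_comp (h := h) (f := f) H); defun_auto ]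
  | |- _ => first
      [ exact: defun_cst
      | apply: defun_poly; apply: polyfun_polymap; solve [polymap_proj]
      | apply: defun_poly; lazymatch goal with |- polyfun (fun c => fun_of_fin (@?g c) ?i) =>
          refine (polyfun_comp (g := g) _ (polyfun_ffun _ i)); solve [polymap_proj] end
      | idtac ]
  end.

Ltac definable_auto := cbv beta; lazymatch goal with
  | |- definable (fun c => @?P c /\ @?Q c) =>
      apply: (definable_and (P := P) (Q := Q)); definable_auto
  | |- definable (fun c => @?P c \/ @?Q c) =>
      apply: (definable_or (P := P) (Q := Q)); definable_auto
  | |- definable (fun c => ~ @?P c) => apply: (definable_not (P := P)); definable_auto
  | |- definable (fun c => is_true (@?f c < @?g c)) =>
      apply: (definable_lt (f := f) (g := g)); defun_auto
  | |- definable (fun c => is_true (@?f c <= @?g c)) =>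
      apply: (definable_le (f := f) (g := g)); defun_auto
  | |- definable (fun c => @?f c = @?g c) =>
      apply: (definable_eq (f := f) (g := g)); defun_auto
  | |- definable (fun c => exists v, @?P c v) =>
      first [apply: (definable_ex (P := P)) | apply: (definable_ex_ffun (P := P))];
      definable_auto
  | |- definable (fun c => @?P c -> @?Q c) =>
      apply: (definable_imp (P := P) (Q := Q)); definable_auto
  | |- definable (fun c => forall v : _, @?P c v) =>
      first [ apply: (definable_all (P := P)) | apply: (definable_all_ffun (P := P))
            | refine (definable_allfin (P := fun j c => P c j) _); intros ? ];
      definable_auto
  | H : definable ?P |- definable (fun c => ?P (@?g c)) =>
      apply: (definable_comp (g := g) (P := P)); [polymap_proj | exact: H]
  | |- _ => first [exact: definable_cst | idtac]
  end.

(** * Monotonicity of definable functions near 0 *)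

Section Monotonicity.
Variable R : realType.
Local Notation RC := (real_ctx R).

(** Take the supremum of the initial segments on which [P] holds: the last hypothesis puts it into
    [P], the one before pushes beyond it unless it is [b]. This serves for functions that may be
    discontinuous. *)
Lemma real_induction (a b : R) (P : R -> Prop) : a <= b -> P a ->
  (forall u, a <= u < b -> P u -> exists2 e, 0 < e & forall v, u < v < u + e -> P v) ->
  (forall c, a < c <= b -> (forall u, a <= u < c -> P u) -> P c) ->
  P b.
Proof.
move=> ab Pa Pr Pl.
pose S := [set c | a <= c <= b /\ forall u, a <= u <= c -> P u].
have Sa : S a by split; rewrite ?lexx // => u /le_anti <-.
have hS : has_sup S by split; [exists a|exists b => c [/andP[]]].
have ac : a <= sup S by apply: ub_le_sup => //; case: hS.
have cb : sup S <= b by apply: ge_sup; [exists a|move=> c [/andP[]]].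
have Plt u : a <= u < sup S -> P u.
  move=> /andP[au uS].
  have d0 : 0 < sup S - u by rewrite subr_gt0.
  have [c [_ hc] uc] := sup_adherent d0 hS.
  by apply: hc; rewrite au ltW //; move: uc; rewrite subKr.
have Pc : P (sup S).
  have [<-//|aS] := eqVneq a (sup S).
  by apply: Pl => //; rewrite cb andbT lt_neqAle aS.
have [<-//|nb] := eqVneq (sup S) b.
have cb' : sup S < b by rewrite lt_neqAle nb.
have [|e e0 he] := Pr (sup S) _ Pc; first by rewrite ac.
pose v := Num.min b (sup S + e / 2).
have v1 : sup S < v by rewrite lt_min cb' /=; lra.
have v2 : v < sup S + e by rewrite gt_min; apply/orP; right; lra.
have : v <= sup S.
  apply: ub_le_sup; first by case: hS.
  split; first by rewrite ge_min lexx /= andbT; lra.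
  move=> u /andP[au uv]; case: (ltgtP u (sup S)) => [uc|cu|->] //; first by apply: Plt; rewrite au.
  by apply: he; rewrite cu /=; lra.
by rewrite leNgt v1.
Qed.

(** Such a [q] would be injective on the interval, which would then be countable and hence
    Lebesgue-null. *)
Lemma no_countable_separation (T : countType) (a b : R) (q : R -> T) : a < b ->
  ~ (forall s s', a < s -> s < s' -> s' < b -> q s <> q s').
Proof.
move=> ab hq.
have cnt : countable (`]a, b[%classic : set R).
  apply/countable_injP; exists (pickle \o q) => s s'; rewrite !inE /= !in_itv /=.
  move=> /andP[s1 s2] /andP[s1' s2'] /(pcan_inj pickleK) e.
  case: (ltgtP s s') => // h.
    by case: (hq s s').
  by case: (hq s' s).
have := countable_lebesgue_measure0 cnt.
rewrite lebesgue_measure_itv /= lte_fin ab -EFinB => -[/eqP].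
by rewrite subr_eq0 => /eqP ba; move: ab; rewrite ba ltxx.
Qed.

(** Attach to each [s] a rational interval around it on which [r s] holds off [s]; two points with
    the same interval would be related both ways. The relation is left abstract so that it can be
    strict on one side only, which already makes it asymmetric. *)
Lemma no_local_extremum_everywhere (a b : R) (r : R -> R -> Prop) : a < b ->
  (forall s s', r s s' -> ~ r s' s) ->
  ~ (forall s, a < s < b -> exists2 e, 0 < e & forall s', s' != s -> s - e < s' < s + e -> r s s').
Proof.
move=> ab hr h.
have /choice [q hq] : forall s, exists q : rat * rat, a < s < b ->
    ratr q.1 < s < ratr q.2 /\ forall s', s' != s -> ratr q.1 < s' < ratr q.2 -> r s s'.
  move=> s; case: (pselect (a < s < b)) => hs; last by exists (0, 0).
  have [e e0 he] := h s hs.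
  have [q1] := @rat_in_itvoo R (s - e) s ltac:(lra); rewrite in_itv /= => /andP[h1 h2].
  have [q2] := @rat_in_itvoo R s (s + e) ltac:(lra); rewrite in_itv /= => /andP[h3 h4].
  exists (q1, q2) => _ /=; split; first by rewrite h2.
  by move=> s' ns /andP[h5 h6]; apply: he => //; lra.
apply: (@no_countable_separation _ a b q ab) => s s' s1 ss s2 e.
have [|h1 h2] := hq s; first by lra.
have [|h3 h4] := hq s'; first by lra.
have ns : s' != s by rewrite neq_lt ss orbT.
apply: (hr s s'); first by apply: h2 => //; rewrite e.
by apply: h4; rewrite 1?eq_sym // -e.
Qed.

Lemma monotone_of_local (h : R -> R) (a b : R) :
  (forall s, a < s < b -> exists2 e, 0 < e & forall s', s < s' < s + e -> h s <= h s') ->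
  (forall s, a < s < b -> exists2 e, 0 < e & forall s', s - e < s' < s -> h s' <= h s) ->
  forall s s', a < s -> s <= s' -> s' < b -> h s <= h s'.
Proof.
move=> hr hl s s' as_ ss sb.
apply: (@real_induction s s' (fun u => h s <= h u)) => //.
  move=> u /andP[su us] hu; have [|e e0 he] := hr u; first by lra.
  by exists e => // v hv; apply: le_trans hu _; exact: he.
move=> c /andP[sc cs] hc; have [|e e0 he] := hl c; first by lra.
have [sce|] := leP s (c - e / 2).
  by apply: le_trans (hc (c - e / 2) _) (he _ _); lra.
by move=> h1; apply: he; lra.
Qed.

(* By o-minimality, [h s' - h s] has a constant sign type on each side of each
   [s], and these two types do not depend on [s] near [0+]; if they did not
   agree, every point near [0+] would be a local extremum. *)
Lemma defun_monotone (h : R -> R) : @defun R RC h -> exists2 e, 0 < e &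
  (forall s s', 0 < s -> s <= s' -> s' < e -> h s <= h s') \/
  (forall s s', 0 < s -> s <= s' -> s' < e -> h s' <= h s).
Proof.
move=> dh.
have dle s : @definable R RC (fun s' => h s <= h s') by definable_auto.
have dge s : @definable R RC (fun s' => h s' <= h s) by definable_auto.
pose A (s : R) := exists d : R, 0 < d /\ forall s' : R, (s < s' /\ s' < s + d) -> h s <= h s'.
pose B (s : R) := exists d : R, 0 < d /\ forall s' : R, (s - d < s' /\ s' < s) -> h s' <= h s.
have dA : @definable R RC A by rewrite /A; definable_auto.
have dB : @definable R RC B by rewrite /B; definable_auto.
have AE s : A s -> exists2 e, 0 < e & forall s', s < s' < s + e -> h s <= h s'.
  by move=> [e [e0 he]]; exists e => // s' /andP[]; auto.
have BE s : B s -> exists2 e, 0 < e & forall s', s - e < s' < s -> h s' <= h s.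
  by move=> [e [e0 he]]; exists e => // s' /andP[]; auto.
(* By o-minimality the failure of a weak inequality near [s] is a strict inequality on a whole
   one-sided neighbourhood. *)
have nAE s : ~ A s -> exists2 e, 0 < e & forall s', s < s' < s + e -> h s' < h s.
  move=> nA; have [[e e0 he]|[e e0 he]] := definable_right s (dle s).
    by case: nA; exists e; split=> // s' [h1 h2]; apply: he; rewrite h1.
  by exists e => // s' /he /negP; rewrite -ltNge.
have nBE s : ~ B s -> exists2 e, 0 < e & forall s', s - e < s' < s -> h s < h s'.
  move=> nA; have [[e e0 he]|[e e0 he]] := definable_left s (dge s).
    by case: nA; exists e; split=> // s' [h1 h2]; apply: he; rewrite h1.
  by exists e => // s' /he /negP; rewrite -ltNge.
have mn (e1 e2 s : R) : 0 < s < Num.min e1 e2 -> 0 < s < 0 + e1 /\ 0 < s < 0 + e2.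
  by rewrite lt_min !add0r => /and3P[-> -> ->].
have [[e1 e10 hA]|[e1 e10 hA]] := definable_right 0 dA;
  have [[e2 e20 hB]|[e2 e20 hB]] := definable_right 0 dB;
  exists (Num.min e1 e2); rewrite ?lt_min ?e10 //.
- left; apply: monotone_of_local => s /mn[/hA hs1 /hB hs2]; [exact: AE|exact: BE].
(* Mixed types: every point near 0 would be a local minimum, strict on its left. *)
- exfalso.
  apply: (@no_local_extremum_everywhere 0 (Num.min e1 e2)
    (fun s s' => (s < s' /\ h s <= h s') \/ (s' < s /\ h s < h s'))); rewrite ?lt_min ?e10 //.
    by move=> s s'; lra.
  move=> s /mn[/hA/AE [d1 d10 hd1] /hB/nBE [d2 d20 hd2]].
  exists (Num.min d1 d2); first by rewrite lt_min d10.
  move=> s'; rewrite neq_lt => /orP[ss|ss] /andP[h1 h2]; [right|left]; split=> //.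
    by apply: hd2; rewrite ss andbT; apply: le_lt_trans h1; rewrite lerB // ge_min lexx orbT.
  by apply: hd1; rewrite ss /=; apply: lt_le_trans h2 _; rewrite lerD // ge_min lexx.
(* Here every point would be a local maximum, strict on its right. *)
- exfalso.
  apply: (@no_local_extremum_everywhere 0 (Num.min e1 e2)
    (fun s s' => (s < s' /\ h s' < h s) \/ (s' < s /\ h s' <= h s))); rewrite ?lt_min ?e10 //.
    by move=> s s'; lra.
  move=> s /mn[/hA/nAE [d1 d10 hd1] /hB/BE [d2 d20 hd2]].
  exists (Num.min d1 d2); first by rewrite lt_min d10.
  move=> s'; rewrite neq_lt => /orP[ss|ss] /andP[h1 h2]; [right|left]; split=> //.
    by apply: hd2; rewrite ss andbT; apply: le_lt_trans h1; rewrite lerB // ge_min lexx orbT.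
  by apply: hd1; rewrite ss /=; apply: lt_le_trans h2 _; rewrite lerD // ge_min lexx.
- right=> s s' s0 ss sb; rewrite -lerN2.
  apply: (@monotone_of_local (fun x => - h x) 0 (Num.min e1 e2)) => //.
    move=> u /mn[/hA/nAE [d d0 hd] _]; exists d => // v /hd; rewrite lerN2; exact: ltW.
  by move=> u /mn[_ /hB/nBE [d d0 hd]]; exists d => // v /hd; rewrite lerN2; exact: ltW.
Qed.

End Monotonicity.

(** * Definable choice *)

Section DefinableChoice.
Variable R : realType.
Local Notation RC := (real_ctx R).

(* A bounded one-dimensional fibre [S] is assigned its minimum if it has one,
   and otherwise the midpoint of the maximal interval [(inf S, b)] it contains. *)
Let selected (S : R -> Prop) (y : R) : Prop :=
  (S y /\ forall z, z < y -> ~ S z) \/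
  (exists a, exists b, y + y = a + b /\ a < b /\ (forall z, z <= a -> ~ S z) /\
    (forall z, a < z /\ z < b -> S z) /\
    (forall b', b < b' -> ~ (forall z, a < z /\ z < b' -> S z))).

Let selected_mem S y : selected S y -> S y.
Proof. by case=> [[]//|[a [b [yab [ab [_ [h _]]]]]]]; apply: h; lra. Qed.

Let selected_inj S y y' : selected S y -> selected S y' -> y = y'.
Proof.
have h12 u u' : (S u /\ forall z, z < u -> ~ S z) ->
    (exists a, exists b, u' + u' = a + b /\ a < b /\ (forall z, z <= a -> ~ S z) /\
    (forall z, a < z /\ z < b -> S z) /\
    (forall b', b < b' -> ~ (forall z, a < z /\ z < b' -> S z))) -> False.
  move=> [Su hu] [a [b [_ [ab [ha [hab _]]]]]].
  have au : a < u by rewrite ltNge; apply/negP => /ha.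
  have [m [am mu mb]] : exists m, [/\ a < m, m < u & m < b].
    case: (leP u b) => ub; first by exists ((a + u) / 2); split; lra.
    by exists ((a + b) / 2); split; lra.
  by apply: (hu m mu); apply: hab.
have h22 (a b a' b' : R) : a < b -> (forall z, a < z /\ z < b -> S z) ->
    (forall z, z <= a' -> ~ S z) -> a' <= a.
  move=> ab hab ha'; rewrite leNgt; apply/negP => aa'.
  case: (leP a' b) => ub.
    by apply: (ha' ((a + a') / 2)); [lra|apply: hab; lra].
  by apply: (ha' ((a + b) / 2)); [lra|apply: hab; lra].
case=> [h1|h1] [h2|h2]; try by case: (h12 _ _ h1 h2) || case: (h12 _ _ h2 h1).
  have [S1 m1] := h1; have [S2 m2] := h2.
  by case: (ltgtP y y') => // h; [case: (m2 _ h)|case: (m1 _ h)].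
have [a [b [yab [ab [ha [hab hb]]]]]] := h1.
have [a' [b' [yab' [ab' [ha' [hab' hb']]]]]] := h2.
have aa : a = a'.
  by apply/le_anti; rewrite (h22 _ _ _ b ab' hab' ha) (h22 _ _ _ b' ab hab ha').
subst a'; suff bb : b = b' by lra.
by case: (ltgtP b b') => // h; [case: (hb _ h)|case: (hb' _ h)].
Qed.

(** If the infimum [a] is not attained, o-minimality puts an interval just to the right of [a]
    inside [S], since one avoiding [S] would contradict the infimum; [K] bounds the maximal such
    interval. *)
Let selected_ex S K : @definable R RC S -> (forall y, S y -> `|y| <= K) ->
  (exists y, S y) -> exists y, selected S y.
Proof.
move=> dS hK [y0 Sy0].
have hS : has_inf S by split; [exists y0|exists (- K) => y /hK; rewrite ler_norml => /andP[]].
have lbS y : S y -> inf S <= y by move=> Sy; apply: ge_inf => //; case: hS.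
have nlt z : z < inf S -> ~ S z by move=> zi /lbS; rewrite leNgt zi.
case: (pselect (S (inf S))) => [Si|nSi]; first by exists (inf S); left.
set a := inf S in nSi lbS nlt *.
have nle z : z <= a -> ~ S z by rewrite le_eqVlt => /orP[/eqP->//|]; exact: nlt.
have [[e e0 he]|[e e0 he]] := definable_right a dS; last first.
  have [y Sy ya] := inf_adherent e0 hS.
  case: (he y) => //; rewrite ya andbT lt_neqAle lbS // andbT.
  by apply/eqP => ay; apply: nSi; rewrite ay.
pose T := [set b | a < b /\ forall z, a < z /\ z < b -> S z].
have Te : T (a + e) by split; [lra|move=> z [h1 h2]; apply: he; rewrite h1].
have ubT : ubound T K.
  move=> b [ab hb]; rewrite leNgt; apply/negP => Kb.
  have : S ((Num.max a K + b) / 2).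
    apply: hb; have := ab; have := Kb; case: (leP a K) => ? ? ?; split; lra.
  by move=> /hK; rewrite ler_norml; case: (leP a K) => ?; lra.
have hT : has_sup T by split; [exists (a + e)|exists K].
have ab : a < sup T by apply: lt_le_trans (ub_le_sup _ Te); [case: Te|exists K].
exists ((a + sup T) / 2); right; exists a, (sup T); split; first by lra.
split=> //; split=> //; split.
  move=> z [az zb]; have d0 : 0 < sup T - z by lra.
  have [b [_ hb] bz] := sup_adherent d0 hT.
  by apply: hb; split=> //; lra.
move=> b' bb' hb'; have : b' <= sup T by apply: ub_le_sup; [exists K|split=> //; lra].
by rewrite leNgt bb'.
Qed.

Lemma definable_choice1 (P : R -> R -> Prop) (e K : R) :
  definable (fun sy : prod_ctx RC RC => P sy.1 sy.2) ->
  (forall s, 0 < s < e -> exists y, `|y| <= K /\ P s y) ->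
  exists2 h, @defun R RC h & forall s, 0 < s < e -> `|h s| <= K /\ P s (h s).
Proof.
move=> dP hP; pose P' s y := `|y| <= K /\ P s y.
have dP' : definable (fun sy : prod_ctx RC RC => P' sy.1 sy.2).
  by apply: definable_and dP; definable_auto.
have dPs s : @definable R RC (P' s).
  refine (definable_comp (P := fun sy : prod_ctx RC RC => P' sy.1 sy.2)
    (g := fun y : RC => (s, y)) _ dP').
  by apply: polymap_pair; [exact: polymap_cst|exact: polymap_id].
(* The value 0 outside the interval keeps the graph of the total function [h] definable. *)
have /choice [h hh] s : exists y, if `[<0 < s < e>] then selected (P' s) y else y = 0.
  case: asboolP => hs; last by exists 0.
  by apply: (selected_ex (K := K) (dPs s)) => [y []//|]; exact: hP.
exists h; last first.
  by move=> s hs; have := hh s; case: asboolP => // _ /selected_mem.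
have dQ : definable (fun sy : prod_ctx RC RC => selected (P' sy.1) sy.2).
  rewrite /selected; definable_auto;
  match goal with |- definable (fun c => P' (@?f c) (@?g c)) =>
    refine (definable_comp (P := fun sy : prod_ctx RC RC => P' sy.1 sy.2)
      (g := fun c => (f c, g c)) _ dP'); apply: polymap_pair; polymap_proj end.
have d1 : definable (fun sy : prod_ctx RC RC => 0 < sy.1 /\ sy.1 < e) by definable_auto.
have d2 : definable (fun sy : prod_ctx RC RC => sy.2 = 0) by definable_auto.
apply: (definable_ext (definable_or (definable_and d1 dQ)
   (definable_and (definable_not d1) d2))) => -[s y] /=.
have := hh s; case: asboolP => hs hsy; split.
- by case=> [[_ /selected_inj]|[]]; [apply|case; apply/andP].
- by move=> ->; left; split=> //; apply/andP.
- by case=> [[/andP]//|[_ ->]].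
- by move=> ->; right; split=> // /andP.
Qed.

(** The coordinates are chosen one at a time, each under the constraint that some point of the fibre
    extends the values already fixed. *)
Lemma definable_choice (I : finType) (P : R -> {ffun I -> R} -> Prop) (e K : R) :
  definable (fun sx : prod_ctx RC (ffun_ctx R I) => P sx.1 sx.2) ->
  (forall s, 0 < s < e -> exists x : {ffun I -> R}, (forall i, `|x i| <= K) /\ P s x) ->
  exists2 h : I -> R -> R, forall i, @defun R RC (h i) &
    forall s, 0 < s < e -> (forall i, `|h i s| <= K) /\ P s [ffun i => h i s].
Proof.
move=> dP hP.
suff hl (l : seq I) : exists2 h : I -> R -> R, forall i, @defun R RC (h i) &
    forall s, 0 < s < e -> exists x : {ffun I -> R},
      ((forall i, `|x i| <= K) /\ P s x) /\ forall i, i \in l -> x i = h i s.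
  have [h dh hh] := hl (enum I); exists h => // s /hh [x [[xK Px] xh]].
  have xE i : x i = h i s by apply: xh; rewrite mem_enum.
  split=> [i|]; first by rewrite -xE.
  by suff <- : x = [ffun i => h i s] by []; apply/ffunP => i; rewrite ffunE.
elim: l => [|i l [h dh hh]].
  exists (fun _ _ => 0) => [i|s /hP [x hx]]; first exact: defun_cst.
  by exists x.
have [||h1 dh1 hh1] := @definable_choice1 (fun s y => exists x : {ffun I -> R},
   ((forall k, `|x k| <= K) /\ P s x) /\ (forall k, k \in l -> x k = h k s) /\ x i = y) e K.
- definable_auto.
  + refine (definable_comp (P := fun sx : prod_ctx RC (ffun_ctx R I) => P sx.1 sx.2)
      (g := fun c : prod_ctx (prod_ctx RC RC) (ffun_ctx R I) => (c.1.1, c.2)) _ dP).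
    by apply: polymap_pair; polymap_proj.
  + by apply: (defun_comp (dh _)); defun_auto.
- move=> s hs; have [x [[xK Px] xh]] := hh s hs.
  by exists (x i); split=> //; exists x.
exists (fun k => if k == i then h1 else h k) => [k|s hs]; first by case: eqP.
have [_ [x [hx [xl xi]]]] := hh1 s hs.
exists x; split=> // k; rewrite inE; case: eqP => [->|_] //=; exact: xl.
Qed.

End DefinableChoice.

(** * The Kurdyka-Lojasiewicz inequality *)

Section KurdykaLojasiewicz.
Variables (R : realType) (I : finType).
Local Notation RC := (real_ctx R).
Local Notation point := {ffun I -> R}.

(** The [l^1] distance is definable and, along a curve with monotone coordinates, additive: it
    becomes a difference of signed coordinate sums. *)
Definition dist1 (x y : point) : R := \sum_i `|x i - y i|.

Lemma dist1_ge0 x y : 0 <= dist1 x y.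
Proof. by apply: sumr_ge0. Qed.

Lemma dist1C x y : dist1 x y = dist1 y x.
Proof. by apply: eq_bigr => i _; rewrite distrC. Qed.

Lemma dist1_triangle z x y : dist1 x y <= dist1 x z + dist1 z y.
Proof. by rewrite -big_split; apply: ler_sum => i _; exact: ler_distD. Qed.

Variables (E : point -> Prop) (F : point -> R) (K : R).
Hypotheses (dE : @definable R (ffun_ctx R I) E) (dF : @defun R (ffun_ctx R I) F).
Hypothesis boundedE : forall x, E x -> forall i, `|x i| <= K.

(** Only ascents are bounded, because the talweg is followed towards higher levels of [F]. With
    [F = f* - f] they are the decreases of the ALS objective that [als_slope] bounds. *)
Definition ascent_slope (x : point) (m : R) : Prop :=
  exists d : R, 0 < d /\ forall y : point, E y -> dist1 y x < d ->
    F y - F x <= m * dist1 y x.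

Lemma definable_ascent_slope :
  definable (fun xm : prod_ctx (ffun_ctx R I) RC => ascent_slope xm.1 xm.2).
Proof. by rewrite /ascent_slope /dist1; definable_auto. Qed.

Lemma ascent_slope_le x m m' : m <= m' -> ascent_slope x m -> ascent_slope x m'.
Proof.
move=> mm [d [d0 hd]]; exists d; split=> // y Ey yd; apply: le_trans (hd y Ey yd) _.
by apply: ler_wpM2r => //; exact: dist1_ge0.
Qed.

Lemma common_radius (J : finType) (e : J -> R) (e0 : R) : 0 < e0 ->
  (forall j, 0 < e j) -> exists2 d, 0 < d <= e0 & forall j, d <= e j.
Proof.
move=> e00 he; suff hs (s : seq J) : exists2 d, 0 < d <= e0 & forall j, j \in s -> d <= e j.
  by have [d d0 hd] := hs (enum J); exists d => // j; apply: hd; rewrite mem_enum.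
elim: s => [|j s [d /andP[d0 de] hd]]; first by exists e0 => //; rewrite e00 lexx.
exists (Num.min d (e j)); first by rewrite lt_min d0 he ge_min de.
by move=> k; rewrite inE ge_min => /orP[/eqP->|/hd->//]; rewrite lexx orbT.
Qed.

(* Kurdyka's talweg argument: the length of a definable curve [c] along which
   [F (c s) = s] controls the increments of [s] divided by the slopes. *)
Lemma talweg_length (h : I -> R -> R) (m : R -> R) (e : R) : 0 < e ->
  (forall i, @defun R RC (h i)) ->
  (forall s, 0 < s < e -> let c := [ffun i => h i s] in
     [/\ forall i, `|h i s| <= K, E c, F c = s, 0 < m s & ascent_slope c (m s)]) ->
  exists e' L B, [/\ 0 < e' <= e,
    (forall s s', 0 < s -> s <= s' -> s' < e' -> L s <= L s'),
    (forall s, 0 < s -> s < e' -> `|L s| <= B) &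
    forall M s' s, 0 < s' -> s' <= s -> s < e' ->
      (forall u, s' <= u <= s -> m u <= M) -> s - s' <= M * (L s - L s')].
Proof.
move=> e0 dh hc.
(* [(p i).2] records the direction in which coordinate [i] is monotone. *)
have /choice [p hp] i : exists p : R * bool, 0 < p.1 /\
    forall s s', 0 < s -> s <= s' -> s' < p.1 -> `|h i s' - h i s| = (-1) ^+ p.2 * (h i s' - h i s).
  have [d d0 [hm|hm]] := defun_monotone (dh i).
    exists (d, false); split=> // s s' s0 ss sd; rewrite expr0 mul1r ger0_norm // subr_ge0; exact: hm.
  exists (d, true); split=> // s s' s0 ss sd; rewrite expr1 mulN1r ler0_norm // subr_le0; exact: hm.
have [e' /andP[e'0 e'e] he'] := common_radius e0 (fun i => (hp i).1).
pose L s := \sum_i (-1) ^+ (p i).2 * h i s.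
have LE s s' : 0 < s -> s <= s' -> s' < e' ->
    dist1 [ffun i => h i s'] [ffun i => h i s] = L s' - L s.
  move=> s0 ss se; rewrite /L -sumrB; apply: eq_bigr => i _.
  by rewrite !ffunE -mulrBr (hp i).2 // (lt_le_trans se).
have Lmono s s' : 0 < s -> s <= s' -> s' < e' -> L s <= L s'.
  by move=> s0 ss se; rewrite -subr_ge0 -LE // dist1_ge0.
exists e', L, (\sum_(i : I) K); split => //; first by rewrite e'0.
  move=> s s0 se; have [//|hK _ _ _ _] := hc s; first by rewrite s0 (lt_le_trans se).
  apply: le_trans (ler_norm_sum _ _ _) _; apply: ler_sum => i _.
  by rewrite normrM normrX normrN1 expr1n mul1r.
move=> M s' s s'0 ss se mM.
apply: (@real_induction R s' s (fun u => u - s' <= M * (L u - L s'))) => //.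
- by rewrite !subrr mulr0.
- move=> u /andP[su us] hu.
  have u0 : 0 < u by lra.
  have [|_ Ec Fc m0 [d [d0 hd]]] := hc u; first by lra.
  have muM : m u <= M by apply: mM; rewrite su ltW.
  have md0 : 0 < m u * d by apply: mulr_gt0.
  (* The curve may jump at [u]: the bound [m u * d] covers the case where the point at level [v] is
     farther than [d], for then [m u] times the distance already exceeds [v - u]. *)
  exists (Num.min (e' - u) (m u * d)); first by rewrite lt_min md0 andbT; lra.
  move=> v /andP[uv]; rewrite -ltrBlDl lt_min => /andP[ve vd].
  have ve' : v < e' by lra.
  have [|_ Ev Fv _ _] := hc v; first by lra.
  have LuLv : L u <= L v by apply: Lmono => //; lra.
  have dE1 : dist1 [ffun i => h i v] [ffun i => h i u] = L v - L u by apply: LE => //; lra.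
  suff h1 : v - u <= m u * (L v - L u).
    have : m u * (L v - L u) <= M * (L v - L u) by apply: ler_wpM2r => //; lra.
    lra.
  rewrite -dE1; case: (ltP (dist1 [ffun i => h i v] [ffun i => h i u]) d) => hlt.
    by rewrite -{1}Fv -{1}Fc; exact: hd.
  have : m u * d <= m u * dist1 [ffun i => h i v] [ffun i => h i u] by rewrite ler_pM2l.
  lra.
- move=> c /andP[sc cs] hu; rewrite leNgt; apply/negP => hlt.
  (* As [L] is monotone, a deficit [g] at [c] is contradicted at any earlier level within [g] of
     [c]. *)
  set g := c - s' - M * (L c - L s').
  have g0 : 0 < g by rewrite /g; lra.
  have M0 : 0 <= M.
    have [|_ _ _ m0 _] := hc s; first by lra.
    by apply: le_trans (ltW m0) (mM _ _); rewrite ss lexx.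
  have [u [su uc ug]] : exists u, [/\ s' <= u, u < c & c - u < g].
    by exists (Num.max s' (c - g / 2)); case: (leP s' (c - g / 2)) => ?; split; lra.
  have h1 := hu u ltac:(by rewrite su uc).
  have h2 : M * (L u - L s') <= M * (L c - L s').
    by apply: ler_wpM2l => //; rewrite lerB // Lmono //; lra.
  by move: ug h1 h2; rewrite /g; lra.
Qed.

Let attained (s m : R) : Prop :=
  exists x : point, (E x /\ F x = s) /\ 0 < m /\ ascent_slope x m.

Let definable_attained :
  definable (fun sm : prod_ctx RC RC => attained sm.1 sm.2).
Proof.
rewrite /attained; definable_auto.
refine (definable_comp (P := fun xm : prod_ctx (ffun_ctx R I) RC => ascent_slope xm.1 xm.2)
  (g := fun c : prod_ctx (prod_ctx RC RC) (ffun_ctx R I) => (c.2, c.1.2)) _ definable_ascent_slope).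
by apply: polymap_pair; polymap_proj.
Qed.

(** The inequality is uniform over all points of [E] at level [s], so the only localization is in
    the level. The clause with [eta] is continuity at 0. *)
Definition desingularizes (e : R) (psi : R -> R) : Prop :=
  [/\ 0 < e, psi 0 = 0,
      forall s s', 0 <= s -> s <= s' -> s' < e -> psi s <= psi s',
      forall eta, 0 < eta -> exists2 d, 0 < d & forall s, 0 <= s < d -> psi s < eta &
      forall s' s x m, 0 <= s' -> s' <= s -> 0 < s -> s < e -> E x -> F x = s ->
        0 < m -> ascent_slope x m -> s - s' <= m * (psi s - psi s')].

(** [psi] is [L] minus its limit at 0, which is the infimum by monotonicity; this gives continuity
    at 0, and the case [s' = 0] is a limit of the others. *)
Let desingularizes_of_bounded (e B : R) (L : R -> R) : 0 < e ->
  (forall s s', 0 < s -> s <= s' -> s' < e -> L s <= L s') ->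
  (forall s, 0 < s -> s < e -> `|L s| <= B) ->
  (forall s' s m, 0 < s' -> s' <= s -> s < e -> attained s m -> s - s' <= m * (L s - L s')) ->
  exists e psi, desingularizes e psi.
Proof.
move=> e0 Lmono LB hL.
pose S := [set L s | s in [set s | 0 < s /\ s < e]].
have hS : has_inf S.
  split; first by exists (L (e / 2)), (e / 2) => //; split; lra.
  by exists (- B) => _ [s [s0 se] <-]; have := LB s s0 se; rewrite ler_norml => /andP[].
have infL s : 0 < s -> s < e -> inf S <= L s.
  by move=> s0 se; apply: ge_inf; [case: hS|exists s].
pose psi s := if s <= 0 then 0 else L s - inf S.
have psi0 s : s <= 0 -> psi s = 0 by rewrite /psi => ->.
have psiE s : 0 < s -> psi s = L s - inf S by rewrite /psi ltNge => /negbTE->.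
exists e, psi; split=> //; first exact: psi0.
- move=> s s' s0 ss se; have [s'0|s'0] := leP s' 0; first by rewrite !psi0 //; lra.
  rewrite (psiE s') //; have [sl0|sl0] := leP s 0; first by rewrite psi0 // subr_ge0 infL.
  by rewrite psiE // lerD2r; exact: Lmono.
- move=> eta eta0; have [_ [d [d0 de] <-] hd] := inf_adherent eta0 hS.
  exists d => // s /andP[s0 sd]; have [sl0|sl0] := leP s 0; first by rewrite psi0.
  rewrite psiE // ltrBlDl; apply: le_lt_trans hd; apply: Lmono => //; exact: ltW.
- move=> s' s x m s'0 ss s0 se Ex Fx m0 sl.
  have am : attained s m by exists x.
  rewrite (psiE s) //; have [sl0|sl0] := ltP 0 s'.
    by rewrite psiE // opprB addrA subrK; exact: hL.
  have -> : s' = 0 by apply/le_anti; rewrite sl0.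
  rewrite psi0 // !subr0; rewrite leNgt; apply/negP => hlt.
  have X0 : 0 <= m * (L s - inf S) by apply: mulr_ge0; [exact: ltW|rewrite subr_ge0 infL].
  set X := m * (L s - inf S) in hlt X0.
  (* The positive level [(s - X) / 2] leaves a drop of [(s + X) / 2], which is greater than [X]. *)
  have u0 : 0 < (s - X) / 2 by lra.
  have us : (s - X) / 2 <= s by lra.
  have := hL _ _ _ u0 us se am.
  have : m * (L s - L ((s - X) / 2)) <= X.
    by apply: ler_wpM2l; [exact: ltW|apply: lerB => //; apply: infL => //; lra].
  lra.
Qed.

Theorem kurdyka_lojasiewicz : exists e psi, desingularizes e psi.
Proof.
have dA := definable_attained.
have dAs s : @definable R RC (attained s).
  refine (definable_comp (P := fun sm : prod_ctx RC RC => attained sm.1 sm.2)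
    (g := fun m : RC => (s, m)) _ dA).
  by apply: polymap_pair; [exact: polymap_cst|polymap_proj].
pose below (c s : R) := forall m : R, attained s m -> c <= m.
have dbelow c : @definable R RC (below c).
  by rewrite /below; definable_auto; exact: dA.
(* If the slopes stay above some [c] near level 0, a linear [psi] works. *)
case: (pselect (exists2 c, 0 < c & exists2 e, 0 < e & forall s, 0 < s < 0 + e -> below c s)).
  move=> [c c0 [e e0 he]].
  apply: (@desingularizes_of_bounded e (e / c) (fun s => s / c)) => //.
  - by move=> s s' _ ss _; rewrite ler_pM2r // invr_gt0.
  - move=> s s0 se; rewrite ger0_norm ?divr_ge0 ?ltW //.
    by rewrite ltr_pM2r ?invr_gt0.
  - move=> s' s m s'0 ss se am.
    have cm : c <= m by apply: (he s) => //; rewrite add0r se andbT; lra.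
    rewrite -mulrBl mulrCA ler_peMr ?subr_ge0 //.
    by rewrite ler_pdivlMr // mul1r.
move=> nobelow.
(* By o-minimality, small slopes occur at every level near 0 and not merely along a sequence of
   levels. *)
have small c : 0 < c -> exists2 e, 0 < e & forall s, 0 < s < 0 + e -> exists2 m, m < c & attained s m.
  move=> c0; have [[e e0 he]|[e e0 he]] := definable_right 0 (dbelow c).
    by case: nobelow; exists c => //; exists e.
  exists e => // s /he hs; apply: contrapT => hn; apply: hs => m am.
  by rewrite leNgt; apply/negP => mc; apply: hn; exists m.
(* Second dichotomy: whether the levels [s] near 0 have points with slope bound [s]. If so, a
   definable curve of such points would have unbounded length. *)
have ddiag : @definable R RC (fun s => attained s s).
  refine (definable_comp (P := fun sm : prod_ctx RC RC => attained sm.1 sm.2)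
    (g := fun s : RC => (s, s)) _ dA).
  by apply: polymap_pair; polymap_proj.
have [[e e0 he]|[e1 e10 he1]] := definable_right 0 ddiag.
  exfalso.
  have [||h dh hh] := @definable_choice R I
     (fun s x => (E x /\ F x = s) /\ ascent_slope x s) e K.
  - definable_auto.
    refine (definable_comp (P := fun xm : prod_ctx (ffun_ctx R I) RC => ascent_slope xm.1 xm.2)
      (g := fun c : prod_ctx RC (ffun_ctx R I) => (c.2, c.1)) _ definable_ascent_slope).
    by apply: polymap_pair; polymap_proj.
  - move=> s hs; have [|x [[Ex Fx] [_ sl]]] := he s; first by rewrite add0r.
    by exists x; split=> //; exact: boundedE.
  have [|e' [L [B [/andP[e'0 e'e] Lmono LB hL]]]] := talweg_length (m := fun s => s) e0 dh.
    by move=> s hs; have [hK [[Ex Fx] sl]] := hh s hs; split=> //; case/andP: hs.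
  (* Between the levels [s / 2] and [s] the slopes are at most [s], so the drop [s / 2] costs length
     at least 1/2; the dyadic intervals add up. *)
  have half s : 0 < s -> s < e' -> 1 / 2 <= L s - L (s / 2).
    move=> s0 se; have := hL s (s / 2) s; rewrite -(ler_pM2l s0).
    have e2 : s - s / 2 = s * (1 / 2) by field.
    by rewrite -e2; apply; try lra; move=> u; lra.
  have iter n s : 0 < s -> s < e' -> n%:R / 2 <= L s - L (s / 2 ^+ n).
    elim: n s => [|n IH] s s0 se; first by rewrite expr0 divr1 mul0r subrr.
    have h1 := half s s0 se.
    have h2 : n%:R / 2 <= L (s / 2) - L (s / 2 / 2 ^+ n) by apply: IH; lra.
    have -> : s / 2 ^+ n.+1 = s / 2 / 2 ^+ n by rewrite exprS invfM mulrA.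
    by rewrite -natr1; lra.
  pose s := e' / 2; have s0 : 0 < s by rewrite /s; lra.
  have se : s < e' by rewrite /s; lra.
  (* [n / 2] exceeds [2 * B], which bounds the oscillation of [L]. *)
  pose n := Num.bound `|4 * B + 1|.
  have hn : 4 * B + 1 < n%:R.
    by apply: le_lt_trans (ler_norm _) _; exact: archi_boundP (normr_ge0 _).
  have := iter n s s0 se.
  have b1 := LB s s0 se.
  have t0 : 0 < s / 2 ^+ n by rewrite divr_gt0 // exprn_gt0.
  have ts : s / 2 ^+ n <= s.
    rewrite ler_pdivrMr ?exprn_gt0 //; apply: ler_peMr; first exact: ltW.
    by apply: exprn_ege1; lra.
  have b2 := LB _ t0 (le_lt_trans ts se).
  by move: b1 b2; rewrite !ler_norml; lra.
(* Now every slope bound attained at level [s] exceeds [s], so the infimum over the level is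
   positive; one of them is below 1, the bound used in the choice of [m]. *)
have [e2 e20 he2] := small 1 ltr01.
have gts s m : 0 < s < e1 -> attained s m -> s < m.
  move=> hs [x [Ex [m0 sl]]]; rewrite ltNge; apply/negP => ms.
  apply: (he1 s); first by rewrite add0r.
  by exists x; split=> //; split; [case/andP: hs|exact: ascent_slope_le sl].
pose e := Num.min e1 e2.
have e0 : 0 < e by rewrite lt_min e10.
have inE1 s : 0 < s < e -> 0 < s < e1 by rewrite lt_min => /and3P[-> ->].
have inE2 s : 0 < s < e -> 0 < s < 0 + e2 by rewrite lt_min add0r => /and3P[-> _ ->].
(* The infimum may not be attained, so [m s] is chosen within a factor 2 of it. *)
have [||m dm hm] := @definable_choice1 R
   (fun s m => attained s m /\ forall m' : R, attained s m' -> m <= m' + m') e 1.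
- definable_auto; first exact: dA.
  refine (definable_comp (P := fun sm : prod_ctx RC RC => attained sm.1 sm.2)
    (g := fun c : prod_ctx (prod_ctx RC RC) RC => (c.1.1, c.2)) _ dA).
  by apply: polymap_pair; polymap_proj.
- move=> s hs.
  have [m1 m11 am1] := he2 s (inE2 s hs).
  have s0 : 0 < s by case/andP: hs.
  have hS : has_inf (attained s).
    by split; [exists m1|exists s => m /(gts _ _ (inE1 s hs)) /ltW].
  have si : s <= inf (attained s).
    by apply: lb_le_inf; [exists m1|move=> m /(gts _ _ (inE1 s hs)) /ltW].
  have i0 : 0 < inf (attained s) by lra.
  have [m2 am2 m2i] := inf_adherent i0 hS.
  have il m' : attained s m' -> inf (attained s) <= m' by move=> am; apply: ge_inf => //; case: hS.
  have [m2m1|m1m2] := leP m2 m1.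
    exists m2; split; last by split=> // m' /il; lra.
    by have := gts _ _ (inE1 s hs) am2; rewrite ler_norml; lra.
  exists m1; split; last by split=> // m' /il; lra.
  by have := gts _ _ (inE1 s hs) am1; rewrite ler_norml; lra.
have [||h dh hh] := @definable_choice R I
    (fun s x => (E x /\ F x = s) /\ ascent_slope x (m s)) e K.
- definable_auto.
  apply: (@definable_subst R (prod_ctx RC (ffun_ctx R I))
    (fun c v => ascent_slope c.2 v) (fun c => m c.1)); first by defun_auto.
  refine (definable_comp (P := fun xm : prod_ctx (ffun_ctx R I) RC => ascent_slope xm.1 xm.2)
    (g := fun c : prod_ctx (prod_ctx RC (ffun_ctx R I)) RC => (c.1.2, c.2)) _ definable_ascent_slope).
  by apply: polymap_pair; polymap_proj.
- move=> s hs; have [_ [[x [[Ex Fx] [_ sl]]] _]] := hm s hs.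
  by exists x; split=> //; exact: boundedE.
have [|e' [L [B [/andP[e'0 e'e] Lmono LB hL]]]] := talweg_length (m := m) e0 dh.
  move=> s hs; have [hK [[Ex Fx] sl]] := hh s hs; split=> //.
  by have [_ [am _]] := hm s hs; have [x [_ []]] := am.
(* If [m] were nonincreasing near 0, the slopes there would be at least [m s1 / 2], the case already
   excluded. Hence [m] is nondecreasing, and [M = m s] serves in the length bound. *)
have [e3 e30 [mono|mono]] := defun_monotone dm; last first.
  case: nobelow; pose s1 := Num.min e3 e / 2.
  have e3e : 0 < Num.min e3 e by rewrite lt_min e30.
  have s1e : 0 < s1 < e by rewrite /s1; case: (leP e3 e) e3e => ? ?; lra.
  have s1e3 : s1 < e3 by rewrite /s1; case: (leP e3 e) e3e => ? ?; lra.
  have [_ [[x [_ [m0 _]]] _]] := hm s1 s1e.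
  exists (m s1 / 2); first by lra.
  exists s1; first by case/andP: s1e.
  move=> s; rewrite add0r => /andP[s0 ss1] m' am'.
  have se : 0 < s < e by lra.
  have [_ [_ /(_ _ am')]] := hm s se.
  by have := mono s s1 s0 (ltW ss1) s1e3; lra.
pose e4 := Num.min e' e3.
have in3 s : s < e4 -> s < e3 by rewrite lt_min => /andP[].
have in' s : s < e4 -> s < e' by rewrite lt_min => /andP[].
(* Doubling [L] pays for the factor 2 in the choice of [m]. *)
apply: (@desingularizes_of_bounded e4 (2 * B) (fun s => 2 * L s)).
- by rewrite lt_min e'0.
- by move=> s s' s0 ss /in' se; rewrite ler_pM2l //; exact: Lmono.
- by move=> s s0 /in' se; rewrite normrM ger0_norm // ler_pM2l //; exact: LB.
- move=> s' s m' s'0 ss se am.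
  have [_ [_ /(_ _ am) hm']] := hm s ltac:(have := in' s se; lra).
  have h1 : s - s' <= m s * (L s - L s').
    by apply: hL => //; [exact: in'|move=> u /andP[us1 us2]; apply: mono => //; [lra|exact: in3]].
  have L0 : 0 <= L s - L s' by rewrite subr_ge0; apply: Lmono => //; exact: in'.
  have : m s * (L s - L s') <= (m' + m') * (L s - L s') by apply: ler_wpM2r.
  lra.
Qed.

End KurdykaLojasiewicz.

(** * Convergence of descent sequences *)

Section DescentConvergence.
Variables (R : realType) (I : finType).
Local Notation point := {ffun I -> R}.

Lemma amgm_sqr (a b c : R) : 0 <= a -> 0 <= b -> c ^+ 2 <= a * b -> c + c <= a + b.
Proof.
move=> a0 b0 hc; have [|c0] := leP (c + c) 0; first by lra.
rewrite -(@ler_pXn2r _ 2) ?nnegrE //; [|lra|lra].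
have := sqr_ge0 (a - b); rewrite !expr2 in hc *; lra.
Qed.

(** With [D k] the length of step [k], the decrease at step [k.+1] and the slope bound by step [k]
    give [D k.+1 ^+ 2 <= D k * q], where [q] is a telescoping difference of [psi]. As the decrease
    is known only in the ball of radius [rho], the sum of lengths and the confinement to the ball
    are proved together. *)
Lemma kl_convergence (x : nat -> point) (xs : point) (s : nat -> R) (psi : R -> R)
    (a b e rho eta : R) :
  0 < a -> 0 <= b -> 0 < e -> 0 < rho -> 0 < eta ->
  psi 0 = 0 ->
  (forall u v, 0 <= u -> u <= v -> v < e -> psi u <= psi v) ->
  (forall c, 0 < c -> exists2 d, 0 < d & forall u, 0 <= u < d -> psi u < c) ->
  (forall k, s k.+1 <= s k) -> (forall k, 0 <= s k) ->
  (forall c, 0 < c -> exists k0, forall k, (k0 <= k)%N -> s k < c) ->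
  (forall k, dist1 (x k) xs < rho -> s k < eta ->
     a * dist1 (x k.+1) (x k) ^+ 2 <= s k - s k.+1) ->
  (forall k, s k.+1 < e -> s k.+1 - s k.+2 <=
     b * dist1 (x k.+1) (x k) * (psi (s k.+1) - psi (s k.+2))) ->
  (forall c k0, 0 < c -> exists2 k, (k0 <= k)%N & dist1 (x k) xs < c) ->
  forall c, 0 < c -> exists k0, forall k, (k0 <= k)%N -> dist1 (x k) xs < c.
Proof.
move=> a0 b0 e0 rho0 eta0 psi0 psim psis sdec s0 slim hdec hkl hclus c c0.
(* A potential below [c] must confine the iterates to the ball where [hdec] applies. *)
wlog crho : c c0 / c <= rho.
  move=> hw; have [k0 hk0] := hw (Num.min c rho)
    ltac:(by rewrite lt_min c0) ltac:(by rewrite ge_min lexx orbT).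
  by exists k0 => k /hk0; rewrite lt_min => /andP[].
pose D k := dist1 (x k.+1) (x k).
have D0 k : 0 <= D k by exact: dist1_ge0.
have ba0 : 0 <= b / a by apply: divr_ge0 => //; exact: ltW.
(* Distance to the limit, last step, and an allowance for all later steps: by [amgm_sqr], the last
   two terms pay for the new step. *)
pose Phi k := dist1 (x k.+1) xs + D k + b / a * psi (s k.+1).
have step k : s k.+1 < e -> s k.+1 < eta -> dist1 (x k.+1) xs < rho -> Phi k.+1 <= Phi k.
  move=> se seta xr; set q := b / a * (psi (s k.+1) - psi (s k.+2)).
  have q0 : 0 <= q by apply: mulr_ge0 => //; rewrite subr_ge0 psim.
  have : D k.+1 + D k.+1 <= D k + q.
    apply: amgm_sqr => //; rewrite -(ler_pM2l a0).
    apply: le_trans (hdec _ xr seta) _; apply: le_trans (hkl _ se) _.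
    by rewrite /q /D le_eqVlt; apply/orP; left; apply/eqP; field; rewrite gt_eqF.
  have := dist1_triangle (x k.+1) (x k.+2) xs.
  by rewrite /Phi /q mulrBr -/(D k.+1); lra.
(* Shares of [c]: [c / 4] for the distance at the starting index, [c / 8] for the first step, which
   counts twice, and [c / 8] for the [psi] term. Adding 1 to [b / a] covers [b = 0]. *)
have [d d0 hd] := psis (c / 8 / (b / a + 1)) ltac:(by apply: divr_gt0; lra).
pose m := Num.min (Num.min e eta) (Num.min d (a * (c / 8) ^+ 2)).
have m0 : 0 < m by rewrite !lt_min e0 eta0 d0 /= mulr_gt0 // exprn_gt0 //; lra.
have [k1 hk1] := slim m m0.
have [k0 k01 hk0] := hclus (c / 4) k1 ltac:(lra).
have sm k : (k0 <= k)%N -> [/\ s k < e, s k < eta, s k < d & s k < a * (c / 8) ^+ 2].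
  move=> kk; have := hk1 k (leq_trans k01 kk).
  by rewrite !lt_min => /andP[/andP[-> ->] /andP[-> ->]].
have Phi0 : Phi k0 < c.
  have [s1 s2 s3 s4] := sm k0 (leqnn _).
  have [_ _ s3' _] := sm k0.+1 (leqnSn _).
  have Dk : D k0 < c / 8.
    have h : a * D k0 ^+ 2 <= s k0 - s k0.+1 by apply: hdec => //; lra.
    have : a * D k0 ^+ 2 < a * (c / 8) ^+ 2 by have := s0 k0.+1; lra.
    by rewrite ltr_pM2l // ltr_pXn2r ?nnegrE //; lra.
  have hp : b / a * psi (s k0.+1) <= c / 8.
    have h1 : psi (s k0.+1) <= c / 8 / (b / a + 1) by apply/ltW/hd; rewrite s0.
    have p0 : 0 <= psi (s k0.+1) by rewrite -psi0; apply: psim => //; have [] := sm k0.+1 (leqnSn _).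
    have : (b / a + 1) * psi (s k0.+1) <= c / 8 by rewrite mulrC -ler_pdivlMr //; lra.
    by rewrite mulrDl mul1r; lra.
  have := dist1_triangle (x k0) (x k0.+1) xs.
  by rewrite /Phi -/(D k0); lra.
have bound k : dist1 (x k.+1) xs <= Phi k \/ ~ (k0 <= k)%N.
  have [kk|nk] := boolP (k0 <= k)%N; last by right.
  left; rewrite /Phi -addrA lerDl addr_ge0 // mulr_ge0 //.
  by have := psim 0 (s k.+1) (lexx _) (s0 _); rewrite psi0; apply; have [] := sm k.+1 (leqW kk).
have hPhi j : Phi (k0 + j)%N < c.
  elim: j => [|j IH]; first by rewrite addn0.
  have [s1 s2 _ _] := sm (k0 + j).+1 (leqW (leq_addr _ _)).
  rewrite addnS; apply: le_lt_trans (IH); apply: step => //.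
  have [h|] := bound (k0 + j)%N; last by rewrite leq_addr.
  by apply: lt_le_trans crho; apply: le_lt_trans h _.
exists k0.+1 => -[//|k]; rewrite ltnS => kk.
have [h|//] := bound k; apply: le_lt_trans h _.
by rewrite -(subnKC kk).
Qed.

End DescentConvergence.

(** * Estimates for one step of ALS *)

Section MatrixEstimates.
Variable R : realType.

Lemma sqr_sum_norm_le (J : finType) (a : J -> R) :
  (\sum_j `|a j|) ^+ 2 <= #|J|%:R * \sum_j a j ^+ 2.
Proof.
rewrite expr2 mulr_suml.
apply: (@le_trans _ _ (\sum_(j : J) \sum_(k : J) (a j ^+ 2 + a k ^+ 2) / 2)).
  apply: ler_sum => j _; rewrite mulr_sumr; apply: ler_sum => k _.
  have := sqr_ge0 (`|a j| - `|a k|).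
  rewrite -(real_normK (num_real (a j))) -(real_normK (num_real (a k))) !expr2; lra.
rewrite le_eqVlt; apply/orP; left; apply/eqP.
under eq_bigr => j _ do rewrite -mulr_suml big_split /= sumr_const -[X in X + _]mulr_natl.
rewrite -mulr_suml big_split /= sumr_const -mulr_sumr -[X in _ + X]mulr_natl.
by field.
Qed.

Lemma sum_sqr_le_sqr_sum_norm (J : finType) (a : J -> R) :
  \sum_j a j ^+ 2 <= (\sum_j `|a j|) ^+ 2.
Proof.
rewrite [X in _ <= X]expr2 mulr_suml; apply: ler_sum => j _.
rewrite -(real_normK (num_real (a j))) expr2 ler_wpM2l //.
by rewrite (bigD1 j) //= lerDl sumr_ge0.
Qed.

Definition norm1 m (y : 'cV[R]_m) : R := \sum_i `|y i 0|.

Lemma norm1_ge0 m (y : 'cV[R]_m) : 0 <= norm1 y.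
Proof. exact: sumr_ge0. Qed.

Lemma norm1D m (y z : 'cV[R]_m) : norm1 (y + z) <= norm1 y + norm1 z.
Proof.
by rewrite -big_split /=; apply: ler_sum => i _; rewrite mxE; exact: ler_normD.
Qed.

Lemma norm1_mulmx m p (B : 'M[R]_(m, p)) (c : R) (y : 'cV[R]_p) :
  (forall i j, `|B i j| <= c) -> norm1 (B *m y) <= m%:R * c * norm1 y.
Proof.
move=> hB; apply: (@le_trans _ _ (\sum_(i < m) c * norm1 y)).
  apply: ler_sum => i _; rewrite mxE; apply: le_trans (ler_norm_sum _ _ _) _.
  by rewrite mulr_sumr; apply: ler_sum => j _; rewrite normrM ler_wpM2r.
by rewrite sumr_const card_ord -[(c * _) *+ _]mulr_natl mulrA.
Qed.

Lemma quadE m (H : 'M[R]_m) (y : 'cV[R]_m) :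
  (y^T *m H *m y) 0 0 = \sum_i \sum_j H i j * y i 0 * y j 0.
Proof.
rewrite mxE exchange_big /=; apply: eq_bigr => j _.
by rewrite !mxE mulr_suml; apply: eq_bigr => i _; rewrite mxE [y i 0 * _]mulrC.
Qed.

Lemma quad_le m (H : 'M[R]_m) (c : R) (y : 'cV[R]_m) :
  (forall i j, `|H i j| <= c) -> (y^T *m H *m y) 0 0 <= c * norm1 y ^+ 2.
Proof.
move=> hH; rewrite quadE expr2 /norm1 mulr_suml mulr_sumr; apply: ler_sum => i _.
rewrite mulr_sumr mulr_sumr; apply: ler_sum => j _.
apply: le_trans (ler_norm _) _; rewrite !normrM -mulrA.
by apply: ler_wpM2r => //; apply: mulr_ge0.
Qed.

(* Evaluating the form at [y - K^-1 H y] bounds [|H y|^2] by [K (y, H y)]. *)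
Lemma psd_mul_le m (H : 'M[R]_m) (K : R) (y : 'cV[R]_m) : psd H -> 0 < K ->
  (forall w : 'cV[R]_m, (w^T *m H *m w) 0 0 <= K * \sum_i w i 0 ^+ 2) ->
  \sum_i (H *m y) i 0 ^+ 2 <= K * (y^T *m H *m y) 0 0.
Proof.
move=> [HT Hpos] K0 hK.
set w := H *m y.
have sq : \sum_i w i 0 ^+ 2 = (w^T *m w) 0 0.
  by rewrite [RHS]mxE; apply: eq_bigr => i _; rewrite [w^T 0 i]mxE expr2.
have e : ((y - K^-1 *: w)^T *m H *m (y - K^-1 *: w)) 0 0 =
    (y^T *m H *m y) 0 0 - 2 / K * (w^T *m w) 0 0 + K^-1 ^+ 2 * (w^T *m H *m w) 0 0.
  have e1 : w^T *m H *m y = w^T *m w by rewrite -mulmxA.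
  have e2 : y^T *m H *m w = w^T *m w by rewrite /w trmx_mul HT.
  have e3 : (y - K^-1 *: w)^T = y^T - K^-1 *: w^T by apply/matrixP => i j; rewrite !mxE.
  rewrite e3 !mulmxBl !mulmxBr -!scalemxAl -!scalemxAr e1 e2.
  move: (y^T *m H *m y) (w^T *m w) (w^T *m H *m w) => p q r.
  by rewrite !mxE; field; rewrite gt_eqF.
have := Hpos (y - K^-1 *: w); rewrite e.
have := hK w; rewrite sq => h1 h2.
have h3 : K^-1 ^+ 2 * (w^T *m H *m w) 0 0 <= K^-1 * (w^T *m w) 0 0.
  have K2 : 0 < K^-1 ^+ 2 by rewrite exprn_gt0 // invr_gt0.
  apply: le_trans (ler_wpM2l (ltW K2) h1) _.
  by rewrite le_eqVlt; apply/orP; left; apply/eqP; field; rewrite gt_eqF.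
rewrite -ler_pdivrMl //.
have h4 : 2 / K * (w^T *m w) 0 0 = K^-1 * (w^T *m w) 0 0 + K^-1 * (w^T *m w) 0 0.
  by field; rewrite gt_eqF.
lra.
Qed.

Lemma sum_mxtrace m p (X Y : 'M[R]_(m, p)) :
  \sum_b \sum_i X b i * Y b i = \tr (X^T *m Y).
Proof.
rewrite /mxtrace exchange_big; apply: eq_bigr => i _.
by rewrite mxE; apply: eq_bigr => b _; rewrite mxE.
Qed.

(** Half the form is [tr (H U^T U) / 2 + tr (H Y^T Y) / 2 - tr (H U^T Y)], and the hypothesis on the
    Gram matrices makes the first two traces equal. A linear gain at an optimal block is thus
    quadratic in the displacement. *)
Lemma block_increase m p (U Y : 'M[R]_(m, p)) (H : 'M[R]_p) : H^T = H ->
  (forall i k, H i k * ((U^T *m U) i k - (Y^T *m Y) i k) = 0) ->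
  \sum_b \sum_i (U *m H) b i * (U b i - Y b i) =
  2^-1 * \sum_b (row b (U - Y) *m H *m (row b (U - Y))^T) 0 0.
Proof.
move=> HT hH.
have -> : \sum_b (row b (U - Y) *m H *m (row b (U - Y))^T) 0 0 = \tr ((U - Y) *m H *m (U - Y)^T).
  apply: eq_bigr => b _; rewrite -row_mul !mxE; apply: eq_bigr => k _.
  by rewrite !mxE.
have -> : \sum_b \sum_i (U *m H) b i * (U b i - Y b i) = \tr (H *m (U^T *m (U - Y))).
  rewrite (eq_bigr (fun b => \sum_i (U *m H) b i * (U - Y) b i)); last first.
    by move=> b _; apply: eq_bigr => i _; rewrite !mxE.
  by rewrite sum_mxtrace trmx_mul HT mulmxA.
have e1 : \tr (H *m (Y^T *m Y)) = \tr (H *m (U^T *m U)).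
  rewrite /mxtrace; apply: eq_bigr => i _; rewrite !mxE; apply: eq_bigr => k _.
  have := hH i k; rewrite mulrBr => /eqP; rewrite subr_eq0 => /eqP.
  have sym (W : 'M[R]_(m, p)) : (W^T *m W) k i = (W^T *m W) i k.
    by rewrite -[in LHS](trmxK W) -trmx_mul trmxK [LHS]mxE.
  by rewrite !sym.
have e2 : \tr (H *m (Y^T *m U)) = \tr (H *m (U^T *m Y)).
  by rewrite -[LHS]mxtrace_tr !trmx_mul trmxK HT mxtrace_mulC.
have e3 : \tr ((U - Y) *m H *m (U - Y)^T) = \tr (H *m ((U - Y)^T *m (U - Y))).
  by rewrite -mulmxA mxtrace_mulC -mulmxA.
have e4 : (U - Y)^T = U^T - Y^T by apply/matrixP => i j; rewrite !mxE.
rewrite e3 e4 !mulmxBl !mulmxBr !raddfB /= e1 e2.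
by field.
Qed.

End MatrixEstimates.

Section PolynomialEstimates.
Variables (R : realType) (I : finType).
Local Notation point := {ffun I -> R}.

(** Bound and Lipschitz estimate go through the induction together, since the product case needs
    both. *)
Lemma polyfun_lipschitz (p : point -> R) (K : R) : 0 <= K ->
  @polyfun R (ffun_ctx R I) p -> exists2 C, 0 <= C &
  forall x y : point, (forall i, `|x i| <= K) -> (forall i, `|y i| <= K) ->
    `|p x| <= C /\ `|p x - p y| <= C * dist1 x y.
Proof.
move=> K0; elim.
- move=> b [i ->]; exists (K + 1) => [|x y hx hy]; first by lra.
  split; first by apply: le_trans (hx i) _; lra.
  have h1 : `|x i - y i| <= dist1 x y by rewrite /dist1 (bigD1 i) //= lerDl sumr_ge0.
  apply: le_trans h1 _; rewrite ler_peMl ?dist1_ge0 //; lra.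
- move=> k; exists `|k| => // x y _ _; split=> //; rewrite subrr normr0.
  by rewrite mulr_ge0 // dist1_ge0.
- move=> p1 p2 _ [C1 C10 h1] _ [C2 C20 h2]; exists (C1 + C2); first exact: addr_ge0.
  move=> x y hx hy; have [b1 l1] := h1 x y hx hy; have [b2 l2] := h2 x y hx hy.
  split; first by apply: le_trans (ler_normD _ _) _; exact: lerD.
  rewrite opprD addrACA mulrDl; apply: le_trans (ler_normD _ _) _; exact: lerD.
- move=> p1 p2 _ [C1 C10 h1] _ [C2 C20 h2].
  have CC : 0 <= C1 * C2 by exact: mulr_ge0.
  exists (C1 * C2 + C1 * C2); first exact: addr_ge0.
  move=> x y hx hy; have [b1 l1] := h1 x y hx hy; have [b2 l2] := h2 x y hx hy.
  have [c2 _] := h2 y x hy hx.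
  split.
    by rewrite normrM; apply: le_trans (ler_pM _ _ b1 b2) _ => //; lra.
  have -> : p1 x * p2 x - p1 y * p2 y = p1 x * (p2 x - p2 y) + (p1 x - p1 y) * p2 y by ring.
  apply: le_trans (ler_normD _ _) _; rewrite !normrM mulrDl; apply: lerD.
    by apply: le_trans (ler_pM _ _ b1 l2) _ => //; rewrite mulrA.
  apply: le_trans (ler_pM _ _ l1 c2) _ => //.
  by rewrite mulrAC.
Qed.

Lemma polyfun_lipschitz_fam (J : finType) (p : J -> point -> R) (K : R) : 0 <= K ->
  (forall j, @polyfun R (ffun_ctx R I) (p j)) -> exists2 C, 0 <= C &
  forall x y : point, (forall i, `|x i| <= K) -> (forall i, `|y i| <= K) ->
    forall j, `|p j x| <= C /\ `|p j x - p j y| <= C * dist1 x y.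
Proof.
move=> K0 hp; have /choice [C hC] j : exists C, 0 <= C /\ forall x y : point,
    (forall i, `|x i| <= K) -> (forall i, `|y i| <= K) ->
    `|p j x| <= C /\ `|p j x - p j y| <= C * dist1 x y.
  by have [C C0 h] := polyfun_lipschitz K0 (hp j); exists C.
exists (\sum_j C j); first by apply: sumr_ge0 => j _; case: (hC j).
move=> x y hx hy j; have [_ /(_ x y hx hy) [h1 h2]] := hC j.
have Cj : C j <= \sum_j C j.
  by rewrite (bigD1 j) //= lerDl sumr_ge0 // => k _; case: (hC k).
split; first exact: le_trans Cj.
by apply: le_trans h2 _; rewrite ler_wpM2r // dist1_ge0.
Qed.

End PolynomialEstimates.

(** * Coordinates on the factors, and multilinearity *)

Section Encoding.
Variables (R : realType) (d r : nat) (n : 'I_d -> nat).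
Local Notation factorsR := (factors R n r).

(** Flattens matrices whose row numbers depend on the mode into one finite family of reals, the kind
    of point that definability and [dist1] deal with. *)
Definition entry : finType := {j : 'I_d & ('I_(n j) * 'I_r)%type}.

Definition entries (U : factorsR) : {ffun entry -> R} :=
  [ffun a : entry => U (tag a) (tagged a).1 (tagged a).2].

Definition mk_entry (j : 'I_d) (b : 'I_(n j)) (i : 'I_r) : entry :=
  Tagged (fun j => ('I_(n j) * 'I_r)%type) (b, i).

Definition of_entries (x : {ffun entry -> R}) : factorsR :=
  fun j => \matrix_(b < n j, i < r) x (mk_entry b i).

Lemma entriesK : cancel entries of_entries.
Proof.
move=> U; apply: functional_extensionality_dep => j.
by apply/matrixP => b i; rewrite mxE ffunE.
Qed.

Lemma of_entriesK : cancel of_entries entries.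
Proof. by move=> y; apply/ffunP => -[j [b i]]; rewrite ffunE mxE. Qed.

Lemma of_entriesE x j b i : of_entries x j b i = x (mk_entry b i).
Proof. by rewrite mxE. Qed.

Lemma sum_entry (V : nmodType) (f : forall j : 'I_d, 'I_(n j) -> 'I_r -> V) :
  \sum_(a : entry) f (tag a) (tagged a).1 (tagged a).2 = \sum_j \sum_b \sum_i f j b i.
Proof.
under [RHS]eq_bigr => j _ do rewrite pair_big /=.
by rewrite sig_big_dep /=.
Qed.

Definition dist (U V : factorsR) : R := dist1 (entries U) (entries V).

Lemma distE (U V : factorsR) : dist U V = \sum_j \sum_b \sum_i `|U j b i - V j b i|.
Proof.
rewrite /dist /dist1 -(sum_entry (fun j b i => `|U j b i - V j b i|)).
by apply: eq_bigr => a _; rewrite !ffunE.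
Qed.

Lemma dist_entry (U V : factorsR) j b i : `|U j b i - V j b i| <= dist U V.
Proof.
rewrite /dist /dist1 (bigD1 (mk_entry b i)) //= !ffunE /= lerDl.
exact: sumr_ge0.
Qed.

Lemma dist_ge0 U V : 0 <= dist U V. Proof. exact: dist1_ge0. Qed.
Lemma distC U V : dist U V = dist V U. Proof. exact: dist1C. Qed.
Lemma dist_triangle W U V : dist U V <= dist U W + dist W V.
Proof. exact: dist1_triangle. Qed.

Lemma dist_gauss_seidel (U U' V V' : factorsR) (j : 'I_d) :
  dist (gauss_seidel U U' j) (gauss_seidel V V' j) <= dist U V + dist U' V'.
Proof.
rewrite !distE -big_split; apply: ler_sum => l _.
rewrite -big_split; apply: ler_sum => b _.
rewrite -big_split; apply: ler_sum => i _; rewrite /= /gauss_seidel.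
by case: ifP => _; [rewrite lerDr|rewrite lerDl].
Qed.

Lemma gauss_seidelxx (U : factorsR) (j : 'I_d) : gauss_seidel U U j = U.
Proof.
by apply: functional_extensionality_dep => l; rewrite /gauss_seidel; case: ifP.
Qed.

Variable A : tensor R n.

Lemma polyfun_sigma i :
  @polyfun R (ffun_ctx R entry) (fun x => sigma A (of_entries x) i 0).
Proof.
rewrite (_ : (fun x => _) = fun x : {ffun entry -> R} => \sum_(a : multi_index n)
    A a * \prod_(j < d) x (mk_entry (a j) i)); last first.
  apply/funext => x; rewrite mxE; apply: eq_bigr => a _; rewrite ffunE; congr (_ * _).
  by apply: eq_bigr => j _; rewrite !mxE.
apply: (@polyfun_sum R (ffun_ctx R entry)) => a.
apply: (@polyfun_mul R (ffun_ctx R entry) (fun=> A a)); first exact: polyfun_cst.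
by apply: (@polyfun_prod R (ffun_ctx R entry)) => j; exact: polyfun_ffun.
Qed.

Lemma polyfun_contractions (e : entry) :
  @polyfun R (ffun_ctx R entry)
    (fun x => contractions A (of_entries x) (tag e) (tagged e).1 (tagged e).2).
Proof.
rewrite (_ : (fun x => _) = fun x : {ffun entry -> R} =>
    \sum_(a : multi_index n | a (tag e) == (tagged e).1)
    A a * \prod_(l < d | l != tag e) x (mk_entry (a l) (tagged e).2)); last first.
  apply/funext => x; rewrite !mxE; apply: eq_bigr => a _; congr (_ * _).
  by apply: eq_bigr => j _; rewrite !mxE.
apply: (@polyfun_sum R (ffun_ctx R entry)) => a.
apply: (@polyfun_mul R (ffun_ctx R entry) (fun=> A a)); first exact: polyfun_cst.
by apply: (@polyfun_prod R (ffun_ctx R entry)) => j; exact: polyfun_ffun.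
Qed.

Definition bounded1 (U : factorsR) : Prop := forall j b i, `|U j b i| <= 1.

Lemma bounded1_gauss_seidel (U U' : factorsR) j :
  bounded1 U -> bounded1 U' -> bounded1 (gauss_seidel U U' j).
Proof. by move=> h h' l b i; rewrite /gauss_seidel; case: ifP. Qed.

Lemma lipschitz_sigma_contractions : exists2 C, 0 < C &
  forall U V : factorsR, bounded1 U -> bounded1 V ->
  (forall i, `|sigma A U i 0| <= C /\
     `|sigma A U i 0 - sigma A V i 0| <= C * dist U V) /\
  (forall j b i, `|contractions A U j b i| <= C /\
     `|contractions A U j b i - contractions A V j b i| <= C * dist U V).
Proof.
have [C1 C10 h1] := polyfun_lipschitz_fam ler01 polyfun_sigma.
have [C2 C20 h2] := polyfun_lipschitz_fam ler01 polyfun_contractions.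
exists (C1 + C2 + 1); first by lra.
move=> U V hU hV.
have eU a : `|entries U a| <= 1 by rewrite ffunE.
have eV a : `|entries V a| <= 1 by rewrite ffunE.
have dd : 0 <= dist U V := dist_ge0 U V.
split=> [i|j b i].
  have [] := h1 _ _ eU eV i; rewrite !entriesK -/(dist U V) => b1 b2; split; first lra.
  by apply: le_trans b2 _; apply: ler_wpM2r => //; lra.
have [] := h2 _ _ eU eV (mk_entry b i); rewrite !entriesK -/(dist U V) /= => b1 b2.
split; first by lra.
by apply: le_trans b2 _; apply: ler_wpM2r => //; lra.
Qed.

(* Multilinearity, replacing one mode at a time. *)
Lemma sigma_telescope (U V : factorsR) i :
  sigma A V i 0 - sigma A U i 0 = \sum_(j < d) \sum_b
    contractions A (gauss_seidel U V j) j b i * (V j b i - U j b i).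
Proof.
(* [G j] is the point of the sweep at which mode [j] is contracted; [G j] and [G j.+1] differ in
   that mode only, which the contraction does not read. *)
pose G (m : nat) : factorsR := fun l => if (l < m)%N then V l else U l.
pose T (W : factorsR) := tinner A (outer (fun l => col i (W l))).
have GE : sigma A V i 0 - sigma A U i 0 = T (G d) - T (G 0%N).
  rewrite !mxE /T; congr (tinner A (outer _) - tinner A (outer _));
  apply: functional_extensionality_dep => l; rewrite /G ?ltn0 ?ltn_ord //.
rewrite GE -(telescope_sumr (fun m => T (G m))) // big_mkord; apply: eq_bigr => j _.
have TE (y : 'M[R]_(n j, r)) (W : factorsR) : W j = y -> (forall l, l != j -> W l = G j l) ->
    T W = \sum_b contractions A (gauss_seidel U V j) j b i * y b i.
  move=> Wj Wl; rewrite /T.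
  rewrite (_ : (fun l => col i (W l)) =
     eqtype.dfwith (fun l => col i (gauss_seidel U V j l)) (col i y)).
    rewrite tinner_outer_dfwith; apply: eq_bigr => b _.
    by congr (_ * _); [rewrite [RHS]mxE|rewrite [LHS]mxE].
  apply: functional_extensionality_dep => l; have [->|lj] := eqVneq l j.
    by rewrite dfwith_in Wj.
  by rewrite dfwith_out 1?eq_sym // Wl.
rewrite (TE (V j) (G j.+1)); last 2 first.
- by rewrite /G ltnS leqnn.
- by move=> l lj; rewrite /G ltnS leq_eqVlt val_eqE (negbTE lj).
rewrite (TE (U j) (G j)); last 2 first.
- by rewrite /G ltnn.
- by [].
by rewrite -sumrB; apply: eq_bigr => b _; rewrite mulrBr.
Qed.

End Encoding.

(** * The gain of one ALS step *)

Section AlsStep.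
Variables (R : realType) (d t r : nat) (n : 'I_d -> nat) (A : tensor R n).
Local Notation factorsR := (factors R n r).
Local Notation state := (als_state R n r).

Lemma enorm_sqr m (y : 'cV[R]_m) : enorm y ^+ 2 = \sum_b y b 0 ^+ 2.
Proof. by rewrite sqr_sqrtr // sumr_ge0 // => b _; exact: sqr_ge0. Qed.

Lemma enorm_ge0 m (y : 'cV[R]_m) : 0 <= enorm y.
Proof. exact: sqrtr_ge0. Qed.

Lemma enorm_eq1 m (y : 'cV[R]_m) : enorm y = 1 <-> \sum_b y b 0 ^+ 2 = 1.
Proof.
split; first by rewrite -enorm_sqr => ->; rewrite expr1n.
by rewrite /enorm => ->; exact: sqrtr1.
Qed.

Lemma feasible_col (U : factorsR) j i : feasible t U -> \sum_b U j b i ^+ 2 = 1.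
Proof.
move=> [hs ho]; case: (leqP (d - t) j) => hj.
  have /matrixP/(_ i i) := ho j hj; rewrite !mxE eqxx => h; apply: etrans h.
  by apply: eq_bigr => b _; rewrite mxE expr2.
by have /enorm_eq1 <- := hs j i hj; apply: eq_bigr => b _; rewrite mxE.
Qed.

Lemma feasible_bounded1 (U : factorsR) : feasible t U -> bounded1 U.
Proof.
move=> hU j b i; rewrite -(@ler_pXn2r _ 2) ?nnegrE // expr1n real_normK ?num_real //.
rewrite -(feasible_col j i hU) (bigD1 b) //= lerDl.
by apply: sumr_ge0 => b' _; exact: sqr_ge0.
Qed.

Lemma sigma_contractions (U : factorsR) j i :
  sigma A U i 0 = \sum_b contractions A U j b i * U j b i.
Proof.
rewrite mxE -[X in outer X](_ : eqtype.dfwith (fun l => col i (U l)) (col i (U j)) = _).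
  rewrite tinner_outer_dfwith; apply: eq_bigr => b _.
  by congr (_ * _); [rewrite [RHS]mxE|rewrite [LHS]mxE].
apply: functional_extensionality_dep => l; have [->|lj] := eqVneq l j.
  by rewrite dfwith_in.
by rewrite dfwith_out // eq_sym.
Qed.

Definition objective (U : factorsR) : R := \sum_i sigma A U i 0 ^+ 2.

Variable delta : R.
Hypotheses (delta0 : 0 < delta) (r0 : (0 < r)%N).

Definition normalized (x : state) : Prop :=
  [/\ feasible t x.1, x.2 = (enorm (sigma A x.1))^-1 *: sigma A x.1
    & forall i, delta <= `|sigma A x.1 i 0|].

Lemma objective_enorm U : enorm (sigma A U) ^+ 2 = objective U.
Proof. exact: enorm_sqr. Qed.

Section Normalized.
Variables (x : state) (nx : normalized x).
Let f := enorm (sigma A x.1).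

Lemma normalized_bounded1 : bounded1 x.1.
Proof. by case: nx => h _ _; exact: feasible_bounded1 h. Qed.

Lemma sigma_le_enorm i : `|sigma A x.1 i 0| <= f.
Proof.
rewrite -(@ler_pXn2r _ 2) ?nnegrE ?enorm_ge0 // real_normK ?num_real // enorm_sqr.
rewrite (bigD1 i) //= lerDl; by apply: sumr_ge0 => b' _; exact: sqr_ge0.
Qed.

Lemma delta_le_enorm : delta <= f.
Proof.
case: nx => _ _ h; exact: le_trans (h (Ordinal r0)) (sigma_le_enorm _).
Qed.

Lemma enorm_gt0 : 0 < f.
Proof. exact: lt_le_trans delta_le_enorm. Qed.

Lemma weightE i : x.2 i 0 = sigma A x.1 i 0 / f.
Proof. by case: nx => _ -> _; rewrite mxE mulrC. Qed.

Lemma weight_le1 i : `|x.2 i 0| <= 1.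
Proof.
rewrite weightE normrM normfV (gtr0_norm enorm_gt0) ler_pdivrMr ?enorm_gt0 // mul1r.
exact: sigma_le_enorm.
Qed.

Lemma sum_weight_sqr : \sum_i x.2 i 0 ^+ 2 = 1.
Proof.
under eq_bigr => i _ do rewrite weightE expr_div_n.
by rewrite -mulr_suml -enorm_sqr mulfV // expf_neq0 // gt_eqF ?enorm_gt0.
Qed.

Lemma sum_weight_sigma : \sum_i x.2 i 0 * sigma A x.1 i 0 = f.
Proof.
under eq_bigr => i _ do rewrite weightE mulrAC -expr2.
rewrite -mulr_suml -enorm_sqr expr2 mulfK // gt_eqF ?enorm_gt0 //.
Qed.

(** Cauchy-Schwarz against the unit vector [x.2], by expanding the square of [y - enorm y *: x.2].
    The weighted sum is thus a minorant of the norm of [sigma] that is exact at [x]. *)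
Lemma sum_weight_le (y : 'cV[R]_r) : \sum_i x.2 i 0 * y i 0 <= enorm y.
Proof.
have : 0 <= \sum_i (y i 0 - enorm y * x.2 i 0) ^+ 2 by apply: sumr_ge0 => i _; exact: sqr_ge0.
have -> : \sum_i (y i 0 - enorm y * x.2 i 0) ^+ 2 =
   enorm y ^+ 2 - 2 * enorm y * (\sum_i x.2 i 0 * y i 0) + enorm y ^+ 2.
  rewrite [X in _ = _ - _ + X](_ : _ = enorm y ^+ 2 * \sum_i x.2 i 0 ^+ 2); last first.
    by rewrite sum_weight_sqr mulr1.
  rewrite [X in _ = X - _ + _]enorm_sqr !mulr_sumr -sumrB -big_split.
  by apply: eq_bigr => i _ /=; ring.
have [e0|] := eqVneq (enorm y) 0.
  have y0 i : y i 0 = 0.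
    apply/eqP; rewrite -sqrf_eq0.
    have : \sum_b y b 0 ^+ 2 = 0 by rewrite -enorm_sqr e0 expr0n.
    move=> /eqP; rewrite psumr_eq0 => [/allP /(_ i)|b _]; last exact: sqr_ge0.
    by rewrite mem_index_enum => /(_ isT).
  by move=> _; rewrite e0 big1 // => i _; rewrite y0 mulr0.
move=> en; have e0 : 0 < enorm y by rewrite lt_neqAle eq_sym en enorm_ge0.
move=> h; rewrite -(ler_pM2l e0); rewrite !expr2 in h; lra.
Qed.

Lemma weight_sigma_ge (C : R) i : `|sigma A x.1 i 0| <= C -> f <= C ->
  delta ^+ 2 / C <= x.2 i 0 * sigma A x.1 i 0.
Proof.
move=> sC fC; rewrite weightE [X in _ <= X]mulrAC -[X in _ <= X / _]expr2 ler_pM ?sqr_ge0 // ?invr_ge0.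
- by apply: le_trans fC; exact: ltW enorm_gt0.
- rewrite -(real_normK (num_real (sigma _ _ _ _))) ler_pXn2r ?nnegrE ?(ltW delta0) //.
  by case: nx.
- by rewrite lef_pV2 // posrE ?enorm_gt0 // (lt_le_trans enorm_gt0).
Qed.

Lemma weight_ge (C : R) i : f <= C -> delta / C <= `|x.2 i 0|.
Proof.
move=> fC; rewrite weightE normrM normfV (gtr0_norm enorm_gt0) ler_pM ?(ltW delta0) //.
- by rewrite invr_ge0; apply: le_trans fC; exact: ltW enorm_gt0.
- by case: nx.
- by rewrite lef_pV2 // posrE ?enorm_gt0 // (lt_le_trans enorm_gt0).
Qed.

End Normalized.

Lemma sigma_col0 (U : factorsR) j i : col i (U j) = 0 -> sigma A U i 0 = 0.
Proof.
rewrite (sigma_contractions U j) => /matrixP h; rewrite big1 // => b _.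
by have := h b 0; rewrite !mxE => ->; rewrite mulr0.
Qed.

Section Step.
Variables x x' : state.
Hypotheses (nx : normalized x) (sx : als_step t A x x')
  (dx' : forall i, delta <= `|sigma A x'.1 i 0|).
Let V j := als_vtilde A x x'.1 j.

(** The normalization never meets a zero column: as [0^-1 = 0], the new vector and hence [sigma]
    would vanish, against [delta]. *)
Lemma als_spherical (j : 'I_d) i : (j < d - t)%N -> 0 < enorm (col i (V j)) /\
  forall b, V j b i = enorm (col i (V j)) * x'.1 j b i.
Proof.
move=> hj; case: sx => /(_ j i hj) h _ _.
have l0 : enorm (col i (V j)) != 0.
  apply/eqP => l0; have s0 : sigma A x'.1 i 0 = 0.
    by apply: (@sigma_col0 _ j); rewrite h l0 invr0 scale0r.
  by have := dx' i; rewrite s0 normr0 leNgt delta0.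
split; first by rewrite lt_neqAle eq_sym l0 enorm_ge0.
by move=> b; move/matrixP: h => /(_ b 0); rewrite !mxE => ->; rewrite mulrA mulfV ?mul1r.
Qed.

Lemma als_feasible : feasible t x'.1.
Proof.
split=> [j i hj|j hj]; last by case: sx => _ /(_ j hj) [].
have [l0 hl] := als_spherical i hj.
apply/enorm_eq1; have := enorm_sqr (col i (V j)).
rewrite (eq_bigr (fun b => enorm (col i (V j)) ^+ 2 * (col i (x'.1 j)) b 0 ^+ 2)).
  rewrite -mulr_sumr => h; apply: (mulfI (x := enorm (col i (V j)) ^+ 2)).
    by rewrite expf_neq0 // gt_eqF.
  by rewrite mulr1.
by move=> b _; rewrite mxE hl exprMn mxE.
Qed.

Lemma als_normalized : normalized x'.
Proof. by split; [exact: als_feasible|case: sx|]. Qed.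

Lemma spherical_increase (j : 'I_d) i (Y : factorsR) : (j < d - t)%N -> feasible t Y ->
  \sum_b V j b i * (x'.1 j b i - Y j b i) =
  enorm (col i (V j)) / 2 * \sum_b (x'.1 j b i - Y j b i) ^+ 2.
Proof.
move=> hj hY; have [l0 hl] := als_spherical i hj.
have h1 := feasible_col j i hY; have h2 := feasible_col j i als_feasible.
have e : \sum_b (x'.1 j b i - Y j b i) ^+ 2 = 2 - 2 * \sum_b x'.1 j b i * Y j b i.
  suff : \sum_b (x'.1 j b i - Y j b i) ^+ 2 + 2 * \sum_b x'.1 j b i * Y j b i =
      \sum_b x'.1 j b i ^+ 2 + \sum_b Y j b i ^+ 2 by rewrite h1 h2; lra.
  by rewrite mulr_sumr -!big_split; apply: eq_bigr => b _ /=; ring.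
rewrite e (eq_bigr (fun b => enorm (col i (V j)) * (x'.1 j b i ^+ 2 - x'.1 j b i * Y j b i))).
  by rewrite -mulr_sumr sumrB h2; field.
by move=> b _; rewrite hl; ring.
Qed.

(** The polar factor equals [(x'.1 j)^T *m V j], which bounds its entries; orthonormality of both
    blocks gives the equal Gram matrices for [block_increase]. *)
Lemma als_orthonormal (j : 'I_d) : (d - t <= j)%N -> exists H : 'M[R]_r,
  [/\ psd H, V j = x'.1 j *m H,
      (forall c, (forall b i, `|V j b i| <= c) -> forall i k, `|H i k| <= (n j)%:R * c) &
      forall Y, feasible t Y ->
      \sum_b \sum_i V j b i * (x'.1 j b i - Y j b i) =
      2^-1 * \sum_b (row b (x'.1 j - Y j) *m H *m (row b (x'.1 j - Y j))^T) 0 0].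
Proof.
move=> hj; case: sx => _ /(_ j hj) [UU [H [pH VH]]] _; exists H; split=> //.
  move=> c hc i k.
  have -> : H = (x'.1 j)^T *m V j by rewrite /V VH mulmxA UU mul1mx.
  rewrite mxE; apply: le_trans (ler_norm_sum _ _ _) _.
  rewrite -[n j in X in _ <= X]card_ord mulr_natl -sumr_const; apply: ler_sum => b _.
  rewrite normrM mxE; apply: le_trans (ler_pM _ _ (feasible_bounded1 als_feasible b i) (hc b k)) _ => //.
  by rewrite mul1r.
move=> Y hY; rewrite -block_increase; first by rewrite -VH.
  by case: pH.
by move=> i k; rewrite UU (hY.2 j hj) subrr mulr0.
Qed.

(** The change of the weighted sum of the [sigma_i], with weights frozen at [x.2], when mode [j] is
    replaced; it is linear because [V j] does not read mode [j]. *)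
Definition increase j := \sum_b \sum_i V j b i * (x'.1 j b i - x.1 j b i).

Lemma increase_ge0 j : 0 <= increase j.
Proof.
have fx : feasible t x.1 by case: nx.
rewrite /increase; case: (leqP (d - t) j) => hj.
  have [H [[_ pH] _ _ ->]] := als_orthonormal hj => //.
  apply: mulr_ge0; first by lra.
  by apply: sumr_ge0 => b _; have := pH (row b (x'.1 j - x.1 j))^T; rewrite trmxK.
rewrite exchange_big; apply: sumr_ge0 => i _.
rewrite spherical_increase // mulr_ge0 //; first by rewrite divr_ge0 // enorm_ge0.
by apply: sumr_ge0 => b _; exact: sqr_ge0.
Qed.

Lemma sum_increase :
  \sum_j increase j <= enorm (sigma A x'.1) - enorm (sigma A x.1).
Proof.
have h : \sum_i x.2 i 0 * sigma A x'.1 i 0 - \sum_i x.2 i 0 * sigma A x.1 i 0 <=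
    enorm (sigma A x'.1) - enorm (sigma A x.1).
  by rewrite (sum_weight_sigma nx) lerD2r; exact: (sum_weight_le nx).
apply: le_trans h.
rewrite -sumrB le_eqVlt; apply/orP; left; apply/eqP.
under [RHS]eq_bigr => i _ do rewrite -mulrBr sigma_telescope mulr_sumr.
rewrite exchange_big /=; apply: eq_bigr => j _; rewrite /increase exchange_big /=.
apply: eq_bigr => i _; rewrite mulr_sumr; apply: eq_bigr => b _.
by rewrite /V mxE mulrA.
Qed.

End Step.

End AlsStep.

Ltac nonneg := repeat first
  [ assumption | exact: sqr_ge0 | exact: ler0n | exact: normr_ge0 | by apply: ltW
  | apply: mulr_ge0 | apply: addr_ge0 | apply: divr_ge0 ].

(** The form controls [|H y|^2] by [psd_mul_le], and [|H y|] controls [|y|]: as [V diag(w) = U H]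
    with [U] bounded, this reduces to injectivity of [V], which persists near [V0] because a left
    inverse of [V0] tolerates a small perturbation. *)
Lemma psd_coercive (R : realType) (m r : nat) (V0 : 'M[R]_(m, r)) (kappa K : R) :
  \rank V0 = r -> 0 < kappa -> 0 <= K -> exists e c : R, [/\ 0 < e, 0 < c &
  forall (V U : 'M[R]_(m, r)) (H : 'M[R]_r) (w : 'cV[R]_r),
    (forall b i, `|V b i - V0 b i| <= e) -> (forall b i, `|U b i| <= 1) ->
    psd H -> (forall i k, `|H i k| <= K) -> (forall i, kappa <= `|w i 0|) ->
    (\matrix_(b, i) (w i 0 * V b i)) = U *m H ->
    forall y : 'cV[R]_r, c * \sum_i y i 0 ^+ 2 <= (y^T *m H *m y) 0 0].
Proof.
move=> rV k0 K0.
have /row_fullP [L LV] : row_full V0 by rewrite /row_full rV.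
pose cL : R := \sum_i \sum_j `|L i j|.
have cL0 : 0 <= cL by apply: sumr_ge0 => i _; exact: sumr_ge0.
have hL i j : `|L i j| <= cL.
  rewrite /cL (bigD1 i) //= (bigD1 j) //= -addrA lerDl addr_ge0 ?sumr_ge0 //.
  by move=> k _; exact: sumr_ge0.
pose M : R := r%:R * cL * m%:R.
have M0 : 0 <= M by rewrite !mulr_ge0.
(* [M * e <= 1 / 2], so the error [L *m ((V0 - V) *m z)] is absorbed by half of [norm1 z]. *)
pose e : R := 2^-1 / (M + 1).
have e0 : 0 < e by rewrite divr_gt0 //; lra.
pose B : R := 2 * (r%:R * cL) * m%:R.
have B0 : 0 <= B by rewrite !mulr_ge0 //; lra.
pose N : R := B ^+ 2 * r%:R * (K * r%:R + 1) + 1.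
have N0 : 0 < N by rewrite ltr_wpDl // !mulr_ge0 ?sqr_ge0 // addr_ge0 // mulr_ge0.
exists e, (kappa ^+ 2 / N); split=> //; first by rewrite divr_gt0 // exprn_gt0.
move=> V U H w hV hU pH hH hw VUH y.
have Kr0 : 0 < K * r%:R + 1 by rewrite ltr_wpDl // mulr_ge0.
have h1 (z : 'cV[R]_r) : norm1 z <= 2 * (r%:R * cL) * norm1 (V *m z).
  have zE : z = L *m (V *m z) + L *m ((V0 - V) *m z).
    by rewrite -mulmxDr -mulmxDl addrC subrK mulmxA LV mul1mx.
  have : norm1 z <= r%:R * cL * norm1 (V *m z) + 2^-1 * norm1 z.
    rewrite {1}zE; apply: le_trans (norm1D _ _) _; apply: lerD; first exact: norm1_mulmx.
    apply: le_trans (norm1_mulmx _ hL) _.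
    apply: (@le_trans _ _ (r%:R * cL * (m%:R * e * norm1 z))).
      apply: ler_wpM2l; first by rewrite mulr_ge0.
      by apply: norm1_mulmx => b i; rewrite !mxE distrC.
    rewrite !mulrA -/M; apply: ler_wpM2r; first exact: norm1_ge0.
    by rewrite ler_pdivrMr; lra.
  lra.
have h2 : kappa * norm1 y <= B * norm1 (H *m y).
  pose z : 'cV[R]_r := \col_i (w i 0 * y i 0).
  have Vz : V *m z = U *m (H *m y).
    rewrite mulmxA -VUH; apply/matrixP => b k; rewrite !mxE; apply: eq_bigr => i _.
    by rewrite !mxE (ord1 k); ring.
  have kz : kappa * norm1 y <= norm1 z.
    rewrite /norm1 mulr_sumr; apply: ler_sum => i _; rewrite mxE normrM.
    by apply: ler_wpM2r.
  apply: le_trans kz _; apply: le_trans (h1 z) _; rewrite Vz /B -[_ * m%:R * _]mulrA.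
  apply: ler_wpM2l; first by rewrite !mulr_ge0 //; lra.
  by have := norm1_mulmx (H *m y) hU; rewrite mulr1.
have h3 : \sum_i (H *m y) i 0 ^+ 2 <= (K * r%:R + 1) * (y^T *m H *m y) 0 0.
  apply: psd_mul_le => // v; apply: le_trans (quad_le _ hH) _.
  have := sqr_sum_norm_le (fun i => v i 0); rewrite card_ord -/(norm1 v) => hv.
  apply: le_trans (ler_wpM2l K0 hv) _; rewrite mulrA mulrDl mul1r lerDl.
  by apply: sumr_ge0 => i _; exact: sqr_ge0.
have h4 : (kappa * norm1 y) ^+ 2 <= (B * norm1 (H *m y)) ^+ 2.
  by rewrite ler_pXn2r // nnegrE mulr_ge0 ?norm1_ge0 // ltW.
have h5 : kappa ^+ 2 * \sum_i y i 0 ^+ 2 <= (kappa * norm1 y) ^+ 2.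
  by rewrite exprMn ler_wpM2l ?sqr_ge0 // sum_sqr_le_sqr_sum_norm.
have h6 : (B * norm1 (H *m y)) ^+ 2 <= B ^+ 2 * (r%:R * \sum_i (H *m y) i 0 ^+ 2).
  rewrite exprMn ler_wpM2l ?sqr_ge0 //.
  by have := sqr_sum_norm_le (fun i => (H *m y) i 0); rewrite card_ord.
have Q0 : 0 <= (y^T *m H *m y) 0 0 by case: pH => _; exact.
rewrite mulrAC ler_pdivrMr //.
apply: (le_trans h5); apply: (le_trans h4); apply: (le_trans h6).
have h7 := ler_wpM2l (mulr_ge0 (sqr_ge0 B) (ler0n R r)) h3.
rewrite mulrA; apply: le_trans h7 _.
rewrite /N mulrDr mulr1 mulrA [_ * (_ ^+ 2 * _ * _)]mulrC lerDl //.
Qed.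

(** * The slope after one ALS step *)

Section AlsEstimates.
Variables (R : realType) (d t r : nat) (n : 'I_d -> nat) (A : tensor R n).
Local Notation factorsR := (factors R n r).
Local Notation state := (als_state R n r).
Variable delta : R.
Hypotheses (delta0 : 0 < delta) (r0 : (0 < r)%N).
Local Notation normalized := (@normalized R d t r n A delta).

(** Uses [f <= 1 + f ^+ 2], which keeps square roots out of the constants. *)
Lemma enorm_bounded (C : R) (U : factorsR) : 0 <= C -> (forall i, `|sigma A U i 0| <= C) ->
  enorm (sigma A U) <= 1 + r%:R * C ^+ 2.
Proof.
move=> C0 hC; set f := enorm _.
have h : f ^+ 2 <= r%:R * C ^+ 2.
  rewrite /f enorm_sqr -[r in X in _ <= X]card_ord mulr_natl -sumr_const.
  apply: ler_sum => i _; rewrite -(real_normK (num_real (sigma _ _ _ _))).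
  by rewrite ler_pXn2r ?nnegrE.
have := sqr_ge0 (f - 1); have := enorm_ge0 (sigma A U); rewrite -/f expr2 => f0.
by rewrite expr2 in h; nra.
Qed.

Lemma weight_lipschitz (C D : R) (x x' : state) i : normalized x -> normalized x' ->
  (forall k, `|sigma A x'.1 k 0 - sigma A x.1 k 0| <= C * D) ->
  `|x'.2 i 0 - x.2 i 0| <= (C + r%:R * C) / delta * D.
Proof.
move=> nx nx' hs; have CD : 0 <= C * D by apply: le_trans (hs i).
set f := enorm (sigma A x.1); set f' := enorm (sigma A x'.1).
have f0 : 0 < f by exact: enorm_gt0 nx.
have f'0 : 0 < f' by exact: enorm_gt0 nx'.
have fd : delta <= f' by exact: delta_le_enorm nx'.
(* The norm is the largest sum against unit weights, so testing with the weights of [y'] bounds its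
   growth. *)
have one (y y' : state) : normalized y -> normalized y' ->
    (forall k, `|sigma A y'.1 k 0 - sigma A y.1 k 0| <= C * D) ->
    enorm (sigma A y'.1) - enorm (sigma A y.1) <= r%:R * (C * D).
  move=> ny ny' h; rewrite -(sum_weight_sigma delta0 r0 ny').
  have := sum_weight_le delta0 r0 ny' (sigma A y.1).
  have : \sum_k y'.2 k 0 * sigma A y'.1 k 0 - \sum_k y'.2 k 0 * sigma A y.1 k 0 <= r%:R * (C * D).
    rewrite -sumrB -[r in X in _ <= X]card_ord mulr_natl -sumr_const; apply: ler_sum => k _.
    rewrite -mulrBr; apply: le_trans (ler_norm _) _; rewrite normrM -[C * D]mul1r.
    by apply: ler_pM => //; exact: (weight_le1 delta0 r0 ny' k).
  lra.
have ff : `|f - f'| <= r%:R * (C * D).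
  rewrite ler_norml; have := one x x' nx nx' hs; have := one x' x nx' nx.
  rewrite -/f -/f' => h1 h2; have {}h1 := h1 (fun k => ltac:(by rewrite distrC)).
  by apply/andP; split; lra.
have -> : x'.2 i 0 - x.2 i 0 = ((sigma A x'.1 i 0 - sigma A x.1 i 0) + x.2 i 0 * (f - f')) / f'.
  rewrite (weightE nx') (weightE nx) -/f -/f'.
  by field; rewrite !gt_eqF.
rewrite normrM normfV (gtr0_norm f'0) ler_pdivrMr //.
have w1 := weight_le1 delta0 r0 nx i.
have h : `|(sigma A x'.1 i 0 - sigma A x.1 i 0) + x.2 i 0 * (f - f')| <= C * D + r%:R * (C * D).
  apply: le_trans (ler_normD _ _) _; apply: lerD => //.
  by rewrite normrM -[r%:R * _]mul1r; exact: ler_pM.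
apply: le_trans h _.
have -> : (C + r%:R * C) / delta * D * f' = (C * D + r%:R * (C * D)) * (f' / delta).
  by field; rewrite gt_eqF.
apply: ler_peMr; first by rewrite addr_ge0 // mulr_ge0.
by rewrite ler_pdivlMr // mul1r.
Qed.

(** The blocks of [x'.1] are stationary for [als_vtilde], computed from old weights and partly old
    factors. These differ from the data at [x'.1] by a multiple of the step, whence [C1]; terms
    quadratic in the displacement to [Y] go into [C2]. *)
Lemma als_slope : exists C1 C2 : R, [/\ 0 <= C1, 0 <= C2 &
  forall (x x' : state) (Y : factorsR), normalized x -> als_step t A x x' ->
    (forall i, delta <= `|sigma A x'.1 i 0|) -> feasible t Y ->
    objective A x'.1 - objective A Y <=
    (C1 * dist x'.1 x.1 + C2 * dist Y x'.1) * dist Y x'.1].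
Proof.
have [C C0 hC] := @lipschitz_sigma_contractions R d r n A.
pose Fm : R := 1 + r%:R * C ^+ 2.
have Fm0 : 0 < Fm by rewrite ltr_pwDl // mulr_ge0 // sqr_ge0.
pose Lw : R := (C + r%:R * C) / delta.
have Lw0 : 0 <= Lw by rewrite divr_ge0 ?(ltW delta0) // addr_ge0 ?mulr_ge0 ?(ltW C0).
pose B : R := \sum_j ((n j)%:R ^+ 2 * C * r%:R ^+ 2 : R).
have B0 : 0 <= B by apply: sumr_ge0 => j _; rewrite !mulr_ge0 ?sqr_ge0 ?(ltW C0).
exists (2 * Fm * (Lw * C + C)), (2 * Fm * (C + B)); split.
- by nonneg.
- by nonneg.
move=> x x' Y nx sx dx' hY.
have nx' : normalized x' := als_normalized delta0 sx dx'.
have bx := normalized_bounded1 nx; have bx' := normalized_bounded1 nx'.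
have bY := feasible_bounded1 hY.
set D := dist x'.1 x.1; set E := dist Y x'.1.
have D0 : 0 <= D := dist_ge0 _ _; have E0 : 0 <= E := dist_ge0 _ _.
set f' := enorm (sigma A x'.1).
have f'0 : 0 <= f' := enorm_ge0 _.
have f'F : f' <= Fm.
  by apply: enorm_bounded (ltW C0) _ => i; have [/(_ i)[]] := hC _ _ bx' bx'.
pose V j := als_vtilde A x x'.1 j.
have ZE j b i : `|x'.1 j b i - Y j b i| <= E by rewrite distrC; exact: dist_entry.
have Vb j b i : `|V j b i| <= C.
  rewrite /V mxE normrM -[C]mul1r; apply: ler_pM => //; first exact: (weight_le1 delta0 r0 nx i).
  have bg := bounded1_gauss_seidel j bx bx'.
  by have [_ /(_ j b i)[]] := hC _ _ bg bg.
(* Stationarity of block [j]: along the constraint set the linear functional decreases only to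
   second order. *)
have block j : \sum_b \sum_i V j b i * (x'.1 j b i - Y j b i) <=
    (n j)%:R ^+ 2 * C * r%:R ^+ 2 * E ^+ 2.
  have sqE b i : (x'.1 j b i - Y j b i) ^+ 2 <= E ^+ 2.
    by rewrite -(real_normK (num_real (x'.1 j b i - _))) ler_pXn2r ?nnegrE.
  case: (leqP (d - t) j) => hj.
    have [H [pH _ hH ->//]] := als_orthonormal delta0 sx dx' hj.
    have {}hH := hH C (Vb j).
    have nC : 0 <= (n j)%:R * C by rewrite mulr_ge0 ?(ltW C0).
    have h1 b : (row b (x'.1 j - Y j) *m H *m (row b (x'.1 j - Y j))^T) 0 0 <=
        (n j)%:R * C * (r%:R * E) ^+ 2.
      have := quad_le (row b (x'.1 j - Y j))^T hH; rewrite trmxK => h.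
      apply: le_trans h _; apply: ler_wpM2l => //.
      rewrite ler_pXn2r ?nnegrE ?norm1_ge0 ?mulr_ge0 //.
      rewrite /norm1 -[r in X in _ <= X]card_ord mulr_natl -sumr_const.
      by apply: ler_sum => i _; rewrite !mxE; exact: ZE.
    have h2 : \sum_b (row b (x'.1 j - Y j) *m H *m (row b (x'.1 j - Y j))^T) 0 0 <=
        (n j)%:R * ((n j)%:R * C * (r%:R * E) ^+ 2).
      by rewrite -[n j in X in _ <= X * _]card_ord mulr_natl -sumr_const; exact: ler_sum.
    have e : (n j)%:R * ((n j)%:R * C * (r%:R * E) ^+ 2) = (n j)%:R ^+ 2 * C * r%:R ^+ 2 * E ^+ 2.
      by rewrite !expr2; ring.
    have : 0 <= (n j)%:R ^+ 2 * C * r%:R ^+ 2 * E ^+ 2.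
      by rewrite !mulr_ge0 ?sqr_ge0 ?(ltW C0).
    by move: h2; rewrite e; lra.
  rewrite exchange_big /=.
  have h1 i : \sum_b V j b i * (x'.1 j b i - Y j b i) <= (n j)%:R ^+ 2 * C * E ^+ 2.
    rewrite (spherical_increase delta0 sx dx') //.
    have [l0 hl] := als_spherical delta0 sx dx' i hj.
    have l1 : enorm (col i (V j)) <= (n j)%:R * C.
      have -> : enorm (col i (V j)) = \sum_b V j b i * x'.1 j b i.
        rewrite (eq_bigr (fun b => enorm (col i (V j)) * x'.1 j b i ^+ 2)).
          by rewrite -mulr_sumr (feasible_col (t := t)) ?mulr1 //; case: nx'.
        by move=> b _; rewrite hl expr2 mulrA.
      rewrite -[n j in X in _ <= X]card_ord mulr_natl -sumr_const; apply: ler_sum => b _.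
      apply: le_trans (ler_norm _) _; rewrite normrM -[C]mulr1; exact: ler_pM.
    have z1 : \sum_b (x'.1 j b i - Y j b i) ^+ 2 <= (n j)%:R * E ^+ 2.
      by rewrite -[n j in X in _ <= X]card_ord mulr_natl -sumr_const; exact: ler_sum.
    have z0 : 0 <= \sum_b (x'.1 j b i - Y j b i) ^+ 2 by apply: sumr_ge0 => b _; exact: sqr_ge0.
    have -> : (n j)%:R ^+ 2 * C * E ^+ 2 = ((n j)%:R * C) * ((n j)%:R * E ^+ 2).
      by rewrite !expr2; ring.
    apply: ler_pM => //; first by rewrite divr_ge0 // ltW.
    by rewrite -/(V j); lra.
  have h2 : \sum_i \sum_b V j b i * (x'.1 j b i - Y j b i) <= r%:R * ((n j)%:R ^+ 2 * C * E ^+ 2).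
    by rewrite -[r in X in _ <= X * _]card_ord mulr_natl -sumr_const; exact: ler_sum.
  apply: le_trans h2 _.
  have -> : (n j)%:R ^+ 2 * C * r%:R ^+ 2 * E ^+ 2 = r%:R ^+ 2 * ((n j)%:R ^+ 2 * C * E ^+ 2) by ring.
  apply: ler_wpM2r; first by rewrite !mulr_ge0 ?sqr_ge0 ?(ltW C0).
  by rewrite expr2; apply: ler_peMr => //; rewrite ler1n.
have wd i : `|x'.2 i 0 - x.2 i 0| <= Lw * D.
  apply: weight_lipschitz nx nx' _ => k.
  by have [/(_ k)[]] := hC _ _ bx' bx.
pose c1 j b i := contractions A (gauss_seidel x'.1 Y j) j b i.
(* The coefficients obtained by telescoping [sigma] from [x'.1] to [Y] are exchanged for those of
   the step. *)
have term j b i : x'.2 i 0 * c1 j b i * (x'.1 j b i - Y j b i) <=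
    V j b i * (x'.1 j b i - Y j b i) +
    (Lw * D * C + C * (D + E)) * `|x'.1 j b i - Y j b i|.
  rewrite -lerBlDl -mulrBl; apply: le_trans (ler_norm _) _; rewrite normrM.
  apply: ler_wpM2r => //; rewrite /V mxE.
  set c2 := contractions A (gauss_seidel x.1 x'.1 j) j b i.
  have -> : x'.2 i 0 * c1 j b i - x.2 i 0 * c2 =
      (x'.2 i 0 - x.2 i 0) * c1 j b i + x.2 i 0 * (c1 j b i - c2) by ring.
  have [_ /(_ j b i)[k1 k2]] := hC _ _ (bounded1_gauss_seidel j bx' bY)
    (bounded1_gauss_seidel j bx bx').
  apply: le_trans (ler_normD _ _) _; rewrite !normrM; apply: lerD; first exact: ler_pM.
  rewrite -[C * (D + E)]mul1r; apply: ler_pM => //; first exact: (weight_le1 delta0 r0 nx i).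
  apply: le_trans k2 _; apply: ler_wpM2l; first exact: ltW.
  exact: dist_gauss_seidel.
have total : \sum_j \sum_b \sum_i x'.2 i 0 * c1 j b i * (x'.1 j b i - Y j b i) <=
    B * E ^+ 2 + (Lw * D * C + C * (D + E)) * E.
  apply: (@le_trans _ _ (\sum_j (\sum_b \sum_i V j b i * (x'.1 j b i - Y j b i) +
     (Lw * D * C + C * (D + E)) * \sum_b \sum_i `|x'.1 j b i - Y j b i|))).
    apply: ler_sum => j _; rewrite mulr_sumr -big_split; apply: ler_sum => b _.
    by rewrite mulr_sumr -big_split; apply: ler_sum => i _; exact: term.
  rewrite big_split /= -mulr_sumr -distE distC -/E lerD2r /B mulr_suml.
  by apply: ler_sum => j _; exact: block.
(* From [a ^+ 2 - b ^+ 2 <= 2 * a * (a - b)], with [a] written as [f'] times the new weight. *)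
have sq : objective A x'.1 - objective A Y <=
    2 * f' * \sum_j \sum_b \sum_i x'.2 i 0 * c1 j b i * (x'.1 j b i - Y j b i).
  rewrite /objective -sumrB.
  have -> : 2 * f' * \sum_j \sum_b \sum_i x'.2 i 0 * c1 j b i * (x'.1 j b i - Y j b i) =
     \sum_i 2 * sigma A x'.1 i 0 * (sigma A x'.1 i 0 - sigma A Y i 0).
    rewrite mulr_sumr [RHS](eq_bigr (fun i => \sum_j \sum_b 2 * f' *
       (x'.2 i 0 * c1 j b i * (x'.1 j b i - Y j b i)))).
      rewrite exchange_big; apply: eq_bigr => j _ /=; rewrite exchange_big mulr_sumr.
      by apply: eq_bigr => b _ /=; rewrite mulr_sumr.
    move=> i _; rewrite -opprB sigma_telescope -sumrN mulr_sumr; apply: eq_bigr => j _.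
    rewrite -sumrN mulr_sumr; apply: eq_bigr => b _.
    rewrite (weightE nx') -/f' /c1; field.
    by rewrite gt_eqF //; exact: enorm_gt0 nx'.
  apply: ler_sum => i _; have := sqr_ge0 (sigma A x'.1 i 0 - sigma A Y i 0).
  by rewrite !expr2; lra.
apply: le_trans sq _.
have tot0 : 0 <= B * E ^+ 2 + (Lw * D * C + C * (D + E)) * E.
  by nonneg.
apply: (@le_trans _ _ (2 * Fm * (B * E ^+ 2 + (Lw * D * C + C * (D + E)) * E))).
  apply: (@le_trans _ _ (2 * f' * (B * E ^+ 2 + (Lw * D * C + C * (D + E)) * E))).
    by apply: ler_wpM2l => //; rewrite mulr_ge0 //; lra.
  by apply: ler_wpM2r => //; lra.
rewrite le_eqVlt; apply/orP; left; apply/eqP; rewrite !expr2; ring.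
Qed.

End AlsEstimates.

(** * Sufficient increase near the cluster point *)

Section AlsIncrease.
Variables (R : realType) (d t r : nat) (n : 'I_d -> nat) (A : tensor R n).
Local Notation factorsR := (factors R n r).
Local Notation state := (als_state R n r).
Variable delta : R.
Hypotheses (delta0 : 0 < delta) (r0 : (0 < r)%N).
Local Notation normalized := (@normalized R d t r n A delta).
Variable Us : factorsR.
Hypotheses (bUs : bounded1 Us)
  (rankUs : forall j : 'I_d, (d - t <= j)%N -> \rank (contractions A Us j) = r).

Let sqdist (U V : factorsR) (j : 'I_d) : R := \sum_b \sum_i (U j b i - V j b i) ^+ 2.

Let sqdist_ge0 U V j : 0 <= sqdist U V j.
Proof. by do 2 apply: sumr_ge0 => ? _; exact: sqr_ge0. Qed.

Let dist_sqr_le (U V : factorsR) :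
  dist U V ^+ 2 <= #|entry r n|%:R * \sum_j sqdist U V j.
Proof.
apply: le_trans (sqr_sum_norm_le _) _; apply: ler_wpM2l; first exact: ler0n.
rewrite -(sum_entry (fun j b i => (U j b i - V j b i) ^+ 2)) le_eqVlt; apply/orP; left; apply/eqP.
by apply: eq_bigr => a _; rewrite !ffunE.
Qed.

(** The coercivity constant is read off at the intermediate point of the sweep, so this point must
    be near [Us] as well. For unit vectors the constant is half the norm of the updated column,
    which is at least [omega_i sigma_i] at that point because unit vectors have inner product at
    most 1. *)
Lemma increase_block_near (j : 'I_d) : exists rho c : R, [/\ 0 < rho, 0 < c &
  forall x x' : state, normalized x -> als_step t A x x' ->
    (forall i, delta <= `|sigma A x'.1 i 0|) ->
    dist (gauss_seidel x.1 x'.1 j) Us <= rho -> dist x.1 Us <= rho ->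
    c * sqdist x'.1 x.1 j <= increase A x x' j].
Proof.
have [C C0 hC] := @lipschitz_sigma_contractions R d r n A.
pose Fm : R := 1 + r%:R * C ^+ 2 + C.
have rC : 0 <= r%:R * C ^+ 2 by nonneg.
have Fm0 : 0 < Fm by rewrite /Fm; lra.
have FC : C <= Fm by rewrite /Fm; lra.
have fF (x : state) : normalized x -> enorm (sigma A x.1) <= Fm.
  move=> nx; apply: le_trans (enorm_bounded (ltW C0) _) _.
    by move=> i; have [/(_ i)[]] := hC _ _ (normalized_bounded1 nx) (normalized_bounded1 nx).
  by rewrite /Fm; lra.
case: (leqP (d - t) j) => hj.
  pose kappa := delta / Fm.
  have kappa0 : 0 < kappa by exact: divr_gt0.
  have nC : 0 <= (n j)%:R * C by nonneg.
  have [e [c [e0 c0 he]]] := psd_coercive (rankUs hj) kappa0 nC.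
  exists (e / C), (2^-1 * c); split; [exact: divr_gt0|by apply: mulr_gt0; lra|].
  move=> x x' nx sx dx' h1 h2.
  have nx' : normalized x' := als_normalized delta0 sx dx'.
  have bx := normalized_bounded1 nx; have bx' := normalized_bounded1 nx'.
  have [H [pH VH hH incE]] := als_orthonormal delta0 sx dx' hj.
  have fx : feasible t x.1 by case: nx.
  rewrite /increase incE // -mulrA ler_pM2l ?invr_gt0 //.
  have bg := bounded1_gauss_seidel j bx bx'.
  have Vb b i : `|als_vtilde A x x'.1 j b i| <= C.
    rewrite mxE normrM -[C]mul1r; apply: ler_pM => //.
      exact: (weight_le1 delta0 r0 nx i).
    by have [_ /(_ j b i)[]] := hC _ _ bg bg.
  have coer := he (contractions A (gauss_seidel x.1 x'.1 j) j) (x'.1 j) H x.2.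
  rewrite /sqdist mulr_sumr; apply: ler_sum => b _.
  have := coer _ (bx' j) pH (hH C Vb) _ VH (row b (x'.1 j - x.1 j))^T.
  rewrite trmxK; have -> : \sum_i (row b (x'.1 j - x.1 j))^T i 0 ^+ 2 =
      \sum_i (x'.1 j b i - x.1 j b i) ^+ 2.
    by apply: eq_bigr => i _; rewrite !mxE.
  apply.
    move=> b' i; have [_ /(_ j b' i)[_ h3]] := hC _ _ bg bUs.
    apply: le_trans h3 _; rewrite mulrC -ler_pdivlMr //.
  by move=> i; apply: (weight_ge delta0 r0 nx); exact: fF.
(* [c] bounds [omega_i sigma_i] from below at [x]; within [c / (4 * C)] of [Us], passing to the
   intermediate point costs at most [c / 2]. *)
pose c := delta ^+ 2 / Fm.
have c0 : 0 < c by rewrite divr_gt0 // exprn_gt0.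
exists (c / (4 * C)), (c / 4); split; [by rewrite divr_gt0 // mulr_gt0|by lra|].
move=> x x' nx sx dx' h1 h2.
have nx' : normalized x' := als_normalized delta0 sx dx'.
have bx := normalized_bounded1 nx; have bx' := normalized_bounded1 nx'.
have fx : feasible t x.1 by case: nx.
have bg := bounded1_gauss_seidel j bx bx'.
rewrite /increase /sqdist exchange_big [X in _ <= X]exchange_big /= mulr_sumr.
apply: ler_sum => i _; rewrite (spherical_increase delta0 sx dx') //.
apply: ler_wpM2r; first by apply: sumr_ge0 => b _; exact: sqr_ge0.
set l := enorm _; suff hl : c / 2 <= l by lra.
have [l0 hV] := als_spherical delta0 sx dx' i hj.
have uv : \sum_b x'.1 j b i * x.1 j b i <= 1.
  have : 0 <= \sum_b (x'.1 j b i - x.1 j b i) ^+ 2 by apply: sumr_ge0 => b _; exact: sqr_ge0.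
  have : \sum_b (x'.1 j b i - x.1 j b i) ^+ 2 + 2 * \sum_b x'.1 j b i * x.1 j b i = 1 + 1.
    have fx' : feasible t x'.1 by case: nx'.
    rewrite -[X in _ = X + _](feasible_col j i fx') -[X in _ = _ + X](feasible_col j i fx).
    by rewrite mulr_sumr -!big_split; apply: eq_bigr => b _ /=; ring.
  lra.
have e : x.2 i 0 * sigma A (gauss_seidel x.1 x'.1 j) i 0 = l * \sum_b x'.1 j b i * x.1 j b i.
  rewrite (sigma_contractions A _ j) !mulr_sumr; apply: eq_bigr => b _.
  rewrite mulrA [X in _ = X]mulrA -hV [X in _ = X * _]mxE; congr (_ * _).
  by rewrite /gauss_seidel ltnn.
have le_l : x.2 i 0 * sigma A (gauss_seidel x.1 x'.1 j) i 0 <= l by rewrite e ler_piMr // ltW.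
have s1 : `|sigma A (gauss_seidel x.1 x'.1 j) i 0 - sigma A x.1 i 0| <= c / 2.
  have [/(_ i)[_ h3] _] := hC _ _ bg bx; apply: le_trans h3 _.
  have h4 : dist (gauss_seidel x.1 x'.1 j) x.1 <= c / (4 * C) + c / (4 * C).
    apply: le_trans (dist_triangle Us _ _) _; apply: lerD => //.
    by rewrite distC.
  apply: le_trans (ler_wpM2l (ltW C0) h4) _.
  by rewrite le_eqVlt; apply/orP; left; apply/eqP; field; rewrite gt_eqF.
have s2 : c <= x.2 i 0 * sigma A x.1 i 0.
  apply: (weight_sigma_ge delta0 r0 nx); last exact: fF.
  by apply: le_trans FC; have [/(_ i)[]] := hC _ _ bx bx.
have s3 : `|x.2 i 0 * (sigma A (gauss_seidel x.1 x'.1 j) i 0 - sigma A x.1 i 0)| <= c / 2.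
  by rewrite normrM -[c / 2]mul1r; apply: ler_pM => //; exact: (weight_le1 delta0 r0 nx i).
by move: s3; rewrite mulrBr ler_norml; lra.
Qed.

(** No bound on the step length is known beforehand. A gain below [eta] takes its place, which holds
    eventually because the objective values converge. *)
Lemma als_sufficient_increase : exists rho a eta : R, [/\ 0 < rho, 0 < a, 0 < eta &
  forall x x' : state, normalized x -> als_step t A x x' ->
    (forall i, delta <= `|sigma A x'.1 i 0|) -> dist x.1 Us < rho ->
    enorm (sigma A x'.1) - enorm (sigma A x.1) < eta ->
    a * dist x'.1 x.1 ^+ 2 <= enorm (sigma A x'.1) - enorm (sigma A x.1)].
Proof.
have /choice [p hp] j := increase_block_near j.
have /choice [q hq] j := hp j.
have [rho /andP[rho0 _] hrho] := common_radius (e := p) ltr01 (fun j => ltac:(by case: (hq j))).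
have [c /andP[c0 _] hc] := common_radius (e := q) ltr01 (fun j => ltac:(by case: (hq j))).
pose N : R := #|entry r n|%:R + 1.
have N0 : 0 < N by rewrite /N ltr_wpDl.
have NN : #|entry r n|%:R <= N by rewrite /N lerDl.
exists (rho / 2), (c / N), (c / N * (rho / 2) ^+ 2); split.
- by lra.
- exact: divr_gt0.
- by apply: mulr_gt0; [exact: divr_gt0|apply: exprn_gt0; lra].
move=> x x' nx sx dx' xrho fd; set g := enorm _ - enorm _ in fd *.
have incg : \sum_j increase A x x' j <= g := sum_increase delta0 r0 x' nx.
have inc0 j : 0 <= increase A x x' j := increase_ge0 delta0 nx sx dx' j.
have block j : c * sqdist x'.1 x.1 j <= increase A x x' j.
  (* Strong induction on the mode: the gains of the modes before [j] bound the displacement of the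
     intermediate point, which therefore stays near [Us]. *)
  have [m] := ubnP (j : nat); elim: m j => // m IH j; rewrite ltnS => jm.
  have gs : dist (gauss_seidel x.1 x'.1 j) x.1 <= rho / 2.
    rewrite -(@ler_pXn2r _ 2) ?nnegrE ?dist_ge0 //; last by lra.
    have h1 : c * \sum_l sqdist (gauss_seidel x.1 x'.1 j) x.1 l <= g.
      apply: le_trans incg; rewrite mulr_sumr; apply: ler_sum => l _.
      rewrite /sqdist /gauss_seidel; case: ltnP => lj.
        by apply: IH; exact: leq_trans lj jm.
      rewrite big1 ?mulr0 // => b _; rewrite big1 // => i _.
      by rewrite subrr expr0n.
    have S0 : 0 <= \sum_l sqdist (gauss_seidel x.1 x'.1 j) x.1 l.
      by apply: sumr_ge0 => l _; exact: sqdist_ge0.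
    apply: le_trans (dist_sqr_le _ _) _; apply: le_trans (ler_wpM2r S0 NN) _.
    have : c * \sum_l sqdist (gauss_seidel x.1 x'.1 j) x.1 l <= c / N * (rho / 2) ^+ 2 by lra.
    by rewrite -mulrA ler_pM2l // mulrC ler_pdivlMr // mulrC.
  have [_ q0 h] := hq j.
  apply: le_trans (h x x' nx sx dx' _ _).
  - by apply: ler_wpM2r; [exact: sqdist_ge0|exact: hc].
  - apply: le_trans (hrho j); apply: le_trans (dist_triangle x.1 _ _) _; lra.
  - by apply: le_trans (hrho j); lra.
have S0 : 0 <= \sum_l sqdist x'.1 x.1 l by apply: sumr_ge0 => l _; exact: sqdist_ge0.
rewrite mulrAC ler_pdivrMr //.
apply: le_trans (ler_wpM2l (ltW c0) (dist_sqr_le _ _)) _.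
apply: le_trans (ler_wpM2l (ltW c0) (ler_wpM2r S0 NN)) _.
rewrite mulrCA mulrC ler_pM2r //; apply: le_trans incg.
by rewrite mulr_sumr; apply: ler_sum => j _; exact: block.
Qed.

End AlsIncrease.

(** * Definability of the constraints and the objective *)

Section Definability.
Variables (R : realType) (d t r : nat) (n : 'I_d -> nat) (A : tensor R n).
Local Notation EC := (ffun_ctx R (entry r n)).

Lemma definable_feasible : @definable R EC (fun x => feasible t (of_entries x)).
Proof.
have h1 : @definable R EC (fun x => forall (j : 'I_d) (i : 'I_r), (j < d - t)%N ->
    \sum_b x (mk_entry (n := n) (j := j) b i) * x (mk_entry b i) = 1).
  apply: definable_allfin => j; apply: definable_allfin => i.
  by apply: definable_imp; [exact: definable_cst|definable_auto].
have h2 : @definable R EC (fun x => forall j : 'I_d, (d - t <= j)%N -> forall i k : 'I_r,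
    \sum_b x (mk_entry (n := n) (j := j) b i) * x (mk_entry b k) = (i == k)%:R).
  apply: definable_allfin => j; apply: definable_imp; first exact: definable_cst.
  apply: definable_allfin => i; apply: definable_allfin => k; definable_auto.
apply: (definable_ext (definable_and h1 h2)) => x; rewrite /feasible; split=> -[g1 g2]; split.
- move=> j i hj; apply/enorm_eq1; rewrite -(g1 j i hj); apply: eq_bigr => b _.
  by rewrite !mxE expr2.
- move=> j hj; apply/matrixP => i k; rewrite !mxE -(g2 j hj i k); apply: eq_bigr => b _.
  by rewrite !mxE.
- move=> j i hj; have /enorm_eq1 <- := g1 j i hj; apply: eq_bigr => b _.
  by rewrite !mxE expr2.
- move=> j hj i k; have /matrixP/(_ i k) := g2 j hj; rewrite !mxE => <-.
  by apply: eq_bigr => b _; rewrite !mxE.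
Qed.

Lemma defun_objective (c : R) :
  @defun R EC (fun x => c - objective A (of_entries x)).
Proof.
apply: defun_poly; apply: polyfun_sub; first exact: polyfun_cst.
apply: (@polyfun_sum R EC) => i.
by rewrite (_ : (fun x => _) = fun x : EC => sigma A (of_entries x) i 0 * sigma A (of_entries x) i 0);
  [apply: polyfun_mul; exact: polyfun_sigma|apply/funext => x; rewrite expr2].
Qed.

End Definability.

(** * Convergence *)

Section StateTopology.
Variables (R : realType) (d r : nat) (n : 'I_d -> nat).
Local Notation factorsR := (factors R n r).
Local Notation state := (als_state R n r).

Lemma near_state (xs : state) (e : R) : 0 < e ->
  nbhs xs [set y : state | dist y.1 xs.1 < e /\ forall i, `|y.2 i 0 - xs.2 i 0| < e].
Proof.
move=> e0; pose N : R := #|entry r n|%:R + 1.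
have N0 : 0 < N by rewrite /N ltr_wpDl.
have eN : 0 < e / N by exact: divr_gt0.
have near1 (a : entry r n) : 
    nbhs xs [set y : state | `|entries y.1 a - entries xs.1 a| < e / N].
  have c : (fun y : state => (y.1 (tag a)) (tagged a).1 (tagged a).2) @ xs -->
      (xs.1 (tag a)) (tagged a).1 (tagged a).2.
    apply: (@continuous_comp _ _ _ (fun y : state => y.1 (tag a))
      (fun M : 'M[R]_(n (tag a), r) => M (tagged a).1 (tagged a).2)); last exact: coord_continuous.
    apply: (@continuous_comp _ _ _ (fst : state -> factorsR) (fun U : factorsR => U (tag a))).
      exact: cvg_fst.
    exact: (@proj_continuous _ (fun j : 'I_d => 'M[R]_(n j, r))).
  move/cvgrPdist_lt : c => /(_ _ eN); apply: filterS => y /=.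
  by rewrite distrC !ffunE.
have near2 (i : 'I_r) : nbhs xs [set y : state | `|y.2 i 0 - xs.2 i 0| < e].
  have c : (fun y : state => y.2 i 0) @ xs --> xs.2 i 0.
    apply: (@continuous_comp _ _ _ (snd : state -> 'cV[R]_r) (fun M : 'cV[R]_r => M i 0)).
      exact: cvg_snd.
    exact: coord_continuous.
  move/cvgrPdist_lt : c => /(_ _ e0); by apply: filterS => y /=; rewrite distrC.
have hA := filter_forall (nbhs_filter xs) near1.
have hB := filter_forall (nbhs_filter xs) near2.
apply: filterS (filterI hA hB) => y [hy hw].
split; last exact: hw.
apply: (@le_lt_trans _ _ (\sum_(a : entry r n) e / N)).
  by apply: ler_sum => a _; exact: ltW (hy a).
rewrite sumr_const -[_ *+ _]mulr_natl mulrCA -[X in _ < X]mulr1 ltr_pM2l //.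
by rewrite ltr_pdivrMr // mul1r /N ltrDl.
Qed.

Lemma cluster_state (x : nat -> state) (xs : state) : cluster (x @ \oo) xs ->
  forall (e : R) k0, 0 < e -> exists k, [/\ (k0 <= k)%N, dist (x k).1 xs.1 < e
    & forall i, `|(x k).2 i 0 - xs.2 i 0| < e].
Proof.
move=> hx e k0 e0.
have [|y [[k kk <-] [h1 h2]]] := hx [set x k | k in [set k | (k0 <= k)%N]] _ _ (near_state xs e0).
  by exists k0 => // k /= kk; exists k.
by exists k.
Qed.

Lemma cvg_state (x : nat -> state) (xs : state) :
  (forall e : R, 0 < e -> exists k0, forall k, (k0 <= k)%N -> dist (x k).1 xs.1 < e) ->
  (forall e : R, 0 < e -> exists k0, forall k, (k0 <= k)%N -> forall i, `|(x k).2 i 0 - xs.2 i 0| < e) ->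
  x @ \oo --> xs.
Proof.
case: xs => U w /= h1 h2.
rewrite (_ : x = fun k => ((x k).1, (x k).2)); last by apply/funext => k; case: (x k).
apply: (@cvg_pair _ _ _ _ (nbhs U) (nbhs w) _ _ _ (fun k => (x k).1) (fun k => (x k).2)); last first.
  apply/cvg_ballP => e e0; have [k0 h] := h2 e e0; exists k0 => // k /= kk.
  by split=> // i j; rewrite (ord1 j) /ball /= distrC; exact: h.
(* The product topology is the supremum of those induced by the projections, so convergence is
   tested one mode at a time. *)
apply/cvg_sup => j A /= [_ [[B Bop <-] Bfs sBfA]].
have c : (fun k => (x k).1 j) @ \oo --> (U j : 'M[R]_(n j, r)).
  apply/cvg_ballP => e e0; have [k0 h] := h1 e e0; exists k0 => // k /= kk.
  split=> // b i; rewrite /ball /= distrC; exact: le_lt_trans (dist_entry _ _ _ _) (h k kk).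
have [k0 _ hk] := c B (open_nbhs_nbhs (conj Bop Bfs)).
by exists k0 => // k /hk Bk; apply: sBfA.
Qed.

End StateTopology.

(** * From cluster point to limit *)

Section AlsConvergence.
Variables (R : realType) (d t r : nat) (n : 'I_d -> nat) (A : tensor R n).
Local Notation factorsR := (factors R n r).
Local Notation state := (als_state R n r).
Variables (delta : R) (x : nat -> state) (xs : state).
Hypotheses (delta0 : 0 < delta) (r0 : (0 < r)%N).
Hypothesis hx : als_sequence t A x.
Hypothesis hsigma : forall k i, delta <= `|sigma A (x k).1 i 0|.
Hypothesis hxs : cluster (x @ \oo) xs.
Hypothesis hrank : forall j : 'I_d, (d - t <= j)%N -> \rank (contractions A xs.1 j) = r.
Local Notation normalized := (@normalized R d t r n A delta).

Let als_step_k k : als_step t A (x k) (x k.+1).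
Proof. by case: hx. Qed.

Let normalized_k k : normalized (x k).
Proof.
case: k => [|k]; first by case: hx => h1 _ h2 _; split.
exact: (als_normalized delta0 (als_step_k k)).
Qed.

Let feasible_k k : feasible t (x k).1.
Proof. by case: (normalized_k k). Qed.

Let bounded1_k k : bounded1 (x k).1.
Proof. exact: feasible_bounded1 (feasible_k k). Qed.

Let near_k (e : R) : 0 < e -> exists k, dist (x k).1 xs.1 < e /\
  forall i, `|(x k).2 i 0 - xs.2 i 0| < e.
Proof. by move=> e0; have [k [_ h1 h2]] := cluster_state hxs 0 e0; exists k. Qed.

Let bounded1_xs : bounded1 xs.1.
Proof.
move=> j b i; apply/ler_addgt0Pr => e e0; have [k [hk _]] := near_k e0.
have := dist_entry (x k).1 xs.1 b i; have := bounded1_k k b i.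
have := ler_normB ((x k).1 j b i) ((x k).1 j b i - xs.1 j b i); rewrite subKr; lra.
Qed.

(** Serves to carry the constraints, written as polynomial equations, over to the cluster point: by
    the Lipschitz bound, iterates arbitrarily near it suffice. *)
Lemma closed_polyfun (p : {ffun entry r n -> R} -> R) (c : R) :
  @polyfun R (ffun_ctx R (entry r n)) p ->
  (forall k, p (entries (x k).1) = c) -> p (entries xs.1) = c.
Proof.
move=> pp hp; have [C C0 hC] := polyfun_lipschitz ler01 pp.
apply/eqP; rewrite -subr_eq0 -normr_le0; apply/ler_addgt0Pr => e e0; rewrite add0r.
have eC : 0 < e / (C + 1) by apply: divr_gt0 => //; lra.
have [k [hk _]] := near_k eC.
have [||_ h] := hC (entries xs.1) (entries (x k).1).
- by move=> a; rewrite ffunE; exact: bounded1_xs.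
- by move=> a; rewrite ffunE; exact: bounded1_k.
rewrite hp dist1C in h; apply: le_trans h _.
apply: (@le_trans _ _ (C * (e / (C + 1)))); first by apply: ler_wpM2l => //; exact: ltW.
by rewrite mulrA ler_pdivrMr; lra.
Qed.

Let feasible_xs : feasible t xs.1.
Proof.
have P j i k : @polyfun R (ffun_ctx R (entry r n))
    (fun y => \sum_b y (mk_entry (n := n) (j := j) b i) * y (mk_entry b k)).
  apply: (@polyfun_sum R (ffun_ctx R (entry r n))) => b.
  by apply: polyfun_mul; exact: polyfun_ffun.
have PE (U : factorsR) j i k :
    \sum_b entries U (mk_entry (n := n) (j := j) b i) * entries U (mk_entry b k) = ((U j)^T *m U j) i k.
  by rewrite mxE; apply: eq_bigr => b _; rewrite !ffunE mxE.
split=> [j i hj|j hj].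
  apply/enorm_eq1; rewrite -(closed_polyfun (P j i i) (c := 1)).
    by apply: eq_bigr => b _; rewrite !ffunE mxE expr2.
  move=> k; rewrite -[RHS](feasible_col j i (feasible_k k)).
  by apply: eq_bigr => b _; rewrite !ffunE expr2.
apply/matrixP => i k; rewrite -PE; apply: (closed_polyfun (P j i k)) => m.
by rewrite PE; have [_ ->] := feasible_k m.
Qed.

Let sigma_xs i : delta <= `|sigma A xs.1 i 0|.
Proof.
have [C C0 hC] := @lipschitz_sigma_contractions R d r n A.
apply/ler_addgt0Pr => e e0; have eC : 0 < e / C by exact: divr_gt0.
have [k [hk _]] := near_k eC.
have [/(_ i)[_ h] _] := hC _ _ (bounded1_k k) bounded1_xs.
have h2 : C * dist (x k).1 xs.1 <= e by rewrite mulrC -ler_pdivlMr // ltW.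
have h3 := hsigma k i.
have := ler_normD (sigma A xs.1 i 0) (sigma A (x k).1 i 0 - sigma A xs.1 i 0).
rewrite addrC subrK; lra.
Qed.

(** The comparison is with the normalized [sigma] at [xs.1] and not with [xs.2]; their equality is
    deduced from it in [weight_xs]. *)
Let weight_near : exists2 L : R, 0 < L & forall k i,
  `|(x k).2 i 0 - ((enorm (sigma A xs.1))^-1 *: sigma A xs.1) i 0| <= L * dist (x k).1 xs.1.
Proof.
have [C C0 hC] := @lipschitz_sigma_contractions R d r n A.
exists ((C + r%:R * C) / delta).
  by rewrite divr_gt0 // ltr_wpDr // mulr_ge0 // ltW.
move=> k i.
have nxs : normalized (xs.1, (enorm (sigma A xs.1))^-1 *: sigma A xs.1).
  by split=> //=.
apply: (weight_lipschitz delta0 r0 i nxs (normalized_k k)) => /=.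
move=> l; by have [/(_ l)[]] := hC _ _ (bounded1_k k) bounded1_xs.
Qed.

Let weight_xs : xs.2 = (enorm (sigma A xs.1))^-1 *: sigma A xs.1.
Proof.
have [L L0 hL] := weight_near.
apply/matrixP => i z; rewrite (ord1 z) {z}; apply/eqP; rewrite -subr_eq0 -normr_le0.
apply/ler_addgt0Pr => e e0; rewrite add0r.
have e1 : 0 < e / (L + 1) by apply: divr_gt0 => //; lra.
have [k [h1 h2]] := near_k e1.
have h3 := hL k i; have {}h2 := h2 i.
set w := _ *: _ in h3 *.
have h4 : L * dist (x k).1 xs.1 <= L * (e / (L + 1)) by rewrite ler_pM2l // ltW.
have h5 : L * (e / (L + 1)) + e / (L + 1) = e by field; rewrite gt_eqF //; lra.
have := ler_normD (xs.2 i 0 - (x k).2 i 0) ((x k).2 i 0 - w i 0).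
have h6 : `|xs.2 i 0 - (x k).2 i 0| = `|(x k).2 i 0 - xs.2 i 0| := distrC _ _.
rewrite addrA subrK; lra.
Qed.

Let normalized_xs : normalized xs.
Proof. by split; [exact: feasible_xs|exact: weight_xs|exact: sigma_xs]. Qed.

Let objective_le k : objective A (x k).1 <= objective A (x k.+1).1 /\
  2 * delta * (enorm (sigma A (x k.+1).1) - enorm (sigma A (x k).1)) <=
  objective A (x k.+1).1 - objective A (x k).1.
Proof.
have h : 0 <= enorm (sigma A (x k.+1).1) - enorm (sigma A (x k).1).
  apply: le_trans (sum_increase delta0 r0 (x k.+1) (normalized_k k)).
  apply: sumr_ge0 => j _; exact: (increase_ge0 delta0 (normalized_k k) (als_step_k k)).
have d1 := delta_le_enorm r0 (normalized_k k).
have d2 := delta_le_enorm r0 (normalized_k k.+1).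
rewrite -!objective_enorm.
have e : enorm (sigma A (x k.+1).1) ^+ 2 - enorm (sigma A (x k).1) ^+ 2 =
  (enorm (sigma A (x k.+1).1) + enorm (sigma A (x k).1)) *
  (enorm (sigma A (x k.+1).1) - enorm (sigma A (x k).1)) by ring.
rewrite e; split.
  by rewrite -subr_ge0 e; apply: mulr_ge0 => //; apply: addr_ge0; exact: enorm_ge0.
by apply: ler_wpM2r => //; lra.
Qed.

Let gap k := objective A xs.1 - objective A (x k).1.

Let gap_near : exists2 C : R, 0 < C & forall k, `|gap k| <= C * dist (x k).1 xs.1.
Proof.
have [C C0 hC] := @lipschitz_sigma_contractions R d r n A.
exists (r%:R * (C * (C + C))); first by rewrite !mulr_gt0 ?ltr0n //; lra.
move=> k; rewrite /gap /objective -sumrB; apply: le_trans (ler_norm_sum _ _ _) _.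
have -> : r%:R * (C * (C + C)) * dist (x k).1 xs.1 = \sum_(i < r) C * (C + C) * dist (x k).1 xs.1.
  by rewrite sumr_const card_ord -mulrA mulr_natl.
apply: ler_sum => i _.
have [/(_ i)[b1 h1] _] := hC _ _ bounded1_xs (bounded1_k k).
have [/(_ i)[b2 _] _] := hC _ _ (bounded1_k k) bounded1_xs.
rewrite subr_sqr normrM mulrAC distC; apply: ler_pM => //.
by apply: le_trans (ler_normD _ _) _; exact: lerD.
Qed.

Let gap_decr k : gap k.+1 <= gap k.
Proof. by rewrite /gap lerD2l lerN2; case: (objective_le k). Qed.

Let gap_mono k l : (k <= l)%N -> gap l <= gap k.
Proof.
move=> /subnKC <-; elim: (l - k)%N => [|m IH]; first by rewrite addn0.
by rewrite addnS; exact: le_trans (gap_decr _) IH.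
Qed.

Let gap_small (c : R) k0 : 0 < c -> exists2 k, (k0 <= k)%N & `|gap k| < c.
Proof.
move=> c0; have [C C0 hC] := gap_near.
have cC : 0 < c / C by exact: divr_gt0.
have [k [kk hk _]] := cluster_state hxs k0 cC; exists k => //.
by apply: le_lt_trans (hC k) _; rewrite mulrC -ltr_pdivlMr.
Qed.

(** A negative gap would persist by monotonicity, whereas arbitrarily small gaps recur near the
    cluster point. *)
Let gap_ge0 k : 0 <= gap k.
Proof.
rewrite leNgt; apply/negP => g0; have c0 : 0 < - gap k by lra.
have [l kl] := gap_small k c0; have := gap_mono kl.
by rewrite ltr_norml; lra.
Qed.

Let gap_lim (c : R) : 0 < c -> exists k0, forall k, (k0 <= k)%N -> gap k < c.
Proof.
move=> c0; have [k0 _ h] := gap_small 0 c0; exists k0 => k /gap_mono h'.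
by apply: le_lt_trans h' _; apply: le_lt_trans h; exact: ler_norm.
Qed.

Lemma als_factors_converge (c : R) : 0 < c ->
  exists k0, forall k, (k0 <= k)%N -> dist (x k).1 xs.1 < c.
Proof.
pose E (y : {ffun entry r n -> R}) := feasible t (of_entries y).
pose F (y : {ffun entry r n -> R}) := objective A xs.1 - objective A (of_entries y).
have bE y : E y -> forall a, `|y a| <= 1.
  by move=> /feasible_bounded1 hy [j [b i]]; have := hy j b i; rewrite of_entriesE.
have [e [psi [e0 psi0 psim psis hpsi]]] :=
  kurdyka_lojasiewicz (definable_feasible R t r n) (defun_objective r A (objective A xs.1)) bE.
have [C1 [C2 [C10 C20 hslope]]] := als_slope t A delta0 r0.
have [rho [a [eta [rho0 a0 eta0 hdec]]]] := als_sufficient_increase delta0 r0 bounded1_xs hrank.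
have d20 : 0 < 2 * delta by apply: mulr_gt0.
apply: (@kl_convergence R (entry r n) (fun k => entries (x k).1) (entries xs.1) gap psi
  (2 * delta * a) C1 e rho (2 * delta * eta)) => //; try exact: mulr_gt0.
- move=> k xr sk; have [_ h1] := objective_le k.
  have h2 : enorm (sigma A (x k.+1).1) - enorm (sigma A (x k).1) < eta.
    rewrite -(ltr_pM2l d20); apply: le_lt_trans h1 _.
    by apply: le_lt_trans sk; rewrite /gap lerD2r; have := gap_ge0 k.+1; rewrite /gap; lra.
  have h3 := hdec _ _ (normalized_k k) (als_step_k k) (hsigma k.+1) xr h2.
  rewrite -mulrA; apply: (@le_trans _ _ (objective A (x k.+1).1 - objective A (x k).1)).
    by apply: le_trans h1; rewrite ler_pM2l.
  by rewrite /gap; lra.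
- move=> k se; set D := dist1 _ _; set P := psi _ - psi _.
  have D0 : 0 <= D := dist1_ge0 _ _.
  have P0 : 0 <= P by rewrite /P subr_ge0; apply: psim.
  (* Level 0 lies outside the range of the slope inequality, but there the gap stays 0 by
     monotonicity. *)
  have [s0|s0] := ltP 0 (gap k.+1); last first.
    have g1 : gap k.+1 = 0 by apply/le_anti; rewrite s0 gap_ge0.
    have g2 : gap k.+2 = 0 by apply/le_anti; rewrite gap_ge0 andbT -g1 gap_decr.
    by rewrite g1 g2 subrr; nonneg.
  rewrite leNgt; apply/negP => hlt.
  (* [als_slope] makes every constant strictly above [C1 * D] a slope bound. A failure by [q] is
     refuted with the excess [q / (2 * (P + 1))], which also makes [m] positive and costs at most
     [q / 2]. *)
  set q := gap k.+1 - gap k.+2 - C1 * D * P; have q0 : 0 < q by rewrite /q; lra.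
  pose m := C1 * D + q / (2 * (P + 1)).
  have q1 : 0 < q / (2 * (P + 1)) by apply: divr_gt0 => //; apply: mulr_gt0; lra.
  have CD : 0 <= C1 * D by exact: mulr_ge0.
  have m0 : 0 < m by rewrite /m; lra.
  have sl : ascent_slope E F (entries (x k.+1).1) m.
    exists (q / (2 * (P + 1)) / (C2 + 1)); split; first by apply: divr_gt0 => //; lra.
    move=> y Ey yd.
    have dE : dist1 y (entries (x k.+1).1) = dist (of_entries y) (x k.+1).1.
      by rewrite /dist of_entriesK.
    have h := hslope _ _ _ (normalized_k k) (als_step_k k) (hsigma k.+1) Ey.
    rewrite -dE in h; rewrite /F entriesK.
    apply: (@le_trans _ _ (objective A (x k.+1).1 - objective A (of_entries y))); first by lra.
    apply: le_trans h _; apply: ler_wpM2r; first exact: dist1_ge0.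
    rewrite /m -/(dist (x k.+1).1 (x k).1) lerD2l.
    have y0 := dist1_ge0 y (entries (x k.+1).1).
    move: yd; rewrite ltr_pdivlMr; last by lra.
    by rewrite mulrDr mulr1 [C2 * _]mulrC; lra.
  have h : gap k.+1 - gap k.+2 <= m * P.
    apply: (hpsi _ _ (entries (x k.+1).1)) => //.
    - by rewrite /E entriesK.
    - by rewrite entriesK.
  have : m * P <= C1 * D * P + q / 2.
    rewrite /m mulrDl lerD2l -mulrA ler_pM2l // invfM -mulrA ler_piMr //.
    by rewrite mulrC ler_pdivrMr; lra.
  by move: h; rewrite /q; lra.
- by move=> c' k0 c0; have [k [kk h _]] := cluster_state hxs k0 c0; exists k.
Qed.

Lemma als_converges : x @ \oo --> xs.
Proof.
apply: cvg_state; first exact: als_factors_converge.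
move=> e e0; have [L L0 hL] := weight_near.
have eL : 0 < e / L by exact: divr_gt0.
have [k0 hk0] := als_factors_converge eL; exists k0 => k kk i.
rewrite weight_xs; apply: le_lt_trans (hL k i) _.
by rewrite mulrC -ltr_pdivlMr // hk0.
Qed.

Let cvg_of_dist (u : nat -> R) (l C : R) : 0 <= C ->
  (forall k, `|u k - l| <= C * (dist (x k).1 xs.1 + dist (x k.+1).1 xs.1)) ->
  u @ \oo --> l.
Proof.
move=> C0 hu; apply/cvgrPdist_le => e e0.
have eC : 0 < e / (2 * (C + 1)) by apply: divr_gt0 => //; lra.
have [k0 hk0] := als_factors_converge eC; exists k0 => // k /= kk.
rewrite distrC; apply: le_trans (hu k) _.
have h1 := hk0 k kk; have h2 := hk0 k.+1 (leqW kk).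
have h3 : C * (dist (x k).1 xs.1 + dist (x k.+1).1 xs.1) <= C * (e / (2 * (C + 1)) + e / (2 * (C + 1))).
  by apply: ler_wpM2l => //; lra.
apply: le_trans h3 _.
have -> : C * (e / (2 * (C + 1)) + e / (2 * (C + 1))) = e * (C / (C + 1)).
  by field; rewrite gt_eqF //; lra.
by apply: ler_piMr; [exact: ltW|rewrite ler_pdivrMr; lra].
Qed.

Let cvg_sum_fin (I : finType) (u : I -> nat -> R) (l : I -> R) :
  (forall i, u i @ \oo --> l i) -> (fun k => \sum_i u i k) @ \oo --> \sum_i l i.
Proof.
move=> h; elim: (index_enum I) => [|i s IH].
  by rewrite big_nil; under eq_fun do rewrite big_nil; exact: cvg_cst.
by rewrite big_cons; under eq_fun do rewrite big_cons; exact: cvgD.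
Qed.

(** The norms and polar factors in the updates are inner products of old data with new vectors,
    hence pass to the limit. Consecutive iterates have the same limit, so the intermediate points of
    a sweep converge to [xs.1] too. *)
Lemma als_limit_kkt : kkt_point t A xs.
Proof.
pose W (j : 'I_d) (b : 'I_(n j)) (i : 'I_r) := xs.2 i 0 * contractions A xs.1 j b i.
pose V k (j : 'I_d) := als_vtilde A (x k) (x k.+1).1 j.
have cU j b i : (fun k => (x k.+1).1 j b i) @ \oo --> xs.1 j b i.
  apply: (@cvg_of_dist _ _ 1) => // k; rewrite mul1r.
  by apply: le_trans (dist_entry _ _ _ _) _; rewrite lerDr dist_ge0.
have cV j b i : (fun k => V k j b i) @ \oo --> W j b i.
  have [C C0 hC] := @lipschitz_sigma_contractions R d r n A.
  have [L L0 hL] := weight_near.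
  rewrite (_ : (fun k => V k j b i) = (fun k => (x k).2 i 0) \*
     (fun k => contractions A (gauss_seidel (x k).1 (x k.+1).1 j) j b i)); last first.
    by apply/funext => k; rewrite /V mxE.
  apply: cvgM.
    apply: (@cvg_of_dist _ _ L) => [|k]; first exact: ltW.
    rewrite weight_xs; apply: le_trans (hL k i) _; rewrite ler_pM2l // lerDl.
    exact: dist_ge0.
  apply: (@cvg_of_dist _ _ C) => [|k]; first exact: ltW.
  have bg := bounded1_gauss_seidel j (bounded1_k k) (bounded1_k k.+1).
  have [_ /(_ j b i)[_ h]] := hC _ _ bg bounded1_xs.
  apply: le_trans h _; rewrite ler_pM2l // -{1}(gauss_seidelxx xs.1 j).
  exact: dist_gauss_seidel.
have WE j b i : W j b i = xs.2 i 0 * Defs.contract A j (fun l => col i (xs.1 l)) b 0 by rewrite /W mxE.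
suff : kkt_point t A (xs.1, xs.2) by rewrite -surjective_pairing.
split; last exact: weight_xs.
- apply/eqP => /matrixP /(_ (Ordinal r0) 0) h; have := sigma_xs (Ordinal r0).
  by rewrite h mxE normr0 leNgt delta0.
- move=> j i hj; split; first by case: feasible_xs => h _; exact: h.
  (* The weight has to be cancelled: the KKT equation for unit vectors does not contain it. *)
  have w0 : xs.2 i 0 != 0.
    have := weight_ge delta0 r0 normalized_xs i (lexx _).
    by move=> h; rewrite -normr_gt0; apply: lt_le_trans h;
      rewrite divr_gt0 // (enorm_gt0 delta0 r0 normalized_xs).
  (* The normalizing norm is written as the inner product of the column with the new unit vector. *)
  have lim b : W j b i = (\sum_b' W j b' i * xs.1 j b' i) * xs.1 j b i.
    have c2 : (fun k => V k j b i) @ \oo --> (\sum_b' W j b' i * xs.1 j b' i) * xs.1 j b i.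
      rewrite (_ : (fun k => V k j b i) = (fun k => \sum_b' V k j b' i * (x k.+1).1 j b' i) \*
         (fun k => (x k.+1).1 j b i)).
        apply: cvgM; last exact: cU.
        by apply: cvg_sum_fin => b'; apply: cvgM; [exact: cV|exact: cU].
      apply/funext => k /=.
      have [l0 hV] := als_spherical delta0 (als_step_k k) (hsigma k.+1) i hj.
      rewrite /V hV; congr (_ * _).
      rewrite (eq_bigr (fun b' =>
        enorm (col i (als_vtilde A (x k) (x k.+1).1 j)) * (x k.+1).1 j b' i ^+ 2)).
        by rewrite -mulr_sumr (feasible_col j i (feasible_k k.+1)) mulr1.
      by move=> b' _; rewrite hV expr2 mulrA.
    exact: (norm_cvg_unique (cV j b i) c2).
  apply/matrixP => b z; rewrite (ord1 z) [RHS]mxE [col _ _ b 0]mxE; apply: (mulfI w0).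
  rewrite -WE lim mulrA (sigma_contractions A xs.1 j) mulr_sumr; congr (_ * _).
  by apply: eq_bigr => b' _; rewrite /W mulrA.
- move=> j hj; split; first by case: feasible_xs => _; exact.
  (* The multiplier is the limit of the polar factors, each recovered as [U^T V] up to
     transposition, and inherits their symmetry. *)
  pose L : 'M[R]_r := \matrix_(i, s) \sum_b xs.1 j b s * W j b i.
  pose G k (i s : 'I_r) := \sum_b (x k.+1).1 j b s * V k j b i.
  have cG i s : (fun k => G k i s) @ \oo --> L i s.
    by rewrite mxE; apply: cvg_sum_fin => b; apply: cvgM; [exact: cU|exact: cV].
  have GE k : exists H : 'M[R]_r, [/\ H^T = H, V k j = (x k.+1).1 j *m H & forall i s, G k i s = H s i].
    have [_ /(_ j hj)[UU [H [[HT _] VH]]] _] := als_step_k k.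
    exists H; split=> // i s; have -> : H = ((x k.+1).1 j)^T *m V k j by rewrite /V VH mulmxA UU mul1mx.
    by rewrite [RHS]mxE; apply: eq_bigr => b _; rewrite [_^T s b]mxE.
  exists L; split.
    apply/matrixP => i s; rewrite mxE.
    apply: (norm_cvg_unique (cG s i)).
    rewrite (_ : (fun k => G k s i) = fun k => G k i s); first exact: cG.
    apply/funext => k; have [H [HT _ h]] := GE k.
    by rewrite !h -{1}HT mxE.
  move=> i; apply/matrixP => b z; rewrite (ord1 z) mxE -WE summxE.
  apply: (norm_cvg_unique (cV j b i)).
  rewrite (_ : (fun k => V k j b i) = fun k => \sum_s G k i s * (x k.+1).1 j b s).
    rewrite (_ : \sum_s _ = \sum_s L i s * xs.1 j b s); last first.
      by apply: eq_bigr => s _; rewrite !mxE.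
    by apply: cvg_sum_fin => s; apply: cvgM; [exact: cG|exact: cU].
  apply/funext => k; have [H [_ VH h]] := GE k.
  rewrite VH mxE; apply: eq_bigr => s _; by rewrite h mulrC.
Qed.

End AlsConvergence.

Theorem theorem4p7 (R : realType) (d t r : nat) (n : 'I_d -> nat)
    (hd : (1 <= d)%N) (ht : (1 <= t <= d)%N) (hr : (1 <= r)%N)
    (hn : forall j : 'I_d, (d - t <= j)%N -> (r <= n j)%N)
    (A : tensor R n) (x : nat -> als_state R n r)
    (hx : als_sequence t A x)
    (delta : R) (hdelta : 0 < delta)
    (hsigma : forall (k : nat) (i : 'I_r), delta <= `|sigma A (x k).1 i 0|)
    (xs : als_state R n r)
    (hxs : cluster (x @ \oo) xs)
    (hrank : forall j : 'I_d, (d - t <= j)%N ->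
       \rank (contractions A xs.1 j) = r) :
  x @ \oo --> xs /\ kkt_point t A xs.
Proof.
split; first exact: (als_converges hdelta hr hx hsigma hxs hrank).
exact: (als_limit_kkt hdelta hr hx hsigma hxs hrank).
Qed.
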